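(* Let $r>d/2$, $s>0$, and let $\beta=2r/d$. There is a constant $C>0$, independent of $n$, $\delta$ and the learning method, such that the following holds. For every learning method $\hat f$ (a map assigning to each sample $\{(X_i,Y_i)\}_{i=1}^n$ a measurable function $\hat f:\mathcal{X}\to\mathbb{R}$) and every fixed $\delta\in(0,1)$, when $n$ is sufficiently large, there is a distribution $\rho\in\mathcal{P}$ (so in particular $f^*_\rho\in[H^r(\mathcal{X})]^s$) such that, with probability at least $1-\delta$ over $n$ i.i.d. samples from $\rho$, $$\mathcal{E}(\hat f)\ \ge\ C\,\delta\, n^{-\frac{s\beta}{2(s\beta+1)}} .$$
   Context: $\mathcal{X}\subset\mathbb{R}^d$ is compact, the closure of a bounded domain with smooth boundary. A distribution $\rho$ on $\mathcal{X}\times\{-1,1\}$ has marginal $\mu$ on $\mathcal{X}$, conditional probability $\eta(x)=\mathbb{P}(Y=1\mid X=x)$, and Bayes classifier function $f^*_\rho=2\eta-1$. For $f:\mathcal{X}\to\mathbb{R}$ the classification risk is $\mathcal{L}(f)=\mathbb{P}_{(X,Y)\sim\rho}[\operatorname{sign}(f(X))\ne Y]=\mathbb{E}_X[(1-\eta(X))\mathbb{I}\{f(X)\ge 0\}+\eta(X)\mathbb{I}\{f(X)<0\}]$, and the classification excess risk is $\mathcal{E}(f)=\mathcal{L}(f)-\mathcal{L}(f^*_\rho)$. Sobolev spaces: for integer $m\ge 0$, $H^m(\mathcal{X})=W^{m,2}(\mathcal{X})$ is the usual Sobolev space, with $H^0=L^2$; for real $r>0$, $H^r(\mathcal{X})=(L^2(\mathcal{X}),H^m(\mathcal{X}))_{r/m,2}$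 is the real interpolation space with $m=\min\{k\in\mathbb{N}:k>r\}$. For $r>d/2$, $H^r(\mathcal{X})$ is a separable RKHS with bounded kernel, whose eigenvalues (with respect to Lebesgue measure) satisfy $\lambda_j\asymp j^{-\beta}$ with $\beta=2r/d$. Interpolation spaces: for an RKHS $\mathcal{H}$ whose kernel has Mercer expansion $\sum_j\lambda_j e_j(x)e_j(x')$ with $\{e_j\}$ orthonormal in $L^2$, $[\mathcal{H}]^s=\{\sum_j a_j\lambda_j^{s/2}e_j:\sum_j a_j^2<\infty\}$ with norm $\|\sum_j a_j\lambda_j^{s/2}e_j\|_{[\mathcal{H}]^s}=(\sum_j a_j^2)^{1/2}$. Under Lebesgue measure, $[H^r(\mathcal{X})]^s=H^{rs}(\mathcal{X})$. The class $\mathcal{P}$: fix constants $B>0$ and $0<\mu_{\min}\le\mu_{\max}$ for which probability densities on $\mathcal{X}$ with values in $[\mu_{\min},\mu_{\max}]$ exist. $\mathcal{P}$ is the set of all distributions $\rho$ on $\mathcal{X}\times\{-1,1\}$ whose marginal has a density (with respect to Lebesgue measure) with values in $[\mu_{\min},\mu_{\max}]$ and whose Bayes classifier function satisfies $f^*_\rho\in[H^r(\mathcal{X})]^s$ with $\|f^*_\rho\|_{[H^r(\mathcal{X})]^s}\le B$. *)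

(* Defs.v *)
From HB Require Import structures.
From mathcomp Require Import all_boot all_order all_algebra.
From mathcomp Require Import all_classical all_reals all_analysis.

Set Implicit Arguments.
Unset Strict Implicit.
Unset Printing Implicit Defensive.
Import Order.TTheory GRing.Theory Num.Theory.
Import numFieldNormedType.Exports.
Local Open Scope classical_set_scope.
Local Open Scope ring_scope.
Local Open Scope ereal_scope.

Section measure_power.
Context d (T : measurableType d) (R : realType).

Definition tcons n (z : T * n.-tuple T) : n.+1.-tuple T :=
  [the n.+1.-tuple T of z.1 :: z.2].

Lemma measurable_tcons n : measurable_fun [set: T * n.-tuple T] (@tcons n).
Proof.
exact: (measurable_cons (@measurable_fst _ _ _ _) (@measurable_snd _ _ _ _)).
Qed.

Section step.
Context n (m : {sigma_finite_measure set T -> \bar R})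
  (mn : {sigma_finite_measure set (n.-tuple T) -> \bar R}).

Definition mstep : set (n.+1.-tuple T) -> \bar R :=
  fun A => (m \x mn) (@tcons n @^-1` A).

Let mstep0 : mstep set0 = 0.
Proof. by rewrite /mstep preimage_set0 measure0. Qed.

Let mstep_ge0 A : 0 <= mstep A.
Proof. exact: measure_ge0. Qed.

Let mstep_sigma_additive : semi_sigma_additive mstep.
Proof.
pose P := measure_function_pushforward__canonical__measure_function_Measure
  (m \x mn) (@measurable_tcons n).
exact: (@measure_semi_sigma_additive _ _ _ P).
Qed.

HB.instance Definition _ := isMeasure.Build _ _ _ mstep
  mstep0 mstep_ge0 mstep_sigma_additive.

Let mstep_sigma_finite : sigma_finite setT mstep.
Proof.
have /sigma_finiteP[F [TF ndF Foo]] := sigma_finiteT m.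
have /sigma_finiteP[G [TG ndG Goo]] := sigma_finiteT mn.
pose g (t : n.+1.-tuple T) : T * n.-tuple T := (thead t, [tuple of behead t]).
have gK : cancel (@tcons n) g.
  by move=> [x t]; rewrite /g /tcons; congr pair; exact: val_inj.
have mg : measurable_fun setT g.
  apply/measurable_fun_pairP; split; first exact: measurable_tnth.
  exact: measurable_behead.
exists (fun k => g @^-1` (F k `*` G k)).
  rewrite predeqE => t; split => // _.
  have : setT (g t).1 by [].
  rewrite TF => -[i _ Fi]; have : setT (g t).2 by [].
  rewrite TG => -[j _ Gj]; exists (maxn i j) => //; split.
    by move: Fi; exact/subsetPset/ndF/leq_maxl.
  by move: Gj; exact/subsetPset/ndG/leq_maxr.
move=> k; have [mF Fk] := Foo k; have [mG Gk] := Goo k; split.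
  by rewrite -[X in measurable X]setTI; apply: mg => //; exact: measurableX.
rewrite /mstep -comp_preimage (_ : _ \o _ = id); last exact/funext.
by rewrite preimage_id product_measure1E// lte_mul_pinfty// ge0_fin_numE.
Qed.

HB.instance Definition _ :=
  Measure_isSigmaFinite.Build _ _ _ mstep mstep_sigma_finite.

End step.

(* [mpow m n] is the n-fold product of m: the joint law of n i.i.d. draws when
   m is a probability. *)
Fixpoint mpow (m : {sigma_finite_measure set T -> \bar R}) n :
    {sigma_finite_measure set (n.-tuple T) -> \bar R} :=
  if n is n'.+1 then mstep m (mpow m n') else \d_[tuple].

End measure_power.

(* The product sigma-algebra on row vectors, as for tuples; for T = R it is the
   Borel one. *)
Section measurable_rV.
Context d (T : sigmaRingType d) (n : nat).

Let coors : 'I_n -> 'rV[T]_n -> T := fun i x => x ord0 i.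

Let rV_set0 : g_sigma_preimage coors set0.
Proof. exact: sigma_algebra0. Qed.

Let rV_setC A : g_sigma_preimage coors A -> g_sigma_preimage coors (~` A).
Proof. exact: sigma_algebraC. Qed.

Let rV_bigcup (F : _^nat) : (forall i, g_sigma_preimage coors (F i)) ->
  g_sigma_preimage coors (\bigcup_i (F i)).
Proof. exact: sigma_algebra_bigcup. Qed.

HB.instance Definition _ := @isMeasurable.Build (measure_tuple_display d)
  'rV[T]_n (g_sigma_preimage coors) rV_set0 rV_setC rV_bigcup.

End measurable_rV.

Section lebesgue_rV.
Context (R : realType) (n : nat).

Definition rV_of_tuple (t : n.-tuple (measurableTypeR R)) : 'rV[R]_n :=
  \row_i tnth t i.

Lemma measurable_rV_of_tuple : measurable_fun setT rV_of_tuple.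
Proof.
move=> _ Y mY; rewrite setTI; move: Y mY; apply: smallest_sub.
  split=> /=.
  - by rewrite preimage_set0; exact: measurable0.
  - by move=> A mA; rewrite setTD preimage_setC; exact: measurableC.
  - by move=> F mF; rewrite preimage_bigcup; exact: bigcupT_measurable.
move=> A; rewrite -bigcup_seq => -[i _ [B mB <-]]; rewrite setTI.
rewrite /= -comp_preimage (_ : _ \o _ = fun t => tnth t i).
  by rewrite -[X in measurable X]setTI; exact: measurable_tnth.
by apply/funext => t /=; rewrite mxE.
Qed.

(* Lebesgue measure on R^n. *)
Definition leb : set 'rV[R]_n -> \bar R :=
  fun A => mpow (@lebesgue_measure R) n (rV_of_tuple @^-1` A).

Let leb0 : leb set0 = 0.
Proof. by rewrite /leb preimage_set0 measure0. Qed.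

Let leb_ge0 A : 0 <= leb A.
Proof. exact: measure_ge0. Qed.

Let leb_sigma_additive : semi_sigma_additive leb.
Proof.
pose P := measure_function_pushforward__canonical__measure_function_Measure
  (mpow (@lebesgue_measure R) n) measurable_rV_of_tuple.
exact: (@measure_semi_sigma_additive _ _ _ P).
Qed.

HB.instance Definition _ := isMeasure.Build _ _ _ leb
  leb0 leb_ge0 leb_sigma_additive.

End lebesgue_rV.

Local Close Scope ereal_scope.

Section smooth.
Context (R : realType) (d : nat).
Implicit Types (f : 'rV[R]_d -> R) (Omega : set 'rV[R]_d).

Definition partial (i : 'I_d) f : 'rV[R]_d -> R :=
  fun x => 'D_(delta_mx ord0 i) f x.

Definition smooth f := forall l : seq 'I_d,
  continuous (foldr partial f l) /\
  forall i x, derivable (foldr partial f l) x (delta_mx ord0 i).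

Definition test_fun Omega f := smooth f /\
  exists K, [/\ compact K, K `<=` Omega & forall x, ~ K x -> f x = 0].

End smooth.

(* Near each boundary point, Omega is one side of the graph of a smooth function
   of the coordinates other than the i-th; [b] is the orientation. *)
Definition smooth_boundary (R : realType) (d : nat) (Omega : set 'rV[R]_d) :=
  forall x, (closure Omega `\` Omega) x ->
  exists (i : 'I_d) (b : bool) (g : 'rV[R]_d.-1 -> R) (eps : R),
    [/\ 0 < eps, smooth g &
        forall y, ball x eps y ->
          (Omega y <-> g (col' i y) < (-1) ^+ b * y ord0 i)].

Definition smooth_bounded_domain (R : realType) (d : nat)
    (Omega : set 'rV[R]_d) :=
  [/\ Omega !=set0, open Omega, connected Omega, bounded_set Omega
    & smooth_boundary Omega].

Section sobolev.
Context (R : realType) (d : nat) (Omega : set 'rV[R]_d).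
Let X := closure Omega.
Implicit Types f g h : 'rV[R]_d -> R.

Definition L2sq f : \bar R := \int[@leb R d]_(x in X) ((f x) ^+ 2)%:E.

Definition L2 f := measurable_fun X f /\ (L2sq f < +oo)%E.

Definition L2dot f g : R := \int[@leb R d]_(x in X) (f x * g x).

Definition multi m := {ffun 'I_d -> 'I_m.+1}.

Definition msize m (al : multi m) : nat := (\sum_i al i)%N.

Definition mpartial m (al : multi m) f : 'rV[R]_d -> R :=
  foldr (fun i => iter (al i) (partial i)) f (enum 'I_d).

Definition weak_derivative m (al : multi m) g h := forall phi,
  test_fun Omega phi ->
  L2dot g (mpartial al phi) = (-1) ^+ msize al * L2dot h phi.

(* The squared norm of W^{m,2}, the sum over |al| <= m of the squared L^2 norms
   of the weak derivatives. These are unique a.e., so that the infimum ranges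
   over a single value; it is +oo outside W^{m,2}. *)
Definition sobolev_sq m g : \bar R :=
  ereal_inf [set (\sum_(al : multi m | (msize al <= m)%N) L2sq (h al))%E
            | h in [set h : multi m -> 'rV[R]_d -> R |
                forall al, (msize al <= m)%N ->
                  L2 (h al) /\ weak_derivative al g (h al)]].

(* Squared K-functional of the couple (L^2, W^{m,2}), in its quadratic form
   K(t,f)^2 = inf_g |f - g|^2 + t^2 |g|^2, which lies within a factor 2 of
   (inf_g |f - g| + t |g|)^2 and yields a Hilbert norm. *)
Definition Ksq m (t : R) f : \bar R :=
  ereal_inf [set (L2sq (f \- g)%R + (t ^+ 2)%:E * sobolev_sq m g)%E | g in L2].

(* Squared norm of (L^2, W^{m,2})_{theta,2}: the integral over (0,+oo) of
   (t^{-theta} K(t,f))^2 dt/t. *)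
Definition interp_sq m (theta : R) f : \bar R :=
  \int[lebesgue_measure]_(t in `]0%R, +oo[)
    ((t `^ (- (2 * theta) - 1))%:E * Ksq m t f)%E.

(* [Hsq r] is the squared norm of H^r = (L^2, H^m)_{r/m,2}, where
   m = min {k | r < k} is the integer part of r plus one. *)
Definition Hsq (r : R) f : \bar R :=
  let m := (Num.truncn r).+1 in interp_sq m (r / m%:R) f.

(* For r > d/2 every class in H^r has a unique continuous representative; this is
   H^r as a space of functions on X. *)
Definition HrRKHS (r : R) f :=
  [/\ L2 f, {within X, continuous f} & (Hsq r f < +oo)%E].

(* The inner product of H^r, by polarization of its norm. *)
Definition Hdot (r : R) f g : R :=
  (fine (Hsq r (f \+ g)) - fine (Hsq r (f \- g))) / 4.

Definition reproducing_kernel (r : R) (k : 'rV[R]_d -> 'rV[R]_d -> R) :=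
  forall x, X x -> HrRKHS r (k x) /\
    forall f, HrRKHS r f -> Hdot r f (k x) = f x.

End sobolev.

Section power_space.
Context (R : realType) (d : nat) (Omega : set 'rV[R]_d).
Let X := closure Omega.
Variables (lam : nat -> R) (e : nat -> 'rV[R]_d -> R).

Definition mercer_expansion (k : 'rV[R]_d -> 'rV[R]_d -> R) :=
  [/\ forall j, 0 < lam j,
      forall j, L2 Omega (e j),
      forall i j, L2dot Omega (e i) (e j) = (i == j)%:R &
      forall x y, X x -> X y ->
        \sum_(j < N) lam j * e j x * e j y @[N --> \oo] --> k x y].

(* f = \sum_j a_j lam_j^{s/2} e_j in L^2(X), with a square summable. *)
Definition power_expansion (s : R) f (a : nat -> R) :=
  [/\ cvgn (series (fun j => a j ^+ 2)), L2 Omega f &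
      L2sq Omega (fun x => f x - \sum_(j < N) a j * lam j `^ (s / 2) * e j x)
        @[N --> \oo] --> 0%E].

Definition power_space (s : R) : set ('rV[R]_d -> R) :=
  [set f | exists a, power_expansion s f a].

(* The coefficients a are unique, so that the infimum ranges over one value. *)
Definition power_norm (s : R) f : \bar R :=
  ereal_inf [set (Num.sqrt (limn (series (fun j => a j ^+ 2))))%:E
            | a in power_expansion s f].

End power_space.

(* The label 1 is encoded by true, the label -1 by false. *)

Section classification.
Context (R : realType) (d : nat) (Omega : set 'rV[R]_d).
Let X := closure Omega.
Implicit Types rho : probability ('rV[R]_d * bool)%type R.

Definition prob_density (mumin mumax : R) (p : 'rV[R]_d -> R) :=
  [/\ measurable_fun X p,
      forall x, X x -> mumin <= p x <= mumax &
      (\int[@leb R d]_(x in X) (p x)%:E = 1)%E].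

Definition marginal rho : set 'rV[R]_d -> \bar R :=
  pushforward rho fst.

(* Since p integrates to 1 over X, rho is concentrated on X * {-1,1}. *)
Definition has_density rho (p : 'rV[R]_d -> R) :=
  forall A, measurable A ->
    marginal rho A = (\int[@leb R d]_(x in A `&` X) (p x)%:E)%E.

(* eta is a version of x |-> P(Y = 1 | X = x). *)
Definition cond_prob rho (eta : 'rV[R]_d -> R) :=
  [/\ measurable_fun X eta, forall x, X x -> 0 <= eta x <= 1 &
      forall A, measurable A ->
        rho (A `*` [set true]) = (\int[marginal rho]_(x in A `&` X) (eta x)%:E)%E].

Definition bayes (eta : 'rV[R]_d -> R) : 'rV[R]_d -> R :=
  fun x => 2 * eta x - 1.

(* sign u = 1 iff 0 <= u. *)
Definition risk rho (f : 'rV[R]_d -> R) : R :=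
  fine (rho [set z | X z.1 /\ (0 <= f z.1) != z.2]).

Definition excess_risk rho eta f : R := risk rho f - risk rho (bayes eta).

Definition distr_class lam e (s B mumin mumax : R) rho eta :=
  [/\ exists2 p, prob_density mumin mumax p & has_density rho p,
      cond_prob rho eta,
      power_space Omega lam e s (bayes eta) &
      (power_norm Omega lam e s (bayes eta) <= B%:E)%E].

(* A learning method, given for all sample sizes; only its values on X and on
   samples from X * {-1,1} are relevant. *)
Definition learning_method
    (fhat : forall n, n.-tuple ('rV[R]_d * bool)%type -> 'rV[R]_d -> R) :=
  forall n (S : n.-tuple ('rV[R]_d * bool)%type),
    (forall i, X (tnth S i).1) -> measurable_fun X (fhat n S).

End classification.

(* Main.v *)
Require Import Defs.
From HB Require Import structures.
From mathcomp Require Import all_boot all_order all_algebra.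
From mathcomp Require Import all_classical all_reals all_analysis.
From mathcomp Require Import measurable_realfun.
From mathcomp Require Import ring lra zify.
Set Implicit Arguments.
Unset Strict Implicit.
Unset Printing Implicit Defensive.
Import Order.TTheory GRing.Theory Num.Theory.
Import numFieldNormedType.Exports.
Local Open Scope classical_set_scope.
Local Open Scope ring_scope.

(** A lower bound by the hypercube method, in the form of a change of measure.

    Hypotheses. The marginal is uniform on X; its density lies in [mumin, mumax] as soon as some
    density does ([density_volume]). A cube in Omega is cut into N^d cells of side 1/a, each
    carrying a smooth bump, and to signs sigma_j in {-1, 1} corresponds the sum g of the bumps
    with the coefficients A sigma_j, where A is a small multiple of a^(-rs). By scaling, the
    squared norm of g in H^r is O(A^2 a^(2r)) ([bump_sum_Hsq]). The Bayes function is g, or an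
    approximation f of g.

    Statistics. With respect to a uniform point with a fair coin, the hypothesis of f has the
    density 1 + y f(x), and the n-fold likelihood ratio has the second moment
    (1 + |f|^2 / |X|)^n <= (1 + A^2)^n. It is at most (21/20)^(N^d) if n A^2 is a small multiple
    of N^d; this allows a of the order of n^(1/(2rs+d)). A classifier casts a vote on the sign of
    each cell, and its excess risk is at least a constant times A unless the votes are wrong on
    less than an eighth of the cells ([excess_risk_ge]). For a given sample only an exponentially
    small part of the sign vectors is that close to the votes ([hamming_ball_card]), so that the
    average over all sign vectors of the probability of this event is exponentially small for fair
    coins, and still is when each sign vector is given its own probability, since the likelihood
    ratios have a small second moment ([average_change_of_measure], [hypercube_lower_bound]).
    Hence for n large some sign vector makes the excess risk at least a constant times
    A ~ n^(-rs/(2rs+d)) with probability at least 1 - delta, and rs/(2rs+d) is the exponent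
    s beta / (2 (s beta + 1)) for beta = 2r/d.

    Membership in [H^r]^s. This space is defined by the given Mercer expansion (lam_j, e_j). Two
    facts on f in H^r suffice: sum_j <f, e_j>^2 / lam_j <= |f|_H^2 ([coef_sum_le]) and the
    convergence of the expansion of f in L^2 ([expansion_cvg]). If s <= 1 they bound the norm of g
    in [H^r]^s by interpolation; if s > 1, f is the part of the expansion of g where lam_j is at
    least tau, a small multiple of a^(-2r): it has the norm required, and up to an arbitrarily
    small error |f - g|^2 is at most tau |g|_H^2, a small multiple of A^2 ([spectral_approx]).

    Both facts are cases of <b, f>^2 <= |f|_H^2 sum_j lam_j <b, e_j>^2 for b in L^2
    ([L2dot_reproducing]). For a discrete measure in place of b this is the Cauchy-Schwarz
    inequality in the kernel space ([reproducing_discrete]): the norm of H^r comes from an inner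
    product, because the parallelogram law survives the infima and the integral in its definition
    ([qinf_parallelogram]). Applied to n random uniform points and averaged, it gives the integral
    version as n grows, once the terms on the diagonal are bounded.

    This bound is the embedding f(x)^2 <= K |f|_H^2 ([sup_bound]), where r > d/2 and the smooth
    boundary enter. Every point x of Omega is the vertex of a cone in Omega of a size independent
    of x ([uniform_cone]); product kernels supported in the cone at distance rho from x test f,
    and their differences between the scales rho and rho/2 are sums of derivatives of order m of
    functions smaller than the kernels by a factor rho^m, which a decomposition of f as in the
    K-functional turns into summable bounds ([cone_step]). *)

(** * Smooth functions of one variable *)

Section smooth1.
Context {R : realType}.
Implicit Types u v : R -> R.

Definition der u u' := forall x : R, is_derive x 1 u (u' x).

(** The derivatives are quantified existentially rather than computed, so that closure under
    the algebraic operations is a plain induction on n. *)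
Fixpoint nder n u := if n is n'.+1 then exists2 u', der u u' & nder n' u' else True.

Definition smooth1 u := forall n, nder n u.

Lemma der_derive1 u u' : der u u' -> (derive1 u) = u'.
Proof. by move=> h; apply/funext => x; rewrite derive1E; apply: (@derive_val _ _ _ _ _ _ _ (h x)). Qed.

Lemma smooth1_der u : smooth1 u -> der u (derive1 u).
Proof. by move=> /(_ 1%N) [u' h _]; rewrite (der_derive1 h). Qed.

Lemma smooth1_derive1 u : smooth1 u -> smooth1 (derive1 u).
Proof. by move=> h n; have [u' hu] := h n.+1; rewrite (der_derive1 hu). Qed.

Lemma smooth1_derive1n u n : smooth1 u -> smooth1 (derive1n n u).
Proof. by move=> h; elim: n => [|n ih]; rewrite ?derive1n0 ?derive1nS//; exact: smooth1_derive1. Qed.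

Lemma smooth1_derivable u x : smooth1 u -> derivable u x 1.
Proof. by move=> /smooth1_der h; apply: ex_derive. Qed.

Lemma smooth1_continuous u : smooth1 u -> continuous u.
Proof.
move=> h x; apply: differentiable_continuous; apply/derivable1_diffP.
exact: smooth1_derivable.
Qed.

(** Smoothness is proved by exhibiting a class of functions that contains the
    function and is stable under differentiation. *)
Lemma smooth1_class (S : set (R -> R)) :
  (forall u, S u -> exists2 u', der u u' & S u') -> forall u, S u -> smooth1 u.
Proof. by move=> H u Su n; elim: n u Su => //= n ih u /H[u' h /ih]; exists u'. Qed.

Lemma nderS n u : nder n.+1 u -> nder n u.
Proof. by elim: n u => //= n ih u [u' h /ih]; exists u'. Qed.

Lemma nderD n u v : nder n u -> nder n v -> nder n (u + v).
Proof.
elim: n u v => //= n ih u v [u' hu nu] [v' hv nv]; exists (u' + v'); last exact: ih.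
by move=> x; apply: is_deriveD.
Qed.

Lemma nderN n u : nder n u -> nder n (- u).
Proof.
elim: n u => //= n ih u [u' hu nu]; exists (- u'); last exact: ih.
by move=> x; apply: is_deriveN.
Qed.

Lemma nderM n u v : nder n u -> nder n v -> nder n (u * v).
Proof.
elim: n u v => // n ih u v nu nv.
have [u' hu nu'] := nu; have [v' hv nv'] := nv.
exists (u * v' + v * u').
  move=> x; apply: is_derive_eq.
    exact: (@is_deriveM _ _ u v x 1 _ _ (hu x) (hv x)).
  by rewrite -[LHS]/(u x * v' x + v x * u' x).
by apply: nderD; apply: ih => //; exact: nderS.
Qed.

Lemma nderV n u : (forall x, u x != 0) -> nder n u -> nder n (fun x => (u x)^-1).
Proof.
move=> u0; elim: n => // n ih nu.
have [u' hu nu'] := nu.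
exists (- (u' * ((fun x => (u x)^-1) * (fun x => (u x)^-1)))).
  move=> x; have dux : derivable u x 1 by have := hu x => ?; exact: ex_derive.
  apply: DeriveDef; first exact: derivableV.
  rewrite deriveV// (@derive_val _ _ _ _ _ _ _ (hu x)).
  by rewrite -[RHS]/(- (u' x * ((u x)^-1 * (u x)^-1))) /GRing.scale/= -exprVn expr2 mulNr mulrC.
by apply: nderN; apply: nderM => //; apply: nderM; apply: ih; exact: nderS.
Qed.

Lemma nder_cst n (c : R) : nder n (cst c).
Proof. by elim: n c => //= n ih c; exists (cst 0) => // x; exact: is_derive_cst. Qed.

Lemma nder_id n : nder n (id : R -> R).
Proof. by case: n => //= n; exists (cst 1); [move=> x; exact: is_derive_id|exact: nder_cst]. Qed.

Lemma der_affine u u' (a b : R) : der u u' ->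
  der (fun x => u (a * x + b)) (fun x => a * u' (a * x + b)).
Proof.
move=> hu x; have hf : is_derive x 1 (fun x => a * x + b) a.
  apply: (@is_derive_eq _ _ _ (a *: id + cst b : R -> R) x 1 a (a *: 1 + 0)).
  by rewrite addr0 /GRing.scale/= mulr1.
have hd : derivable (fun x => u (a * x + b)) x 1.
  apply/derivable1_diffP.
  apply: (@differentiable_comp _ _ _ _ (fun x => a * x + b) u).
    by apply/derivable1_diffP; exact: ex_derive.
  by apply/derivable1_diffP; exact: ex_derive.
apply: DeriveDef => //.
rewrite -derive1E (@derive1_comp _ (fun x => a * x + b) u).
- by rewrite !derive1E (@derive_val _ _ _ _ _ _ _ hf) (@derive_val _ _ _ _ _ _ _ (hu _)) mulrC.
- exact: ex_derive.
- exact: ex_derive.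
Qed.

Lemma nder_affine n u (a b : R) : nder n u -> nder n (fun x => u (a * x + b)).
Proof.
elim: n u => // n ih u [u' hu nu].
exists (cst a * (fun x => u' (a * x + b))); first exact: der_affine.
by apply: nderM; [exact: nder_cst|exact: ih].
Qed.

Lemma smooth1D u v : smooth1 u -> smooth1 v -> smooth1 (u + v).
Proof. by move=> hu hv n; apply: nderD. Qed.

Lemma smooth1N u : smooth1 u -> smooth1 (- u).
Proof. by move=> hu n; apply: nderN. Qed.

Lemma smooth1M u v : smooth1 u -> smooth1 v -> smooth1 (u * v).
Proof. by move=> hu hv n; apply: nderM. Qed.

Lemma smooth1V u : (forall x, u x != 0) -> smooth1 u -> smooth1 (fun x => (u x)^-1).
Proof. by move=> u0 hu n; apply: nderV. Qed.

Lemma smooth1_cst (c : R) : smooth1 (cst c).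
Proof. by move=> n; apply: nder_cst. Qed.

Lemma smooth1_X n : smooth1 (fun x : R => x ^+ n).
Proof.
elim: n => [|n ih].
  by rewrite (_ : (fun x : R => x ^+ 0) = cst 1)//; exact: smooth1_cst.
have -> : (fun x : R => x ^+ n.+1) = (id * (fun x => x ^+ n)) by apply/funext => x; rewrite exprS.
by apply: smooth1M => // k; exact: nder_id.
Qed.

Lemma smooth1_affine u (a b : R) : smooth1 u -> smooth1 (fun x => u (a * x + b)).
Proof. by move=> hu n; apply: nder_affine. Qed.

Lemma derive1n_affine u (a b : R) n : smooth1 u ->
  derive1n n (fun x => u (a * x + b)) = (fun x => a ^+ n * derive1n n u (a * x + b)).
Proof.
move=> su; elim: n => [|n ih].
  by apply/funext => x; rewrite !derive1n0 expr0 mul1r.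
rewrite derive1nS ih; apply: der_derive1 => x.
have := @is_deriveZ _ _ _ _ (a ^+ n) x 1 _
  (der_affine a b (smooth1_der (smooth1_derive1n n su)) x).
by rewrite derive1nS exprSr -mulrA.
Qed.

End smooth1.

(** * A flat function, a step and a bump *)

Section flat.
Context {R : realType}.
Implicit Types (p q : {poly R}) (x y : R).

(** [flat 1] is the classical function exp(-1/x) of x > 0, extended by 0. *)
Definition flat p x : R := if 0 < x then p.[x^-1] * expR (- x^-1) else 0.

Lemma exprn_le_expR n y : 0 <= y -> y ^+ n <= n`!%:R * expR y.
Proof.
move=> y0; case: n => [|n].
  by rewrite expr0 fact0 mul1r; rewrite -expR0 ler_expR.
have f0 : (0 : R) < n.+1`!%:R by rewrite ltr0n fact_gt0.
rewrite mulrC -ler_pdivrMr//.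
by apply: le_trans (expR_ge1Dxn n y0); rewrite lerDr.
Qed.

Lemma horner_le_expR p : exists2 C, 0 <= C & forall y, 0 <= y -> `|p.[y]| <= C * expR y.
Proof.
exists (\sum_(i < size p) `|p`_i| * i`!%:R).
  by apply: sumr_ge0 => i _; rewrite mulr_ge0.
move=> y y0; rewrite horner_coef mulr_suml.
apply: le_trans (ler_norm_sum _ _ _) _; apply: ler_sum => i _.
rewrite normrM -mulrA ler_wpM2l// ger0_norm ?exprn_ge0//.
exact: exprn_le_expR.
Qed.

(** The exponential absorbs any polynomial in 1/x; the square of x is what differentiability
    at 0 takes. *)
Lemma flat_le p : exists2 C, 0 <= C & forall x, `|flat p x| <= C * x ^+ 2.
Proof.
have [C C0 hC] := horner_le_expR (p * 'X^2).
exists C => // x; rewrite /flat; case: ifPn => [x0|_]; last first.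
  by rewrite normr0 mulr_ge0// sqr_ge0.
have := hC x^-1; rewrite invr_ge0 (ltW x0) => /(_ isT).
rewrite hornerM hornerXn normrM exprVn expRN.
rewrite normrM (gtr0_norm (_ : 0 < (expR _)^-1)) ?invr_gt0 ?expR_gt0//.
rewrite -[X in _ <= C * X -> _](invrK (expR _)) (gtr0_norm (_ : 0 < (x ^+ 2)^-1)); last first.
  by rewrite invr_gt0 exprn_gt0.
by rewrite ler_pdivlMr ?invr_gt0 ?expR_gt0// mulrAC ler_pdivrMr// exprn_gt0.
Qed.

(** Derivatives of flat functions are flat, so that these functions form a class as in
    [smooth1_class]; at 0 the difference quotient is O(x) by [flat_le]. *)
Lemma der_flat p : der (flat p) (flat ('X^2 * (p - p^`())%R)).
Proof.
move=> x; have [x0|x0|->] := ltgtP x 0.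
- apply: (@near_eq_is_derive _ _ _ (cst 0)).
    near=> z; rewrite /flat ifN// -leNgt ltW//; near: z; exact: lt_nbhsl.
  rewrite /flat ltNge (ltW x0)/=; exact: is_derive_cst.
- apply: (@near_eq_is_derive _ _ _ (fun x => p.[x^-1] * expR (- x^-1))).
    near=> z; rewrite /flat ifT//; near: z; exact: lt_nbhsr.
  have xn0 : x != 0 by rewrite gt_eqF.
  have hi : is_derive x 1 (fun x => x^-1) (- x ^- 2).
    apply: DeriveDef; first by apply: (@derivableV _ _ id).
    by rewrite (@deriveV _ _ id)// derive_id /GRing.scale/= mulr1.
  have h1 : is_derive x 1 (fun x => p.[x^-1]) (- x ^- 2 * p^`().[x^-1]).
    by rewrite mulrC; exact: (@is_derive1_comp _ (horner p) _ _ _ _ (is_derive_poly p x^-1) hi).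
  have h2 : is_derive x 1 (fun x => expR (- x^-1)) (x ^- 2 * expR (- x^-1)).
    rewrite mulrC -[X in _ * X]opprK.
    exact: (@is_derive1_comp _ expR _ _ _ _ (is_derive_expR _) (@is_deriveN _ _ _ _ x 1 _ hi)).
  have h3 := @is_deriveM _ _ _ _ x 1 _ _ h1 h2.
  suff <- : p.[x^-1] *: (x ^- 2 * expR (- x^-1)) + expR (- x^-1) *: (- x ^- 2 * p^`().[x^-1]) =
    flat ('X^2 * (p - p^`())) x by exact: h3.
  rewrite /flat x0 !hornerE /GRing.scale/= exprVn; ring.
- have [C C0 hC] := flat_le p.
  have q0 : flat ('X^2 * (p - p^`())) 0 = 0 by rewrite /flat ltxx.
  have f0 : flat p 0 = 0 by rewrite /flat ltxx.
  rewrite q0.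
  have hcvg : h^-1 *: (flat p (h *: 1 + 0) - flat p 0) @[h --> 0^'] --> (0 : R).
    apply/cvgr0Pnorm_le => eps eps0.
    near=> h; have h0 : h != 0 by near: h; exact: nbhs_dnbhs_neq.
    rewrite f0 subr0 addr0 /GRing.scale/= mulr1 normrM normfV.
    rewrite mulrC ler_pdivrMr ?normr_gt0//.
    apply: le_trans (hC h) _; rewrite -(real_normK (num_real h)) expr2 mulrA ler_wpM2r//.
    have : `|h| <= eps / (C + 1).
      by near: h; apply: dnbhs0_le; rewrite divr_gt0//; lra.
    rewrite ler_pdivlMr; last lra.
    move=> h1; apply: le_trans h1; rewrite mulrC ler_wpM2l//; lra.
  apply: DeriveDef; first by apply/cvg_ex; exists 0.
  by apply/cvg_lim.
Unshelve. all: by end_near.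
Qed.

Lemma smooth1_flat p : smooth1 (flat p).
Proof.
apply: (@smooth1_class _ (range flat)); last by exists p.
by move=> _ [q _ <-]; exists (flat ('X^2 * (q - q^`())))%R; [exact: der_flat|exists ('X^2 * (q - q^`()))%R].
Qed.

Lemma flat1_gt0 x : 0 < x -> 0 < flat 1 x.
Proof. by move=> x0; rewrite /flat x0 hornerC mul1r expR_gt0. Qed.

Lemma flat1_eq0 x : x <= 0 -> flat 1 x = 0.
Proof. by move=> x0; rewrite /flat ltNge x0. Qed.

Lemma flat1_ge0 x : 0 <= flat 1 x.
Proof. by case: (ltP 0 x) => [/flat1_gt0/ltW//|/flat1_eq0->]. Qed.

Lemma flat1_le1 x : flat 1 x <= 1.
Proof.
rewrite /flat; case: ifPn => // x0; rewrite hornerC mul1r -expR0 ler_expR oppr_le0 invr_ge0.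
exact: ltW.
Qed.

(** A smooth step from 0 on x <= 1/2 to 1 on x >= 1. *)
Definition step x : R := flat 1 (x - 1/2) / (flat 1 (x - 1/2) + flat 1 (1 - x)).

Lemma step_den x : flat 1 (x - 1/2) + flat 1 (1 - x) != 0.
Proof.
have := flat1_ge0 (x - 1/2); have := flat1_ge0 (1 - x) => a b.
apply: lt0r_neq0; case: (ltP (1/2) x) => h.
- by apply: ltr_pwDl => //; apply: flat1_gt0; lra.
- by apply: ltr_pwDr => //; apply: flat1_gt0; lra.
Qed.

Lemma smooth1_step : smooth1 step.
Proof.
have s1 : smooth1 (fun x => flat 1 (x - 1/2)).
  rewrite [X in smooth1 X](_ : _ = fun x => flat 1 (1 * x + (- (1/2)))).
    exact/smooth1_affine/smooth1_flat.
  by apply/funext => x; rewrite (mul1r x).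
have s2 : smooth1 (fun x => flat 1 (1 - x)).
  rewrite [X in smooth1 X](_ : _ = fun x => flat 1 (-1 * x + 1)).
    exact/smooth1_affine/smooth1_flat.
  by apply/funext => x; rewrite mulN1r addrC.
apply: (smooth1M s1); apply: (smooth1V step_den); exact: smooth1D.
Qed.

Lemma step0 x : x <= 1/2 -> step x = 0.
Proof. by move=> h; rewrite /step flat1_eq0 ?mul0r//; lra. Qed.

Lemma step1 x : 1 <= x -> step x = 1.
Proof.
move=> h; have := step_den x; rewrite /step (@flat1_eq0 (1 - x)) ?addr0; last lra.
exact: divff.
Qed.

Definition bump1 x : R := flat 1 (x - 1/4) * flat 1 (3/4 - x).

Lemma smooth1_bump : smooth1 bump1.
Proof.
apply: smooth1M.
  rewrite [X in smooth1 X](_ : _ = fun x => flat 1 (1 * x + (- (1/4)))).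
    exact/smooth1_affine/smooth1_flat.
  by apply/funext => x; rewrite (mul1r x).
rewrite [X in smooth1 X](_ : _ = fun x => flat 1 (-1 * x + 3/4)).
  exact/smooth1_affine/smooth1_flat.
by apply/funext => x; rewrite (mulN1r x) addrC.
Qed.

Lemma bump_ge0 x : 0 <= bump1 x.
Proof. by apply: mulr_ge0; apply: flat1_ge0. Qed.

Lemma bump_le1 x : bump1 x <= 1.
Proof. by apply: mulr_ile1; rewrite ?flat1_ge0 ?flat1_le1. Qed.

Lemma bump_supp x : ~ (1/4 <= x <= 3/4) -> bump1 x = 0.
Proof.
move=> /negP; rewrite negb_and -!ltNge => /orP[h|h].
  by rewrite /bump1 flat1_eq0 ?mul0r//; lra.
by rewrite /bump1 (@flat1_eq0 (3/4 - x)) ?mulr0//; lra.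
Qed.

Lemma flat1_ge x : 1/8 <= x -> expR (- 8) <= flat 1 x.
Proof.
move=> h; rewrite /flat ifT; last lra.
rewrite hornerC mul1r ler_expR lerN2 -[leRHS]invrK lef_pV2 ?posrE; lra.
Qed.

Lemma bump_ge x : 3/8 <= x <= 5/8 -> expR (- 16) <= bump1 x.
Proof.
move=> h; have -> : (- 16 : R) = - 8 + - 8 by ring.
rewrite expRD; apply: ler_pM; rewrite ?expR_ge0//; apply: flat1_ge; lra.
Qed.

End flat.

Section compact_support.
Context {R : realType}.
Implicit Types (u : R -> R) (a b : R).

Lemma derive1n_supp u a b n : smooth1 u -> (forall t, ~ (a <= t <= b) -> u t = 0) ->
  forall t, ~ (a <= t <= b) -> derive1n n u t = 0.
Proof.
move=> su u0; elim: n => [|n ih] t ht; first by rewrite derive1n0; exact: u0.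
rewrite derive1nS derive1E (@near_eq_derive _ _ _ _ (cst 0)); first by rewrite derive_cst.
have : open (~` `[a, b]%classic : set R) by apply: closed_openC; exact: itv_closed.
rewrite openE => /(_ t) h; have : (~` `[a, b]%classic)^° t by apply: h; rewrite /= in_itv.
by apply: filterS => s; rewrite /= in_itv/=; exact: ih.
Qed.

Lemma supp_bounded u a b : continuous u -> (forall t, ~ (a <= t <= b) -> u t = 0) ->
  exists2 M, 1 <= M & forall t, `|u t| <= M.
Proof.
move=> cu u0.
have cK : compact (`[a, b]%classic : set R) by exact: segment_compact.
have [M [_ hM]] := compact_bounded (continuous_compact (continuous_subspaceT cu) cK).
exists (`|M| + 1); first by rewrite lerDr normr_ge0.
move=> t; have [ab|/u0 ->] := pselect (a <= t <= b); last first.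
  by rewrite normr0 addr_ge0.
apply: hM; first by rewrite ltr_pwDr// ler_norm.
by exists t => //=; rewrite in_itv.
Qed.

End compact_support.

(** * Products of functions of one coordinate *)

Section coordinates.
Context {R : realType} {d : nat}.
Implicit Types (x y : 'rV[R]_d) (f g : 'rV[R]_d -> R) (i l : 'I_d).

Definition setc x i (t : R) : 'rV[R]_d := \row_l (if l == i then t else x ord0 l).

Lemma setc_coord x i t l : setc x i t ord0 l = if l == i then t else x ord0 l.
Proof. by rewrite mxE. Qed.

Lemma setc_id x i : setc x i (x ord0 i) = x.
Proof. by apply/rowP => l; rewrite setc_coord; case: eqP => [->|]. Qed.

Lemma shift_setc x i (h : R) : h *: delta_mx ord0 i + x = setc x i (h + x ord0 i).
Proof.
apply/rowP => l; rewrite setc_coord !mxE eqxx/=.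
by case: eqP => [->|]; rewrite ?mulr1 ?mulr0 ?add0r.
Qed.

Lemma setc_setc x i s t : setc (setc x i s) i t = setc x i t.
Proof. by apply/rowP => l; rewrite !setc_coord; case: eqP. Qed.

(** This reduces partial derivatives, which are derivatives along a direction of the space
    of rows, to derivatives of functions of one variable. *)
Lemma partial_is_derive f i x (df : R) :
  is_derive (x ord0 i) 1 (fun t => f (setc x i t)) df <->
  is_derive x (delta_mx ord0 i) f df.
Proof.
have E : (fun h => h^-1 *: (f (h *: delta_mx ord0 i + x) - f x)) =
   (fun h : R => h^-1 *: (f (setc x i (h *: 1 + x ord0 i)) - f (setc x i (x ord0 i)))).
  by apply/funext => h; rewrite shift_setc setc_id /GRing.scale/= mulr1.
by split=> -[h1 h2]; split; move: h1 h2; rewrite /derivable /derive/= E.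
Qed.

Definition tens (u : 'I_d -> R -> R) x : R := \prod_l u l (x ord0 l).

(** Products are closed under partial derivatives: only the factor of that coordinate
    changes. *)
Definition updf (u : 'I_d -> R -> R) i v : 'I_d -> R -> R := fun l => if l == i then v else u l.

Lemma updf_id u i : updf u i (u i) = u.
Proof. by apply/funext => l; rewrite /updf; case: eqP => [->|]. Qed.

Lemma updf_updf u i v w : updf (updf u i v) i w = updf u i w.
Proof. by apply/funext => l; rewrite /updf; case: eqP. Qed.

Lemma updfE u i v : updf u i v i = v.
Proof. by rewrite /updf eqxx. Qed.

Lemma tens_updf u i v x :
  tens (updf u i v) x = v (x ord0 i) * \prod_(l | l != i) u l (x ord0 l).
Proof.
rewrite /tens (bigD1 i)//= updfE; congr (_ * _).
by apply: eq_bigr => l /negPf li; rewrite /updf li.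
Qed.

Lemma tens_is_derive u i x (v : R) : is_derive (x ord0 i) 1 (u i) v ->
  is_derive x (delta_mx ord0 i) (tens u) (v * \prod_(l | l != i) u l (x ord0 l)).
Proof.
move=> hu; apply/partial_is_derive.
have -> : (fun t => tens u (setc x i t)) = (\prod_(l | l != i) u l (x ord0 l)) *: u i.
  apply/funext => t; rewrite -[u in LHS](updf_id u i) tens_updf setc_coord eqxx.
  rewrite mulrC; congr (_ * _).
  by apply: eq_bigr => l /negPf li; rewrite setc_coord li.
by rewrite mulrC; exact: is_deriveZ.
Qed.

Lemma partial_tens u i : smooth1 (u i) -> partial i (tens u) = tens (updf u i (derive1 (u i))).
Proof.
move=> su; apply/funext => x; rewrite tens_updf.
by apply: derive_val; apply: tens_is_derive; exact: smooth1_der.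
Qed.

Lemma continuous_tens u : (forall l, continuous (u l)) -> continuous (tens u).
Proof.
move=> cu x; rewrite /tens; apply: cvg_big; first exact: mul_continuous.
  exact: (@nbhs_filter _ x).
by move=> l _; apply: cvg_comp; [exact: coord_continuous|exact: cu].
Qed.

Lemma smooth1_updf u i v l : (forall l, smooth1 (u l)) -> smooth1 v -> smooth1 (updf u i v l).
Proof. by rewrite /updf; case: eqP. Qed.

Lemma smooth_tens u : (forall l, smooth1 (u l)) -> smooth (tens u).
Proof.
move=> su s.
have [v [sv ->]] : exists v, (forall l, smooth1 (v l)) /\ foldr (@partial R d) (tens u) s = tens v.
  elim: s => [|i s [v [sv E]]]/=; first by exists u.
  rewrite E.
  exists (updf v i (derive1 (v i))); rewrite partial_tens//; split => // l.
  by apply: smooth1_updf => //; exact: smooth1_derive1.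
split; first by apply: continuous_tens => l; exact: smooth1_continuous.
by move=> i x; have := tens_is_derive (smooth1_der (sv i) (x ord0 i)) => ?; exact: ex_derive.
Qed.

Lemma iter_partial_tens u i k : smooth1 (u i) ->
  iter k (partial i) (tens u) = tens (updf u i (derive1n k (u i))).
Proof.
move=> su; elim: k => [|k ih]; first by rewrite derive1n0 updf_id.
rewrite iterS ih partial_tens updfE; last exact: smooth1_derive1n.
by rewrite updf_updf derive1nS.
Qed.

Lemma mpartial_tens m (al : multi d m) u : (forall l, smooth1 (u l)) ->
  mpartial al (tens u) = tens (fun l => derive1n (al l) (u l)).
Proof.
move=> su; rewrite /mpartial.
have : uniq (enum 'I_d) by exact: enum_uniq.
have -> : (fun l => derive1n (al l) (u l)) =
   (fun l => if l \in enum 'I_d then derive1n (al l) (u l) else u l).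
  by apply/funext => l; rewrite mem_enum.
elim: (enum 'I_d) => [|i s ih]//= /andP[/negPf nis us].
rewrite ih// iter_partial_tens nis//; congr tens; apply/funext => l.
by rewrite /updf in_cons; case: eqP => [->|].
Qed.

Definition box (a b : 'I_d -> R) : set 'rV[R]_d :=
  [set x | forall l, a l <= x ord0 l <= b l].

Lemma compact_box a b : compact (box a b).
Proof.
have := @rV_compact R d (fun l => `[a l, b l]%classic) (fun l => @segment_compact _ _ _).
by congr compact; apply/seteqP; split => x h l; have := h l; rewrite /= in_itv.
Qed.

Lemma test_fun_tens (Omega : set 'rV[R]_d) u a b : (forall l, smooth1 (u l)) ->
  (forall l t, ~ (a l <= t <= b l) -> u l t = 0) -> box a b `<=` Omega ->
  test_fun Omega (tens u).
Proof.
move=> su u0 ab; split; first exact: smooth_tens.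
exists (box a b); split => //; first exact: compact_box.
move=> x /existsNP[l hl]; rewrite /tens (bigD1 l)//= u0 ?mul0r//.
Qed.

Lemma smooth_partial f i : smooth f -> smooth (partial i f).
Proof. by move=> sf l; have := sf (rcons l i); rewrite foldr_rcons. Qed.

Lemma smooth_cont f : smooth f -> continuous f.
Proof. by move=> /(_ [::])[]. Qed.

Lemma smooth_is_derive f i x : smooth f -> is_derive x (delta_mx ord0 i) f (partial i f x).
Proof. by move=> /(_ [::])[_ /(_ i x)] h; apply: DeriveDef. Qed.

Lemma test_fun_partial (Omega : set 'rV[R]_d) f i :
  test_fun Omega f -> test_fun Omega (partial i f).
Proof.
move=> [sf [K [cK KO f0]]]; split; first exact: smooth_partial.
exists K; split => // x Kx.
have oK : open (~` K) by apply: closed_openC; apply: compact_closed => //; exact: norm_hausdorff.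
rewrite /partial (@near_eq_derive _ _ _ f (cst 0)); first by rewrite derive_cst.
by move: oK; rewrite openE => /(_ x Kx); apply: filterS => y /f0.
Qed.

Lemma test_fun_iter_partial (Omega : set 'rV[R]_d) f i k :
  test_fun Omega f -> test_fun Omega (iter k (partial i) f).
Proof. by move=> h; elim: k => //= k ih; exact: test_fun_partial. Qed.

Lemma test_fun_mpartial (Omega : set 'rV[R]_d) m (al : multi d m) f :
  test_fun Omega f -> test_fun Omega (mpartial al f).
Proof.
by move=> h; rewrite /mpartial; elim: (enum _) => //= i s ih; exact: test_fun_iter_partial.
Qed.

Lemma partial_MVT f df i x t (M : R) : (forall y, is_derive y (delta_mx ord0 i) f (df y)) ->
  (forall s, `|s - x ord0 i| <= `|t - x ord0 i| -> `|df (setc x i s)| <= M) ->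
  `|f (setc x i t) - f x| <= M * `|t - x ord0 i|.
Proof.
move=> fdf hM.
have hd (s : R) : is_derive s 1 (fun t => f (setc x i t)) (df (setc x i s)).
  have := fdf (setc x i s) => /partial_is_derive.
  rewrite setc_coord eqxx; under eq_fun do rewrite setc_setc.
  by [].
have cd (A : set R) : {within A, continuous (fun t => f (setc x i t))}.
  apply: continuous_subspaceT => s; apply: differentiable_continuous.
  by apply/derivable1_diffP; have := hd s => ?; exact: ex_derive.
have [xt|xt|xt] := ltgtP (x ord0 i) t.
- have [s hs E] := MVT xt (fun s _ => hd s) (cd _).
  rewrite setc_id in E; rewrite E normrM ler_wpM2r//; apply: hM.
  by move: hs; rewrite in_itv/= => hs; rewrite !ger0_norm; lra.
- have [s hs E] := MVT xt (fun s _ => hd s) (cd _).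
  rewrite setc_id in E; rewrite distrC E normrM (distrC t) ler_wpM2r//; apply: hM.
  by move: hs; rewrite in_itv/= => hs; rewrite !ler0_norm; lra.
- by rewrite -xt setc_id !subrr normr0 mulr0.
Qed.

End coordinates.

(** * Integration against n-fold products *)

Section mpow_integral.
Context d (T : measurableType d) (R : realType).
Variable m : {sigma_finite_measure set T -> \bar R}.
Local Open Scope ereal_scope.

Lemma ge0_integral_mpowS n (G : n.+1.-tuple T -> \bar R) :
  measurable_fun setT G -> (forall t, 0 <= G t) ->
  \int[mpow m n.+1]_t G t = \int[m]_x \int[mpow m n]_t G (tcons (x, t)).
Proof.
move=> mG G0.
rewrite -[LHS]/(\int[pushforward (m \x mpow m n) (@tcons _ _ n)]_t G t).
rewrite ge0_integral_pushforward//; last exact: measurable_tcons.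
rewrite preimage_setT fubini_tonelli1//.
  by apply: measurableT_comp => //; exact: measurable_tcons.
by move=> z; exact: G0.
Qed.

Lemma ge0_integral_mpow0 (G : 0.-tuple T -> \bar R) : measurable_fun setT G ->
  \int[mpow m 0]_t G t = G [tuple].
Proof. by move=> mG; rewrite integral_dirac// diracT mul1e. Qed.

Lemma measurable_tcons1 n (x : T) : measurable_fun setT (fun t : n.-tuple T => tcons (x, t)).
Proof. exact: (@measurable_cons _ _ _ _ (cst x) n id). Qed.

Lemma measurable_tuple_prod n (f : 'I_n -> T -> R) :
  (forall i, measurable_fun setT (f i)) ->
  measurable_fun setT (fun t : n.-tuple T => \prod_i f i (tnth t i))%R.
Proof.
move=> mf; apply: measurable_prod => i _.
by apply: measurableT_comp => //; exact: measurable_tnth.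
Qed.

Lemma measurable_tuple_sum n (f : 'I_n -> T -> R) :
  (forall i, measurable_fun setT (f i)) ->
  measurable_fun setT (fun t : n.-tuple T => \sum_i f i (tnth t i))%R.
Proof.
move=> mf; apply: measurable_sum => i.
by apply: measurableT_comp => //; exact: measurable_tnth.
Qed.

Lemma measurable_tuple_prodE n (f : 'I_n -> T -> R) :
  (forall i, measurable_fun setT (f i)) ->
  measurable_fun setT (fun t : n.-tuple T => (\prod_i f i (tnth t i))%:E).
Proof. by move=> mf; apply/measurable_EFinP; exact: (measurable_tuple_prod mf). Qed.

Lemma tcons_prod n (f : 'I_n.+1 -> T -> R) x t :
  (\prod_i f i (tnth (tcons (x, t)) i) = f ord0 x * \prod_i f (lift ord0 i) (tnth t i))%R.
Proof.
rewrite big_ord_recl; congr (_ * _)%R.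
by apply: eq_bigr => i _; rewrite tnthS.
Qed.

Lemma tcons_sum n (f : 'I_n.+1 -> T -> R) x t :
  (\sum_i f i (tnth (tcons (x, t)) i) = f ord0 x + \sum_i f (lift ord0 i) (tnth t i))%R.
Proof.
rewrite big_ord_recl; congr (_ + _)%R.
by apply: eq_bigr => i _; rewrite tnthS.
Qed.

Lemma ge0_integral_mpow_prod n (f : 'I_n -> T -> R) :
  (forall i, measurable_fun setT (f i)) -> (forall i x, (0 <= f i x)%R) ->
  \int[mpow m n]_t (\prod_i f i (tnth t i))%:E = \prod_i \int[m]_x (f i x)%:E.
Proof.
elim: n f => [|n ih] f mf f0.
  rewrite ge0_integral_mpow0 ?big_ord0//.
  exact: measurable_tuple_prodE.
rewrite ge0_integral_mpowS; last 2 first.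
  exact: measurable_tuple_prodE.
  by move=> t; rewrite lee_fin prodr_ge0.
under eq_integral => x _.
  under eq_integral => t _ do rewrite tcons_prod EFinM.
  rewrite ge0_integralZl//; last 3 first.
    exact: (measurable_tuple_prodE (fun i => mf (lift ord0 i))).
    by move=> t _; rewrite lee_fin prodr_ge0.
    by rewrite lee_fin.
  rewrite (ih (fun i => f (lift ord0 i)))//; over.
rewrite ge0_integralZr//; last 3 first.
  exact/measurable_EFinP.
  by move=> t _; rewrite lee_fin.
  by apply: prode_ge0 => i _; apply: integral_ge0 => x _; rewrite lee_fin.
by rewrite big_ord_recl.
Qed.

Lemma integral_mpow_prod n (f : 'I_n -> T -> R) :
  (forall i, m.-integrable setT (EFin \o f i)) ->
  (mpow m n).-integrable setT (fun t => (\prod_i f i (tnth t i))%:E) /\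
  \int[mpow m n]_t (\prod_i f i (tnth t i))%:E = \prod_i \int[m]_x (f i x)%:E.
Proof.
move=> fi; have mf k (g : 'I_k -> T -> R) : (forall i, m.-integrable setT (EFin \o g i)) ->
   forall i, measurable_fun setT (g i).
  by move=> gi i; apply/measurable_EFinP; exact: measurable_int (gi i).
have I k (g : 'I_k -> T -> R) : (forall i, m.-integrable setT (EFin \o g i)) ->
    (mpow m k).-integrable setT (fun t => (\prod_i g i (tnth t i))%:E).
  move=> gi; apply/integrableP; split.
    exact: (measurable_tuple_prodE (mf _ _ gi)).
  under eq_integral do rewrite abse_EFin normr_prod.
  rewrite (@ge0_integral_mpow_prod _ (fun i x => `|g i x|%R))//; last first.
    by move=> i; apply: measurableT_comp => //; exact: mf.
  suff /andP[] : 0 <= \prod_i \int[m]_x (`|g i x|%R)%:E < +oo by [].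
  apply: (big_ind (fun x => 0 <= x < +oo)) => //.
  - by rewrite lee01 ltry.
  - move=> x y /andP[x0 xoo] /andP[y0 yoo]; rewrite mule_ge0//=.
    by rewrite lte_mul_pinfty// ge0_fin_numE.
  - by move=> i _; have /integrableP[_ ->] := gi i; rewrite andbT integral_ge0.
split; first exact: I.
elim: n f fi => [|n ih] f fi.
  rewrite ge0_integral_mpow0 ?big_ord0//.
  exact: (measurable_tuple_prodE (mf _ _ fi)).
have fi' i : m.-integrable setT (EFin \o f (lift ord0 i)) by exact: fi.
have If := I _ _ fi; have If' := I _ _ fi'.
rewrite -[LHS]/(\int[pushforward (m \x mpow m n) (@tcons _ _ n)]_t _).
have mt := @measurable_tcons _ T n.
have Ip : (m \x mpow m n).-integrable setT
    (fun z => (\prod_i f i (tnth (tcons z) i))%:E).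
  apply/integrableP; split.
    by apply: (measurableT_comp (measurable_tuple_prodE (mf _ _ fi))); exact: mt.
  have /integrableP[mG] := If.
  rewrite -[X in X < _ -> _]/(\int[pushforward (m \x mpow m n) (@tcons _ _ n)]_t _).
  by rewrite ge0_integral_pushforward//; exact: measurableT_comp.
rewrite integral_pushforward//=; last exact: (measurable_tuple_prodE (mf _ _ fi)).
rewrite preimage_setT -integral12_prod_meas1// /fubini_F.
have fin : \prod_i \int[m]_x (f (lift ord0 i) x)%:E \is a fin_num.
  apply: (big_ind (fun x => x \is a fin_num)) => //; first exact: fin_numM.
  by move=> i _; exact: (integrable_fin_num measurableT (fi' i)).
under eq_integral => x _.
  under eq_integral => t _ do rewrite tcons_prod EFinM.
  rewrite integralZl//= (ih (fun i => f (lift ord0 i)))// -(fineK fin); over.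
by rewrite (integralZr measurableT (fi ord0)) fineK// big_ord_recl.
Qed.

End mpow_integral.

(** * Densities *)

Section density.
Context d (T : measurableType d) (R : realType).
Variables (mu : {measure set T -> \bar R}) (L : T -> R).
Hypotheses (mL : measurable_fun setT L) (L0 : forall x, 0 <= L x).
Local Open Scope ereal_scope.

Definition dens (A : set T) : \bar R := \int[mu]_(x in A) (L x)%:E.

Let dens0 : dens set0 = 0.
Proof. by rewrite /dens integral_set0. Qed.

Let dens_ge0 A : 0 <= dens A.
Proof. by apply: integral_ge0 => x _; rewrite lee_fin. Qed.

Let dens_sigma_additive : semi_sigma_additive dens.
Proof.
move=> /= F mF tF mUF; rewrite /dens; apply: cvg_toP.
  apply: ereal_nondecreasing_is_cvgn => m n mn.
  apply: lee_sum_nneg_natr => // k _ _; exact: dens_ge0.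
rewrite ge0_integral_bigcup//=.
- by apply: measurable_funTS; apply/measurable_EFinP.
- by move=> x _; rewrite lee_fin.
Qed.

HB.instance Definition _ := isMeasure.Build _ _ _ dens
  dens0 dens_ge0 dens_sigma_additive.

Hypothesis dens1 : dens setT = 1.

HB.instance Definition _ := @Measure_isProbability.Build _ _ _ dens dens1.

Lemma density_probability : exists P : probability T R,
  forall A, measurable A -> P A = \int[mu]_(x in A) (L x)%:E.
Proof. by exists (dens : probability T R). Qed.

End density.

Section density_integral.
Context d (T : measurableType d) (R : realType).
Variables (mu nu : {measure set T -> \bar R}) (L : T -> R).
Hypotheses (mL : measurable_fun setT L) (L0 : forall x, 0 <= L x).
Local Open Scope ereal_scope.
Hypothesis nuE : forall A, measurable A -> nu A = \int[mu]_(x in A) (L x)%:E.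
Import HBNNSimple.

Let mLE : measurable_fun setT (EFin \o L).
Proof. exact/measurable_EFinP. Qed.

(** By simple functions and monotone convergence, since the measure nu is given only by its
    values on sets. *)
Lemma ge0_integral_density (f : T -> \bar R) : measurable_fun setT f ->
  (forall x, 0 <= f x) -> \int[nu]_x f x = \int[mu]_x (f x * (L x)%:E).
Proof.
move=> mf f0; pose h := nnsfun_approx measurableT mf.
have hf x : (EFin \o h n) x @[n --> \oo] --> f x by exact: cvg_nnsfun_approx.
have -> : \int[nu]_x f x = lim (\int[nu]_x (EFin \o h n) x @[n --> \oo]).
  under eq_integral do rewrite -(cvg_lim _ (hf _))//.
  apply: monotone_convergence => //.
  - by move=> n; apply/measurable_EFinP; exact/measurable_funP.
  - by move=> n x _ /=; rewrite lee_fin.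
  - by move=> x _ a b ab; rewrite lee_fin; exact/lefP/nd_nnsfun_approx.
have -> : \int[mu]_x (f x * (L x)%:E) =
    lim (\int[mu]_x ((EFin \o h n) x * (L x)%:E) @[n --> \oo]).
  have hfL x : ((EFin \o h n) x * (L x)%:E) @[n --> \oo] --> f x * (L x)%:E.
    by apply: cvgeZr => //; exact: hf.
  under eq_integral do rewrite -(cvg_lim _ (hfL _))//.
  apply: monotone_convergence => //.
  - by move=> n; apply: emeasurable_funM => //; apply/measurable_EFinP; exact/measurable_funP.
  - by move=> n x _ /=; rewrite mule_ge0 ?lee_fin.
  - move=> x _ a b ab; rewrite lee_wpmul2r ?lee_fin//; exact/lefP/nd_nnsfun_approx.
suff suf n : \int[nu]_x (EFin \o h n) x = \int[mu]_x ((EFin \o h n) x * (L x)%:E).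
  by under eq_fun do rewrite suf.
have mi r : measurable (h n @^-1` [set r]) by exact: measurable_funPTI.
have mind r : measurable_fun setT (fun x => (r * \1_(h n @^-1` [set r]) x)%:E).
  by apply/measurable_EFinP; exact: measurable_funM.
transitivity (\int[nu]_x (\sum_(y \in range (h n)) (y * \1_(h n @^-1` [set y]) x)%:E)).
  by apply: eq_integral => t tE; rewrite /= fimfunE -fsumEFin.
rewrite ge0_integral_fsum//; last by move=> m y Ey; exact: nnfun_muleindic_ge0.
transitivity (\int[mu]_x (\sum_(y \in range (h n))
    (y * \1_(h n @^-1` [set y]) x)%:E * (L x)%:E)); last first.
  apply: eq_integral => x _.
  rewrite -ge0_mule_fsuml => [|y]; last exact: nnfun_muleindic_ge0.
  by rewrite fsumEFin // -(fimfunE _ x).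
rewrite ge0_integral_fsum//; last 2 first.
  - by move=> y; apply: emeasurable_funM => //.
  - by move=> m y Ey; apply: mule_ge0; [exact: nnfun_muleindic_ge0|rewrite lee_fin].
apply: eq_fsbigr => r rhn.
rewrite integralZl_indic_nnsfun// integral_indic// setIT nuE//.
have r0 : (0 <= r)%R by have /set_mem[x _ <-] := rhn.
under [RHS]eq_integral do rewrite EFinM -muleA.
rewrite ge0_integralZl//; last 2 first.
  by apply: emeasurable_funM => //; apply/measurable_EFinP.
  by move=> x _; rewrite mule_ge0 ?lee_fin.
congr (_ * _); rewrite integral_mkcond; apply: eq_integral => x _.
by rewrite patchE indicE; case: ifPn => [|]; rewrite ?mul1e ?mul0e.
Qed.

End density_integral.

Section mpow_density.
Context d (T : measurableType d) (R : realType).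
Variables (mu nu : {sigma_finite_measure set T -> \bar R}) (L : T -> R).
Hypotheses (mL : measurable_fun setT L) (L0 : forall x, 0 <= L x).
Local Open Scope ereal_scope.
Hypothesis nuE : forall A, measurable A -> nu A = \int[mu]_(x in A) (L x)%:E.

Lemma ge0_integral_mpow_density n (f : n.-tuple T -> \bar R) : measurable_fun setT f ->
  (forall x, 0 <= f x) ->
  \int[mpow nu n]_t f t = \int[mpow mu n]_t (f t * (\prod_i L (tnth t i))%:E).
Proof.
have mP k : measurable_fun setT (fun t : k.-tuple T => (\prod_i L (tnth t i))%:E).
  exact: (measurable_tuple_prodE (fun=> mL)).
elim: n f => [|n ih] f mf f0.
  rewrite !ge0_integral_mpow0//; first by rewrite big_ord0 mule1.
  by apply: emeasurable_funM => //; exact: mP.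
have mft : measurable_fun setT (fun z => f (tcons z)).
  by apply: measurableT_comp => //; exact: measurable_tcons.
have mf1 x : measurable_fun setT (fun t => f (tcons (x, t))).
  by apply: measurableT_comp => //; exact: measurable_tcons1.
have mI (g : T * n.-tuple T -> \bar R) : measurable_fun setT g -> (forall z, 0 <= g z) ->
  measurable_fun setT (fun x => \int[mpow mu n]_t g (x, t)).
  by move=> mg g0; exact: measurable_fun_fubini_tonelli_F.
rewrite ge0_integral_mpowS// ge0_integral_mpowS; last 2 first.
  by apply: emeasurable_funM => //; exact: mP.
  by move=> t; rewrite mule_ge0// lee_fin prodr_ge0.
under eq_integral => x _ do rewrite ih//.
rewrite (ge0_integral_density mL L0 nuE); last 2 first.
  apply: (mI (fun z => f (tcons z) * (\prod_i L (tnth z.2 i))%:E)).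
    apply: emeasurable_funM => //; exact: (measurableT_comp (mP n)).
  by move=> z; rewrite mule_ge0// lee_fin prodr_ge0.
  by move=> x; apply: integral_ge0 => t _; rewrite mule_ge0// lee_fin prodr_ge0.
apply: eq_integral => x _; rewrite -ge0_integralZr//; last 3 first.
  by apply: emeasurable_funM; [exact: mf1|exact: mP].
  by move=> t _; rewrite mule_ge0// lee_fin prodr_ge0.
  by rewrite lee_fin.
apply: eq_integral => t _.
by rewrite (tcons_prod (fun=> L)) -muleA -EFinM mulrC.
Qed.

Lemma measure_mpow_density n (A : set (n.-tuple T)) : measurable A ->
  mpow nu n A = \int[mpow mu n]_(t in A) (\prod_i L (tnth t i))%:E.
Proof.
move=> mA; rewrite -(setIT A) -integral_indic//.
rewrite ge0_integral_mpow_density//; last exact/measurable_EFinP.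
rewrite setIT [RHS]integral_mkcond; apply: eq_integral => t _.
by rewrite patchE indicE; case: ifPn => _; rewrite ?mul1e ?mul0e.
Qed.

End mpow_density.

(** * Moments of sums of independent variables *)

Section second_moment.
Context d (T : measurableType d) (R : realType) (P : probability T R).
Variable Z : T -> R.
Hypotheses (iZ : P.-integrable setT (EFin \o Z))
  (iZ2 : P.-integrable setT (EFin \o (fun x => Z x ^+ 2))).
Let z1 := fine (\int[P]_x (Z x)%:E).
Let z2 := fine (\int[P]_x (Z x ^+ 2)%:E).
Local Open Scope ereal_scope.

Lemma integral_quadratic (a b c : R) :
  \int[P]_x (a * Z x ^+ 2 + b * Z x + c)%:E = (a * z2 + b * z1 + c)%:E.
Proof.
transitivity (\int[P]_x (a%:E * (Z x ^+ 2)%:E + b%:E * (Z x)%:E + c%:E)) => //.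
have i2 : P.-integrable setT (fun x => a%:E * (Z x ^+ 2)%:E) by exact: integrableZl.
have i1 : P.-integrable setT (fun x => b%:E * (Z x)%:E) by exact: integrableZl.
have i0 : P.-integrable setT (fun x => c%:E) by exact: finite_measure_integrable_cst.
rewrite integralD//=; last exact: integrableD.
rewrite integralD//= integralZl//= integralZl//= integral_cst//= probability_setT mule1.
by rewrite -(fineK (integrable_fin_num measurableT iZ)) -(fineK (integrable_fin_num measurableT iZ2)).
Qed.

(** Expanding the square, the n (n - 1) cross terms have the mean z1^2 by independence. *)
Lemma integral_sqr_sum n (a : R) :
  \int[mpow P n]_t ((a + \sum_i Z (tnth t i)) ^+ 2)%:E =
  (a ^+ 2 + 2 * a * n%:R * z1 + n%:R * z2 + n%:R * (n%:R - 1) * z1 ^+ 2)%:E.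
Proof.
have mZ : measurable_fun setT Z by apply/measurable_EFinP; exact: measurable_int iZ.
have mS k (b : R) : measurable_fun setT (fun t : k.-tuple T => ((b + \sum_i Z (tnth t i)) ^+ 2)%:E).
  apply/measurable_EFinP; apply: measurable_funX; apply: measurable_funD => //.
  exact: (measurable_tuple_sum (fun=> mZ)).
elim: n a => [|n ih] a.
  by rewrite ge0_integral_mpow0//; congr EFin; rewrite big_ord0; ring.
rewrite ge0_integral_mpowS//; last by move=> t; rewrite lee_fin sqr_ge0.
under eq_integral => x _.
  under eq_integral => t _ do rewrite (tcons_sum (fun=> Z)) addrA.
  rewrite ih.
  rewrite (_ : _ + _ = 1 * Z x ^+ 2 + (2 * a + 2 * n%:R * z1) * Z x +
    (a ^+ 2 + 2 * a * n%:R * z1 + n%:R * z2 + n%:R * (n%:R - 1) * z1 ^+ 2))%R; last by ring.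
  over.
rewrite integral_quadratic -natr1; congr EFin; ring.
Qed.

End second_moment.

(** * Lebesgue measure on row vectors *)

Section measurable_rows.
Context {R : realType} {d : nat}.
Implicit Types (x y : 'rV[R]_d) (f : 'rV[R]_d -> R).

Lemma measurable_fun_rV d' (T : measurableType d') (f : T -> 'rV[R]_d) :
  (forall i, measurable_fun setT (fun z => f z ord0 i)) -> measurable_fun setT f.
Proof.
move=> mf _ Y mY; rewrite setTI; move: Y mY; apply: smallest_sub.
  split=> /=.
  - by rewrite preimage_set0; exact: measurable0.
  - by move=> A mA; rewrite setTD preimage_setC; exact: measurableC.
  - by move=> F mF; rewrite preimage_bigcup; exact: bigcupT_measurable.
move=> A; rewrite -bigcup_seq => -[i _ [B mB <-]]; rewrite setTI.
rewrite /= -comp_preimage (_ : _ \o _ = fun z => f z ord0 i)//.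
by rewrite -[X in measurable X]setTI; exact: mf.
Qed.

Lemma measurable_coord i : measurable_fun setT (fun x : 'rV[R]_d => x ord0 i).
Proof.
move=> _ Y mY; rewrite setTI; apply: sub_sigma_algebra => /=.
rewrite -bigcup_seq/=; exists i => /=; first by rewrite mem_index_enum.
by exists Y => //; rewrite setTI.
Qed.

Lemma measurable_forall_coord (P : 'I_d -> set R) : (forall i, measurable (P i)) ->
  measurable [set x : 'rV[R]_d | forall i, P i (x ord0 i)].
Proof.
move=> mP.
rewrite (_ : [set _ | _] = \bigcap_(i in [set: 'I_d]) ((fun x : 'rV[R]_d => x ord0 i) @^-1` P i)).
  apply: fin_bigcap_measurable => // i _.
  by rewrite -[X in measurable X]setTI; exact: measurable_coord.
by apply/seteqP; split => x /= h i => [_|]; exact: h.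
Qed.

Lemma ball_rV x y (e : R) : 0 < e -> ball x e y <-> forall i, `|x ord0 i - y ord0 i| < e.
Proof.
move=> e0; split=> [[_ h] i|h]; first exact: h.
by split=> // i j; rewrite (ord1 i); exact: h.
Qed.

(** The sigma-algebra is generated by the coordinates; an open set is a countable union of
    cubes with rational centres and sides 2/(n+1). *)
Lemma open_measurable_rV (U : set 'rV[R]_d) : open U -> measurable U.
Proof.
move=> oU; pose r n : R := n.+1%:R^-1.
pose B (q : 'rV[rat]_d * nat) : set 'rV[R]_d :=
  [set x | (forall i, `|ratr (q.1 ord0 i) - x ord0 i| < r q.2) /\
    forall y : 'rV[R]_d, (forall i, `|ratr (q.1 ord0 i) - y ord0 i| < r q.2) -> U y].
have -> : U = \bigcup_q B q.
  apply/seteqP; split=> [x Ux|x [q _ [h1 h2]]]; last exact: h2.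
  move: oU; rewrite openE => /(_ x Ux) /nbhs_ballP[e /= e0 eU].
  have [n ne] : exists n, r n < e / 2.
    have [n hn] := ltr_add_invr (divr_gt0 e0 (ltr0Sn _ 1)).
    by exists n; rewrite /r -[X in X < _]add0r.
  have rn0 : 0 < r n by rewrite invr_gt0.
  have hq i : exists q : rat, `|ratr q - x ord0 i| < r n.
    have : x ord0 i - r n < x ord0 i + r n by lra.
    by move=> /rat_in_itvoo[q]; rewrite in_itv/= => h; exists q; rewrite ltr_norml; lra.
  pose q : 'rV[rat]_d := \row_i projT1 (cid (hq i)).
  have qE i : `|ratr (q ord0 i) - x ord0 i| < r n by rewrite mxE; exact: (projT2 (cid (hq i))).
  exists (q, n) => //; split => // y hy; apply: eU; apply/ball_rV => // i.
  have := qE i; have := hy i; rewrite /= !ltr_norml; lra.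
apply: countable_bigcupT_measurable; first exact: countableP.
move=> q; have [h|h] := pselect (forall y : 'rV[R]_d,
    (forall i, `|ratr (q.1 ord0 i) - y ord0 i| < r q.2) -> U y); last first.
  by rewrite (_ : B q = set0)// -subset0 => x [_].
rewrite (_ : B q = [set x | forall i, `]ratr (q.1 ord0 i) - r q.2, ratr (q.1 ord0 i) + r q.2[%classic (x ord0 i)]).
  apply: (measurable_forall_coord (P := fun i =>
    `]ratr (q.1 ord0 i) - r q.2, ratr (q.1 ord0 i) + r q.2[%classic)) => i.
  exact: measurable_itv.
apply/seteqP; split=> [x [hx _] i|x hx].
  by have := hx i; rewrite /= in_itv/= ltr_norml; lra.
by split=> // i; have := hx i; rewrite /= in_itv/= ltr_norml; lra.
Qed.

Lemma closed_measurable_rV (U : set 'rV[R]_d) : closed U -> measurable U.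
Proof. by move=> /closed_openC/open_measurable_rV/measurableC; rewrite setCK. Qed.

Lemma continuous_measurable_rV f : continuous f -> measurable_fun setT f.
Proof.
move=> /continuousP cf; apply: (measurability _ (RGenOpens.measurableE R)).
move=> _ -[_ [a [b ->]] <-]; rewrite setTI; apply: open_measurable_rV; apply: cf.
exact: interval_open.
Qed.

Lemma measurable_box a b : measurable (@box R d a b).
Proof.
apply: (measurable_forall_coord (P := fun i => `[a i, b i]%classic)) => i.
exact: measurable_itv.
Qed.

End measurable_rows.

Section leb_integral.
Context {R : realType}.
Notation leb1 := (@lebesgue_measure R).
Local Open Scope ereal_scope.

Lemma ge0_integral_leb d (G : 'rV[R]_d -> \bar R) : measurable_fun setT G -> (forall x, 0 <= G x) ->
  \int[@leb R d]_x G x = \int[mpow leb1 d]_t G (rV_of_tuple t).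
Proof.
move=> mG G0.
rewrite -[LHS]/(\int[pushforward (mpow leb1 d) (@rV_of_tuple R d)]_x G x).
by rewrite ge0_integral_pushforward//; exact: measurable_rV_of_tuple.
Qed.

Lemma rV_of_tuple_tens d (u : 'I_d -> R -> R) t : tens u (rV_of_tuple t) = (\prod_i u i (tnth t i))%R.
Proof. by rewrite /tens; apply: eq_bigr => i _; rewrite mxE. Qed.

Lemma measurable_tens d (u : 'I_d -> R -> R) : (forall i, measurable_fun setT (u i)) ->
  measurable_fun setT (tens u).
Proof.
move=> mu; apply: measurable_prod => i _.
by apply: measurableT_comp => //; exact: measurable_coord.
Qed.

Lemma integral_leb_tens d (u : 'I_d -> R -> R) : (forall i, leb1.-integrable setT (EFin \o u i)) ->
  (@leb R d).-integrable setT (EFin \o tens u) /\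
  \int[@leb R d]_x (tens u x)%:E = \prod_i \int[leb1]_x (u i x)%:E.
Proof.
move=> ui; have [I E] := integral_mpow_prod ui.
have mu i : measurable_fun setT (u i) by apply/measurable_EFinP; exact: measurable_int (ui i).
have mt : measurable_fun setT (EFin \o tens u) by apply/measurable_EFinP; exact: measurable_tens.
have I' : (mpow leb1 d).-integrable setT ((EFin \o tens u) \o @rV_of_tuple R d).
  by apply: eq_integrable I => // t _ /=; rewrite rV_of_tuple_tens.
split.
  rewrite -[X in X.-integrable _ _]/(pushforward (mpow leb1 d) (@rV_of_tuple R d)).
  by apply: integrable_pushforward => //; exact: measurable_rV_of_tuple.
rewrite -[LHS]/(\int[pushforward (mpow leb1 d) (@rV_of_tuple R d)]_x ((EFin \o tens u) x)).
rewrite integral_pushforward//; last exact: measurable_rV_of_tuple.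
by rewrite preimage_setT -E; apply: eq_integral => t _ /=; rewrite rV_of_tuple_tens.
Qed.

Lemma leb_box d (a b : 'I_d -> R) : (forall i, (a i <= b i)%R) ->
  @leb R d (box a b) = (\prod_i (b i - a i))%:E.
Proof.
move=> ab; pose u i : R -> R := \1_(`[a i, b i]%classic).
have mI i : measurable `[a i, b i]%classic by exact: measurable_itv.
have uI i : \int[leb1]_x (u i x)%:E = (b i - a i)%:E.
  rewrite integral_indic// setIT.
  rewrite /= lebesgue_measure_itv/= lte_fin -EFinD; case: ltgtP (ab i) => // -> _.
  by rewrite subrr.
have ui i : leb1.-integrable setT (EFin \o u i).
  apply/integrableP; split; first exact/measurable_EFinP/measurable_indic.
  rewrite (_ : (fun x => _) = (fun x => (u i x)%:E)); last first.
    by apply/funext => x /=; rewrite ger0_norm.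
  by rewrite uI ltry.
have [_ E] := integral_leb_tens ui.
rewrite -(setIT (box a b)) -integral_indic//; last exact: measurable_box.
rewrite (_ : (fun x => _) = (fun x => (tens u x)%:E)); last first.
  apply/funext => x; congr EFin; rewrite indicE /tens.
  have [/set_mem xab|xab] := boolP (x \in box a b).
    rewrite big1// => i _; rewrite /u indicE mem_set//= in_itv/=; exact: xab.
  have [i xi] : exists i, ~~ (a i <= x ord0 i <= b i)%R.
    by apply: contrapT => h; move/negP: xab; apply; apply/mem_set => i; apply: contrapT => /negP hi;
      apply: h; exists i.
  rewrite (bigD1 i)//= /u indicE memNset ?mul0r//= in_itv/=; exact/negP.
transitivity (\prod_i \int[leb1]_x (u i x)%:E); first exact: E.
rewrite (eq_bigr (fun i => (b i - a i)%:E)); first by rewrite prodEFin.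
by move=> i _; exact: uI.
Qed.

Lemma lebesgue_measure_shift (v : R) (A : set R) : measurable A ->
  leb1 ((fun x => x + v)%R @^-1` A) = leb1 A.
Proof.
move=> mA.
have mv : measurable_fun setT (fun x : measurableTypeR R => (x + v : measurableTypeR R))%R.
  exact: measurable_funD.
pose P := measure_function_pushforward__canonical__measure_function_Measure leb1 mv.
apply/esym; rewrite -[RHS]/(P A); apply: lebesgue_measure_unique => // X [[a b]] /= _ <-.
rewrite -[RHS]/(leb1 _) (_ : _ @^-1` _ = `](a - v)%R, (b - v)%R]%classic).
  rewrite !lebesgue_measure_itv/= !lte_fin ltrD2r -!EFinD.
  by case: ifP => // _; congr EFin; ring.
by apply/seteqP; split=> x /=; rewrite !in_itv/=; lra.
Qed.

Lemma ge0_integral_shift1 (v : R) (f : R -> \bar R) : measurable_fun setT f ->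
  (forall x, 0 <= f x) -> \int[leb1]_x f (x + v)%R = \int[leb1]_x f x.
Proof.
move=> mf f0.
have mv : measurable_fun setT (fun x : measurableTypeR R => (x + v : measurableTypeR R))%R.
  exact: measurable_funD.
transitivity (\int[pushforward leb1 (fun x : measurableTypeR R => (x + v : measurableTypeR R)%R)]_x f x).
  by rewrite ge0_integral_pushforward// preimage_setT.
by apply: eq_measure_integral => A mA _; exact: lebesgue_measure_shift.
Qed.

Definition tshift n (v : 'I_n -> R) (t : n.-tuple (measurableTypeR R)) :
  n.-tuple (measurableTypeR R) := [tuple (tnth t i + v i)%R | i < n].

Lemma measurable_tshift n (v : 'I_n -> R) : measurable_fun setT (tshift v).
Proof.
apply/measurable_fun_tnthP => i; rewrite (_ : _ \o _ = fun t => (tnth t i + v i)%R).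
  by apply: measurable_funD => //; exact: measurable_tnth.
by apply/funext => t /=; rewrite tnth_mktuple.
Qed.

Lemma tshift_tcons n (v : 'I_n.+1 -> R) x t : tshift v (tcons (x, t)) =
  tcons ((x + v ord0)%R : measurableTypeR R, tshift (fun i => v (lift ord0 i)) t).
Proof.
apply: eq_from_tnth => i; rewrite tnth_mktuple.
case: (unliftP ord0 i) => [j ->|->]; last by [].
by rewrite !tnthS tnth_mktuple.
Qed.

Lemma ge0_integral_mpow_shift n (v : 'I_n -> R) (G : n.-tuple (measurableTypeR R) -> \bar R) :
  measurable_fun setT G -> (forall t, 0 <= G t) ->
  \int[mpow leb1 n]_t G (tshift v t) = \int[mpow leb1 n]_t G t.
Proof.
elim: n v G => [|n ih] v G mG G0.
  have ms := measurable_tshift v.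
  rewrite !ge0_integral_mpow0//; first by congr G; apply: eq_from_tnth => -[].
  exact: measurableT_comp.
rewrite ge0_integral_mpowS//; last by apply: measurableT_comp => //; exact: measurable_tshift.
rewrite ge0_integral_mpowS//.
under eq_integral => x _.
  under eq_integral => t _ do rewrite tshift_tcons.
  rewrite (ih _ (fun t => G (tcons ((x + v ord0)%R : measurableTypeR R, t))))//; last first.
    by apply: measurableT_comp => //; exact: measurable_tcons1.
  over.
rewrite (@ge0_integral_shift1 (v ord0) (fun x : R => \int[mpow leb1 n]_t G (tcons (x : measurableTypeR R, t))))//.
  apply: (measurable_fun_fubini_tonelli_F (fun z => G (tcons z))) => //.
  by apply: measurableT_comp => //; exact: measurable_tcons.
by move=> x; apply: integral_ge0.
Qed.

Lemma measurable_shift_rV d (v : 'rV[R]_d) : measurable_fun setT (fun x : 'rV[R]_d => x + v)%R.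
Proof.
apply: measurable_fun_rV => i; under eq_fun do rewrite mxE.
by apply: measurable_funD => //; exact: measurable_coord.
Qed.

Lemma ge0_integral_leb_shift d (v : 'rV[R]_d) (G : 'rV[R]_d -> \bar R) : measurable_fun setT G ->
  (forall x, 0 <= G x) -> \int[@leb R d]_x G (x + v)%R = \int[@leb R d]_x G x.
Proof.
move=> mG G0.
have mr := @measurable_rV_of_tuple R d.
rewrite (ge0_integral_leb mG G0) ge0_integral_leb//; last first.
  by apply: measurableT_comp => //; exact: measurable_shift_rV.
rewrite -(ge0_integral_mpow_shift (fun i => v ord0 i) (measurableT_comp mG mr))//=.
apply: eq_integral => t _; congr G; apply/rowP => i.
by rewrite !mxE tnth_mktuple; congr (_ + v _ _)%R; exact: ord1.
Qed.

Lemma integral_leb_shift d (v : 'rV[R]_d) (G : 'rV[R]_d -> \bar R) : measurable_fun setT G ->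
  \int[@leb R d]_x G (x + v)%R = \int[@leb R d]_x G x.
Proof.
move=> mG; rewrite integralE [RHS]integralE.
have E : (fun x => G (x + v)%R) = G \o (fun x => x + v)%R by [].
congr (_ - _).
  rewrite -(ge0_integral_leb_shift v (measurable_funepos mG))//.
  by apply: eq_integral => x _; rewrite E funepos_comp.
rewrite -(ge0_integral_leb_shift v (measurable_funeneg mG))//.
by apply: eq_integral => x _; rewrite E funeneg_comp.
Qed.

End leb_integral.

(** * Quadratic forms *)

Section polarization.
Context {R : realType} {V : lmodType R}.
Variables (P : set V) (Q : V -> R).
Hypotheses (PD : forall x y, P x -> P y -> P (x + y)) (PZ : forall (c : R) x, P x -> P (c *: x)).
Hypotheses (Q0 : forall x, P x -> 0 <= Q x)
  (QZ : forall (c : R) x, P x -> Q (c *: x) = c ^+ 2 * Q x)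
  (QP : forall x y, P x -> P y -> Q (x + y) + Q (x - y) = 2 * Q x + 2 * Q y).

Definition polar x y := (Q (x + y) - Q (x - y)) / 4.

Let PN x : P x -> P (- x).
Proof. by move=> Px; rewrite -scaleN1r; exact: PZ. Qed.

Let P0 x : P x -> P 0.
Proof. by move=> Px; rewrite -(scale0r x); exact: PZ. Qed.

Let Qz x : P x -> Q 0 = 0.
Proof. by move=> Px; rewrite -(scale0r x) QZ// expr0n/= mul0r. Qed.

Let QN x : P x -> Q (- x) = Q x.
Proof. by move=> Px; rewrite -scaleN1r QZ// sqrrN expr1n mul1r. Qed.

Lemma polar_diag x : P x -> polar x x = Q x.
Proof.
move=> Px; rewrite /polar subrr (Qz Px) -mulr2n -scaler_nat QZ// subr0.
by field.
Qed.

Lemma polarC x y : P x -> P y -> polar x y = polar y x.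
Proof.
move=> Px Py; have Pxy : P (x - y) by apply: PD => //; exact: PN.
by rewrite /polar (addrC y x) -(QN Pxy) opprB.
Qed.

Let polar_half x y z : P x -> P y -> P z ->
  polar x z + polar y z = polar (x + y) (2 *: z) / 2.
Proof.
move=> Px Py Pz; rewrite /polar.
have h1 := QP (PD Px Pz) (PD Py Pz); have h2 := QP (PD Px (PN Pz)) (PD Py (PN Pz)).
have e1 : x + z + (y + z) = x + y + 2 *: z by rewrite addrACA scaler_nat mulr2n.
have e2 : x + z - (y + z) = x - y by rewrite opprD addrACA subrr addr0.
have e3 : x - z + (y - z) = x + y - 2 *: z by rewrite addrACA scaler_nat mulr2n opprD.
have e4 : x - z - (y - z) = x - y by rewrite opprB addrA subrK.
by rewrite e1 e2 in h1; rewrite e3 e4 in h2; lra.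
Qed.

Lemma polarDl x y z : P x -> P y -> P z -> polar (x + y) z = polar x z + polar y z.
Proof.
move=> Px Py Pz; rewrite polar_half//.
have := polar_half (PD Px Py) (P0 Px) Pz.
by rewrite {2}/polar !addr0 add0r sub0r (QN Pz) subrr mul0r addr0 => ->.
Qed.

Let polar_bound x z : P x -> P z -> `|polar x z| <= (Q x + Q z) / 2.
Proof.
move=> Px Pz; have h := QP Px Pz.
have := Q0 (PD Px Pz); have := Q0 (PD Px (PN Pz)) => h1 h2.
by rewrite /polar ler_norml; lra.
Qed.

(** This is the step from additivity to linearity in the construction of an inner product from
    a norm with the parallelogram law; boundedness stands in for continuity. *)
Let additive_bounded_linear (a : R -> R) (M : R) : (forall s t, a (s + t) = a s + a t) ->
  (forall t, 0 <= t <= 1 -> `|a t| <= M) -> forall t, a t = t * a 1.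
Proof.
move=> aD aM t; pose D t := a t - t * a 1.
have DD s u : D (s + u) = D s + D u by rewrite /D aD; ring.
have D0 : D 0 = 0 by have := DD 0 0; rewrite addr0; lra.
have Dn n u : D (n%:R * u) = n%:R * D u.
  by elim: n => [|n ih]; rewrite ?mul0r// -natr1 mulrDl mul1r DD ih; ring.
have DN u : D (- u) = - D u by have := DD u (- u); rewrite subrr D0; lra.
have D1 : D 1 = 0 by rewrite /D; ring.
have Dz (z : int) : D z%:~R = 0.
  case: z => n; first by have := Dn n 1; rewrite mulr1 D1 mulr0.
  by rewrite NegzE mulrNz DN; have := Dn n.+1 1; rewrite mulr1 D1 mulr0 => ->; rewrite oppr0.
have M0 : 0 <= M by have := aM 0; rewrite lexx ler01 => /(_ isT); apply: le_trans.
have DM u : `|D u| <= M + `|a 1|.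
  have -> : D u = D (u - (Num.floor u)%:~R).
    by rewrite DD DN Dz oppr0 addr0.
  set v := u - _; have v01 : 0 <= v <= 1.
    have := floor_le_tmp u; have := floorD1_gt u; rewrite /v intrD; lra.
  apply: le_trans (ler_normB _ _) _; apply: lerD; first exact: aM.
  rewrite normrM ler_piMl// ger0_norm; lra.
suff : D t = 0 by rewrite /D; lra.
apply/eqP; rewrite -normr_eq0; apply/negPn/negP => Dt0.
have Dt : 0 < `|D t| by rewrite lt_def Dt0 normr_ge0.
have [n hn] : exists n, (M + `|a 1|) / `|D t| < n%:R.
  exists (Num.truncn ((M + `|a 1|) / `|D t|)).+1; exact: truncnS_gt.
have := DM (n%:R * t); rewrite Dn normrM normr_nat leNgt => /negP; apply.
by rewrite -ltr_pdivrMr.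
Qed.

Lemma polarZl (c : R) x z : P x -> P z -> polar (c *: x) z = c * polar x z.
Proof.
move=> Px Pz; rewrite (@additive_bounded_linear (fun t => polar (t *: x) z) ((Q x + Q z) / 2)).
- by rewrite scale1r.
- by move=> s t; rewrite scalerDl polarDl//; exact: PZ.
- move=> t t01; apply: le_trans (polar_bound (PZ _ Px) Pz) _.
  rewrite QZ//; have := Q0 Px => h.
  have : t ^+ 2 * Q x <= 1 * Q x by rewrite ler_wpM2r// expr_le1//; lra.
  lra.
Qed.

Lemma polar_sum (I : finType) (c : I -> R) (x : I -> V) y : P y -> (forall i, P (x i)) ->
  P (\sum_i c i *: x i) /\ polar (\sum_i c i *: x i) y = \sum_i c i * polar (x i) y.
Proof.
move=> Py Px; elim: (index_enum I) => [|i s [ih1 ih2]].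
  rewrite !big_nil; split; first exact: P0 Py.
  by rewrite /polar add0r sub0r (QN Py) subrr mul0r.
rewrite !big_cons polarDl//; last exact: PZ.
by rewrite polarZl// ih2; split=> //; apply: PD => //; exact: PZ.
Qed.

Lemma le_discriminant (a b c : R) : (forall t, 0 <= a - 2 * t * b + t ^+ 2 * c) -> 0 <= c ->
  b ^+ 2 <= a * c.
Proof.
move=> h; rewrite le_eqVlt => /predU1P[c0|c0].
  have b0 : b = 0.
    apply/eqP/negPn/negP => b0; have := h ((a + 1) / (2 * b)).
    rewrite -c0 mulr0 addr0 (_ : 2 * _ * b = a + 1); [lra|by field].
  by rewrite b0 -c0 expr0n/= mulr0.
have := h (b / c); rewrite (_ : a - _ + _ = a - b ^+ 2 / c); last first.
  by field; rewrite gt_eqF.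
by rewrite subr_ge0 ler_pdivrMr.
Qed.

Lemma polar_CauchySchwarz x y : P x -> P y -> polar x y ^+ 2 <= Q x * Q y.
Proof.
move=> Px Py; apply: le_discriminant; last exact: Q0.
move=> t; have Pt : P (- t *: y) by exact: PZ.
have := Q0 (PD Px Pt); rewrite -(polar_diag (PD Px Pt)) polarDl//; last exact: PD.
rewrite (polarC Px)//; last exact: PD.
rewrite (polarC Pt)//; last exact: PD.
rewrite !polarDl// polar_diag// polar_diag// polarZl// (polarC Px Pt) polarZl// QZ//.
rewrite (polarC Py Px); nra.
Qed.

End polarization.

Section quadratic_inf.
Context {R : realType} {V W : lmodType R}.
Variables (S : V -> set W) (Q : W -> \bar R).
Local Open Scope ereal_scope.
Hypothesis Q0 : forall h, 0 <= Q h.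

(** The squared norm of W^{m,2} and the squared K-functional have this form, S f being the set
    of the data that represent f. *)
Definition qinf f := ereal_inf [set Q h | h in S f].

Lemma qinf_ge0 f : 0 <= qinf f.
Proof. by apply: le_ereal_inf_tmp => _ [h _ <-]. Qed.

(** The infimum of a quadratic form over data that depend linearly on f is quadratic in f:
    near-minimizers for two points add up to competitors for their sum and difference. *)
Lemma qinf_parallelogram f1 f2 :
  (forall h1 h2, S f1 h1 -> S f2 h2 -> [/\ S (f1 + f2)%R (h1 + h2)%R, S (f1 - f2)%R (h1 - h2)%R &
     Q (h1 + h2)%R + Q (h1 - h2)%R <= 2%:E * Q h1 + 2%:E * Q h2]) ->
  qinf (f1 + f2)%R + qinf (f1 - f2)%R <= 2%:E * qinf f1 + 2%:E * qinf f2.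
Proof.
move=> hS.
have [->|f1oo] := eqVneq (qinf f1) +oo.
  rewrite mulry gtr0_sg// mul1e addye ?leey// gt_eqF//.
  by apply: lt_le_trans (_ : 0 <= _); rewrite ?ltNy0// mule_ge0 ?lee_fin// qinf_ge0.
have [->|f2oo] := eqVneq (qinf f2) +oo.
  rewrite mulry gtr0_sg// mul1e addey ?leey// gt_eqF//.
  by apply: lt_le_trans (_ : 0 <= _); rewrite ?ltNy0// mule_ge0 ?lee_fin// qinf_ge0.
have fin1 : qinf f1 \is a fin_num by rewrite ge0_fin_numE ?qinf_ge0// lt_neqAle f1oo leey.
have fin2 : qinf f2 \is a fin_num by rewrite ge0_fin_numE ?qinf_ge0// lt_neqAle f2oo leey.
apply/lee_addgt0Pr => e e0; have e4 : (0 < e / 4)%R by lra.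
have [_ [h1 Sh1 <-] lt1] := lb_ereal_inf_adherent e4 fin1.
have [_ [h2 Sh2 <-] lt2] := lb_ereal_inf_adherent e4 fin2.
have [SD SB QQ] := hS _ _ Sh1 Sh2.
apply: (@le_trans _ _ (Q (h1 + h2)%R + Q (h1 - h2)%R)).
  by apply: leeD; apply: ereal_inf_lbound; [exists (h1 + h2)%R|exists (h1 - h2)%R].
apply: le_trans QQ _.
apply: (@le_trans _ _ (2%:E * (qinf f1 + (e / 4)%:E) + 2%:E * (qinf f2 + (e / 4)%:E))).
  by apply: leeD; rewrite lee_pmul2l//; exact: ltW.
rewrite -(fineK fin1) -(fineK fin2) -!(EFinD, EFinM) lee_fin; lra.
Qed.

Lemma qinf_scale (c : R) f : c != 0%R ->
  (forall h, S f h -> S (c *: f) (c *: h) /\ Q (c *: h) <= (c ^+ 2)%:E * Q h) ->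
  qinf (c *: f) <= (c ^+ 2)%:E * qinf f.
Proof.
move=> c0 hS; have c2 : (0 < c ^+ 2)%R by rewrite exprn_even_gt0.
rewrite -lee_pdivrMl//; apply: le_ereal_inf_tmp => _ [h Sh <-].
have [S1 S2] := hS _ Sh.
rewrite lee_pdivrMl//; by apply: le_trans S2; apply: ereal_inf_lbound; exists (c *: h).
Qed.

End quadratic_inf.

(** * Square-integrable functions on the domain *)

Section L2_theory.
Context {R : realType} {d : nat} (Omega : set 'rV[R]_d).
Let X := closure Omega.
Hypothesis Xfin : (@leb R d X < +oo)%E.
Implicit Types f g : 'rV[R]_d -> R.
Notation lebd := (@leb R d).
Notation L2 := (L2 Omega).
Notation L2sq := (L2sq Omega).
Notation L2dot := (L2dot Omega).

Lemma measurable_closure : measurable X.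
Proof. apply: closed_measurable_rV; exact: closed_closure. Qed.
Hint Resolve measurable_closure : core.

Lemma L2sq_ge0 f : (0 <= L2sq f)%E.
Proof. by apply: integral_ge0 => x _; rewrite lee_fin sqr_ge0. Qed.

Lemma L2_integrable_sq f : L2 f -> lebd.-integrable X (EFin \o (fun x => f x ^+ 2)).
Proof.
move=> [mf foo]; apply/integrableP; split.
  by apply/measurable_EFinP; exact: measurable_funX.
rewrite (_ : (fun x => _) = (fun x => (f x ^+ 2)%:E))//.
by apply/funext => x /=; rewrite ger0_norm// sqr_ge0.
Qed.

Lemma L2_integrableM f g : L2 f -> L2 g -> lebd.-integrable X (EFin \o (fun x => f x * g x)).
Proof.
move=> Lf Lg; have I := integrableD measurable_closure (L2_integrable_sq Lf) (L2_integrable_sq Lg).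
apply: le_integrable I => //.
  by apply/measurable_EFinP; apply: measurable_funM; [exact: Lf.1|exact: Lg.1].
move=> x _ /=; rewrite lee_fin [leRHS]ger0_norm ?addr_ge0 ?sqr_ge0// normrM.
rewrite -(real_normK (num_real (f x))) -(real_normK (num_real (g x))).
have := sqr_ge0 (`|f x| - `|g x|); have := sqr_ge0 `|f x|; have := sqr_ge0 `|g x|; nra.
Qed.

Lemma L2sqE f : L2 f -> L2sq f = (L2dot f f)%:E.
Proof.
move=> Lf; have I := L2_integrableM Lf Lf.
rewrite /Defs.L2dot /Rintegral fineK//; exact: integrable_fin_num.
Qed.

Lemma L2D f g : L2 f -> L2 g -> L2 (f + g).
Proof.
move=> Lf Lg; split; first by apply: measurable_funD; [exact: Lf.1|exact: Lg.1].
have I : lebd.-integrable X (EFin \o (fun x => (f x + g x) ^+ 2)).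
  have I1 := integrableD measurable_closure (L2_integrable_sq Lf) (L2_integrable_sq Lg).
  have I2 := integrableD measurable_closure I1 (integrableZl measurable_closure 2 (L2_integrableM Lf Lg)).
  apply: eq_integrable I2 => // x _ /=.
  by rewrite -!EFinM -!EFinD; congr EFin; ring.
move/integrableP : I => [_]; apply: le_lt_trans; apply: ge0_le_integral => //.
- by move=> x _; rewrite lee_fin sqr_ge0.
- by apply/measurable_EFinP/measurable_funX/measurable_funD; [exact: Lf.1|exact: Lg.1].
- apply/measurable_EFinP/measurableT_comp => //; apply: measurable_funX.
  by apply: measurable_funD; [exact: Lf.1|exact: Lg.1].
- by move=> x _ /=; rewrite lee_fin ler_norm.
Qed.

Lemma L2sqZ (c : R) f : measurable_fun X f -> L2sq (c *: f) = ((c ^+ 2)%:E * L2sq f)%E.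
Proof.
move=> mf; rewrite /Defs.L2sq -ge0_integralZl//.
- by apply: eq_integral => x _; rewrite -EFinM -exprMn.
- by apply/measurable_EFinP/measurable_funX.
- by move=> x _; rewrite lee_fin sqr_ge0.
- by rewrite lee_fin sqr_ge0.
Qed.

Lemma L2Z (c : R) f : L2 f -> L2 (c *: f).
Proof.
move=> Lf; split; first exact: (measurable_funM (measurable_cst c) Lf.1).
rewrite L2sqZ; last exact: Lf.1.
by apply: lte_mul_pinfty; rewrite ?lee_fin ?sqr_ge0//; exact: Lf.2.
Qed.

Lemma L2N f : L2 f -> L2 (- f).
Proof. by move=> Lf; rewrite -scaleN1r; exact: L2Z. Qed.

Lemma L2B f g : L2 f -> L2 g -> L2 (f - g).
Proof. by move=> Lf Lg; apply: L2D => //; exact: L2N. Qed.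

Lemma L2_bounded f (M : R) : measurable_fun X f -> (forall x, X x -> `|f x| <= M) ->
  L2 f /\ (L2sq f <= (M ^+ 2)%:E * lebd X)%E.
Proof.
move=> mf fM.
have le : (L2sq f <= (M ^+ 2)%:E * lebd X)%E.
  rewrite -integral_cst//; apply: ge0_le_integral => //.
  - by move=> x _; rewrite lee_fin sqr_ge0.
  - by apply/measurable_EFinP/measurable_funX.
  - move=> x Xx /=; rewrite lee_fin -(real_normK (num_real (f x))).
    by rewrite lerXn2r ?nnegrE//; [apply: le_trans (fM x Xx)|exact: fM].
split=> //; split => //; apply: le_lt_trans le _.
by apply: lte_mul_pinfty; rewrite ?lee_fin ?sqr_ge0.
Qed.

Lemma L20 : L2 0.
Proof. suff [] : L2 0 /\ (L2sq 0%R <= (0 ^+ 2)%R%:E * lebd X)%E by [].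
apply: L2_bounded; first exact: measurable_cst.
by move=> x _; rewrite normr0. Qed.

Lemma L2_sum (I : Type) (s : seq I) (F : I -> 'rV[R]_d -> R) : (forall i, L2 (F i)) ->
  L2 (\sum_(i <- s) F i).
Proof.
move=> LF; elim: s => [|i s ih]; first by rewrite big_nil; exact: L20.
by rewrite big_cons; exact: L2D.
Qed.

Lemma L2dotC f g : L2dot f g = L2dot g f.
Proof. by rewrite /Defs.L2dot; apply: eq_Rintegral => x _; rewrite mulrC. Qed.

Lemma L2dotDl f g h : L2 f -> L2 g -> L2 h -> L2dot (f + g) h = L2dot f h + L2dot g h.
Proof.
move=> Lf Lg Lh; rewrite /Defs.L2dot -RintegralD//; try exact: L2_integrableM.
by apply: eq_Rintegral => x _; rewrite -mulrDl.
Qed.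

Lemma L2dotZl (c : R) f g : L2 f -> L2 g -> L2dot (c *: f) g = c * L2dot f g.
Proof.
move=> Lf Lg; rewrite /Defs.L2dot -RintegralZl//; try exact: L2_integrableM.
by apply: eq_Rintegral => x _; rewrite mulrA.
Qed.

Lemma L2dotNl f g : L2 f -> L2 g -> L2dot (- f) g = - L2dot f g.
Proof. by move=> Lf Lg; rewrite -scaleN1r L2dotZl// mulN1r. Qed.

Lemma L2dotBl f g h : L2 f -> L2 g -> L2 h -> L2dot (f - g) h = L2dot f h - L2dot g h.
Proof. by move=> Lf Lg Lh; rewrite L2dotDl ?L2dotNl//; exact: L2N. Qed.

Lemma L2dot0l f : L2 f -> L2dot 0 f = 0.
Proof. by move=> Lf; rewrite -(scale0r 0) L2dotZl ?mul0r//; exact: L20. Qed.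

Lemma L2dot_suml (I : Type) (s : seq I) (c : I -> R) (F : I -> 'rV[R]_d -> R) h :
  (forall i, L2 (F i)) -> L2 h ->
  L2dot (\sum_(i <- s) c i *: F i) h = \sum_(i <- s) c i * L2dot (F i) h.
Proof.
move=> LF Lh; elim: s => [|i s ih]; first by rewrite !big_nil L2dot0l.
by rewrite !big_cons L2dotDl ?L2dotZl ?ih//; [exact: L2Z|apply: L2_sum => j; exact: L2Z].
Qed.

Lemma L2dot_ge0 f : L2 f -> 0 <= L2dot f f.
Proof. by move=> Lf; rewrite -lee_fin -L2sqE// L2sq_ge0. Qed.

Lemma L2dotBB f g : L2 f -> L2 g ->
  L2dot (f - g) (f - g) = L2dot f f - 2 * L2dot f g + L2dot g g.
Proof.
move=> Lf Lg; have LB := L2B Lf Lg.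
rewrite L2dotBl// (L2dotC f) (L2dotC g) !L2dotBl// (L2dotC g f); ring.
Qed.

Lemma L2dotDD f g : L2 f -> L2 g ->
  L2dot (f + g) (f + g) = L2dot f f + 2 * L2dot f g + L2dot g g.
Proof.
move=> Lf Lg; have LB := L2D Lf Lg.
rewrite L2dotDl// (L2dotC f) (L2dotC g) !L2dotDl// (L2dotC g f); ring.
Qed.

Lemma L2dot_CauchySchwarz f g : L2 f -> L2 g -> L2dot f g ^+ 2 <= L2dot f f * L2dot g g.
Proof.
move=> Lf Lg; apply: le_discriminant; last exact: L2dot_ge0.
move=> t; have := L2dot_ge0 (L2B Lf (L2Z t Lg)).
rewrite L2dotBB//; last exact: L2Z.
rewrite (L2dotC f) !L2dotZl//; last exact: L2Z.
by rewrite (L2dotC g (_ *: _)) L2dotZl// (L2dotC g f); nra.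
Qed.

Lemma L2sq_parallelogram f g : L2 f -> L2 g ->
  (L2sq (f + g)%R + L2sq (f - g)%R <= 2%:E * L2sq f + 2%:E * L2sq g)%E.
Proof.
move=> Lf Lg; have LD := L2D Lf Lg; have LB := L2B Lf Lg.
rewrite !L2sqE// -!EFinM -!EFinD lee_fin L2dotBB// L2dotDD//; lra.
Qed.

Lemma test_fun_bounded f : test_fun Omega f -> exists M, forall x, `|f x| <= M.
Proof.
move=> [sf [K [cK KO f0]]].
have cf : {within K, continuous f} by apply: continuous_subspaceT; exact: smooth_cont.
have [M [_ hM]] := compact_bounded (continuous_compact cf cK).
exists (`|M + 1|) => x; have [Kx|/f0 ->] := pselect (K x); last by rewrite normr0.
apply: le_trans (ler_norm (M + 1)); apply: hM; first by rewrite ltrDl.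
by exists x.
Qed.

Lemma test_fun_L2 f : test_fun Omega f -> L2 f.
Proof.
move=> tf; have [M fM] := test_fun_bounded tf.
apply: (L2_bounded (M := M) _ _).1 => //; apply: measurable_funTS.
by apply: continuous_measurable_rV; apply: smooth_cont; exact: tf.1.
Qed.

(** * The Sobolev and interpolation norms are quadratic *)

Let mpL2 m (al : multi d m) f : test_fun Omega f -> L2 (mpartial al f).
Proof. by move=> tf; apply: test_fun_L2; exact: test_fun_mpartial. Qed.

Lemma weak_derivativeD m (al : multi d m) g1 g2 h1 h2 : L2 g1 -> L2 g2 -> L2 h1 -> L2 h2 ->
  weak_derivative Omega al g1 h1 -> weak_derivative Omega al g2 h2 ->
  weak_derivative Omega al (g1 + g2) (h1 + h2).
Proof.
move=> Lg1 Lg2 Lh1 Lh2 w1 w2 phi tphi; have L1 := mpL2 al tphi; have L2 := test_fun_L2 tphi.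
by rewrite !L2dotDl// w1// w2// mulrDr.
Qed.

Lemma weak_derivativeZ m (al : multi d m) (c : R) g h : L2 g -> L2 h ->
  weak_derivative Omega al g h -> weak_derivative Omega al (c *: g) (c *: h).
Proof.
move=> Lg Lh w phi tphi; have L1 := mpL2 al tphi; have L2 := test_fun_L2 tphi.
by rewrite !L2dotZl// w// mulrCA.
Qed.

Definition sob_adm m g := [set h : multi d m -> 'rV[R]_d -> R |
  forall al, (msize al <= m)%N -> L2 (h al) /\ weak_derivative Omega al g (h al)].

Definition sob_form m (h : multi d m -> 'rV[R]_d -> R) : \bar R :=
  (\sum_(al : multi d m | (msize al <= m)%N) L2sq (h al))%E.

Lemma sobolev_qinf m g : sobolev_sq Omega m g = qinf (sob_adm (m := m)) (@sob_form m) g.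
Proof. by []. Qed.

Lemma sob_form_ge0 m h : (0 <= @sob_form m h)%E.
Proof. by apply: sume_ge0 => al _; exact: L2sq_ge0. Qed.

Lemma sobolev_sq_ge0 m g : (0 <= sobolev_sq Omega m g)%E.
Proof. by rewrite sobolev_qinf; apply: qinf_ge0 => h; exact: sob_form_ge0. Qed.

Lemma sobolev_sq_le m g h : sob_adm (m := m) g h -> (sobolev_sq Omega m g <= sob_form h)%E.
Proof. by move=> gh; apply: ereal_inf_lbound; exists h. Qed.

Lemma sobolev_parallelogram m g1 g2 : L2 g1 -> L2 g2 ->
  (sobolev_sq Omega m (g1 + g2)%R + sobolev_sq Omega m (g1 - g2)%R <=
   2%:E * sobolev_sq Omega m g1 + 2%:E * sobolev_sq Omega m g2)%E.
Proof.
move=> Lg1 Lg2; rewrite !sobolev_qinf; apply: qinf_parallelogram; first exact: sob_form_ge0.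
move=> h1 h2 a1 a2; split.
- by move=> al /[dup] /a1[L1 w1] /a2[L2' w2]; split; [exact: L2D|exact: weak_derivativeD].
- move=> al /[dup] /a1[L1 w1] /a2[L2' w2]; split; first exact: L2B.
  rewrite -(scaleN1r g2) -(scaleN1r (h2 : _ -> _)); apply: weak_derivativeD => //.
  + exact: L2Z.
  + exact: L2Z.
  + exact: weak_derivativeZ.
- rewrite /sob_form -big_split/= !ge0_sume_distrr; try by move=> *; exact: L2sq_ge0.
  rewrite -big_split/=; apply: lee_sum => al /[dup] /a1[L1 _] /a2[L2' _].
  exact: L2sq_parallelogram.
Qed.

Lemma sobolev_scale m (c : R) g : c != 0 -> L2 g ->
  (sobolev_sq Omega m (c *: g) <= (c ^+ 2)%:E * sobolev_sq Omega m g)%E.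
Proof.
move=> c0 Lg; rewrite !sobolev_qinf; apply: qinf_scale => // h a; split.
  by move=> al /a[L1 w]; split; [exact: L2Z|exact: weak_derivativeZ].
rewrite /sob_form ge0_sume_distrr; last by move=> *; exact: L2sq_ge0.
by apply: lee_sum => al /a[L1 _]; rewrite L2sqZ//; exact: L1.1.
Qed.

Lemma sobolev_sq0 m : sobolev_sq Omega m 0 = 0%E.
Proof.
apply/eqP; rewrite eq_le sobolev_sq_ge0 andbT.
have a0 : sob_adm (m := m) 0 (fun=> 0).
  move=> al _; split; first exact: L20.
  move=> phi tphi; rewrite !L2dot0l ?mulr0//; first exact: test_fun_L2.
  exact: mpL2.
apply: le_trans (sobolev_sq_le a0) _; rewrite /sob_form big1// => al _.
by rewrite L2sqE ?L2dot0l//; exact: L20.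
Qed.

Definition K_adm f := [set p : ('rV[R]_d -> R) * ('rV[R]_d -> R) | [/\ p.1 = f, L2 f & L2 p.2]].

Definition K_form m (t : R) (p : ('rV[R]_d -> R) * ('rV[R]_d -> R)) : \bar R :=
  (L2sq (p.1 - p.2)%R + (t ^+ 2)%:E * sobolev_sq Omega m p.2)%E.

Lemma Ksq_qinf m t f : L2 f -> Ksq Omega m t f = qinf K_adm (K_form m t) f.
Proof.
move=> Lf; rewrite /Ksq /qinf; congr ereal_inf; apply/seteqP; split => [y [g Lg <-]|y [[f' g]]].
  by exists (f, g).
by move=> [/= -> _ Lg] <-; exists g.
Qed.

Lemma K_form_ge0 m t p : (0 <= K_form m t p)%E.
Proof.
by apply: adde_ge0; [exact: L2sq_ge0|rewrite mule_ge0 ?lee_fin ?sqr_ge0// sobolev_sq_ge0].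
Qed.

Lemma Ksq_ge0 m t f : (0 <= Ksq Omega m t f)%E.
Proof. by apply: le_ereal_inf_tmp => _ [g _ <-]; exact: (K_form_ge0 m t (f, g)). Qed.

Lemma Ksq_le m t f g : L2 g ->
  (Ksq Omega m t f <= L2sq (f - g)%R + (t ^+ 2)%:E * sobolev_sq Omega m g)%E.
Proof. by move=> Lg; apply: ereal_inf_lbound; exists g. Qed.

Lemma Ksq_le_L2sq m t f : (Ksq Omega m t f <= L2sq f)%E.
Proof. by apply: le_trans (Ksq_le m t f L20) _; rewrite subr0 sobolev_sq0 mule0 adde0. Qed.

Lemma Ksq_fin m t f : L2 f -> Ksq Omega m t f \is a fin_num.
Proof.
by move=> Lf; rewrite ge0_fin_numE ?Ksq_ge0//; apply: le_lt_trans (Ksq_le_L2sq _ _ _) _; exact: Lf.2.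
Qed.

Lemma Ksq_nondecreasing m f s t : 0 <= s <= t -> (Ksq Omega m s f <= Ksq Omega m t f)%E.
Proof.
move=> st; apply: le_ereal_inf_tmp => _ [g Lg <-]; apply: le_trans (Ksq_le m s f Lg) _.
by apply: leeD => //; rewrite lee_wpmul2r ?sobolev_sq_ge0// lee_fin; nra.
Qed.

Let quadratic_add (x a1 a2 a3 a4 b1 b2 b3 b4 : \bar R) : (0 <= x)%E ->
  (0 <= a3)%E -> (0 <= a4)%E -> (0 <= b1)%E -> (0 <= b2)%E -> (0 <= b3)%E -> (0 <= b4)%E ->
  (a1 + a2 <= 2%:E * a3 + 2%:E * a4)%E -> (x * (b1 + b2) <= x * (2%:E * b3 + 2%:E * b4))%E ->
  (a1 + x * b1 + (a2 + x * b2) <= 2%:E * (a3 + x * b3) + 2%:E * (a4 + x * b4))%E.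
Proof.
move=> x0 a30 a40 b10 b20 b30 b40 h1.
rewrite ge0_muleDr// ge0_muleDr ?mule_ge0// => h3; have := leeD h1 h3.
rewrite addeACA => /le_trans; apply.
rewrite (ge0_muleDr _ a30 (mule_ge0 x0 b30)) (ge0_muleDr _ a40 (mule_ge0 x0 b40)).
by rewrite addeACA !(muleCA x).
Qed.

Lemma Ksq_parallelogram m t f1 f2 : L2 f1 -> L2 f2 ->
  (Ksq Omega m t (f1 + f2)%R + Ksq Omega m t (f1 - f2)%R <=
   2%:E * Ksq Omega m t f1 + 2%:E * Ksq Omega m t f2)%E.
Proof.
move=> Lf1 Lf2; rewrite !Ksq_qinf//; [|exact: L2B|exact: L2D].
apply: qinf_parallelogram; first exact: K_form_ge0.
move=> [_ g1] [_ g2] [/= -> _ Lg1] [/= -> _ Lg2]; split.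
- by split => //=; exact: L2D.
- by split => //=; exact: L2B.
- rewrite /K_form/=.
  have -> : f1 + f2 - (g1 + g2) = (f1 - g1) + (f2 - g2) by rewrite opprD addrACA.
  have -> : f1 - f2 - (g1 - g2) = (f1 - g1) - (f2 - g2) by rewrite !opprD addrACA.
  have h1 := L2sq_parallelogram (L2B Lf1 Lg1) (L2B Lf2 Lg2).
  have h2 := sobolev_parallelogram m Lg1 Lg2.
  have t2 : (0 <= (t ^+ 2)%:E)%E by rewrite lee_fin sqr_ge0.
  have h3 := lee_wpmul2l t2 h2; move: h1 h3 {h2}.
  have := L2sq_ge0 (f1 - g1); have := L2sq_ge0 (f2 - g2).
  have := sobolev_sq_ge0 m g1; have := sobolev_sq_ge0 m g2.
  have := sobolev_sq_ge0 m (g1 + g2); have := sobolev_sq_ge0 m (g1 - g2).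
  move: (L2sq _) (L2sq _) (L2sq _) (L2sq _) => a1 a2 a3 a4.
  move: (sobolev_sq _ _ _) (sobolev_sq _ _ _) (sobolev_sq _ _ _) (sobolev_sq _ _ _) => b1 b2 b3 b4.
  move=> ? ? ? ? ? ?.
  exact: quadratic_add.
Qed.

Lemma Ksq_scale m t (c : R) f : c != 0 -> L2 f ->
  (Ksq Omega m t (c *: f) <= (c ^+ 2)%:E * Ksq Omega m t f)%E.
Proof.
move=> c0 Lf; rewrite !Ksq_qinf//; last exact: L2Z.
apply: qinf_scale => // -[_ g] [/= -> _ Lg]; split.
  by split => //=; exact: L2Z.
rewrite /K_form/= -scalerBr L2sqZ; last exact: (L2B Lf Lg).1.
have t2 (x : R) : (0 <= (x ^+ 2)%:E)%E by rewrite lee_fin sqr_ge0.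
rewrite (ge0_muleDr _ (L2sq_ge0 _) (mule_ge0 (t2 t) (sobolev_sq_ge0 m g))).
rewrite leeD2l// muleCA; apply: lee_wpmul2l => //; exact: sobolev_scale.
Qed.

(** The K-functional is monotone in t. *)
Lemma measurable_Ksq m f : L2 f -> measurable_fun (`]0, +oo[%classic : set R) (fun t => Ksq Omega m t f).
Proof.
move=> Lf; pose k t := if 0 < t then fine (Ksq Omega m t f) else 0.
apply: (eq_measurable_fun (EFin \o k)).
  by move=> t; rewrite inE/= in_itv/= andbT /k => ->; rewrite fineK// Ksq_fin.
apply/measurable_EFinP; apply: nondecreasing_measurable => // s t st; rewrite /k.
case: ifPn => s0; last by case: ifPn => // _; rewrite fine_ge0// Ksq_ge0.
by rewrite (lt_le_trans s0 st) fine_le ?Ksq_fin// Ksq_nondecreasing// (ltW s0).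
Qed.

Opaque Defs.L2sq Defs.sobolev_sq Defs.Ksq.

Definition interp_integrand m (theta : R) f t := ((t `^ (- (2 * theta) - 1)%R)%:E * Ksq Omega m t f)%E.

Lemma measurable_interp m theta f : L2 f ->
  measurable_fun (`]0, +oo[%classic : set R) (interp_integrand m theta f).
Proof.
move=> Lf; apply: emeasurable_funM; last exact: measurable_Ksq.
by apply/measurable_EFinP; apply: measurable_funTS; exact: measurable_powR.
Qed.

Lemma interp_ge0 m theta f t : (0 <= interp_integrand m theta f t)%E.
Proof. by rewrite mule_ge0 ?lee_fin ?powR_ge0 ?Ksq_ge0. Qed.

Lemma interp_sq_ge0 m theta f : (0 <= interp_sq Omega m theta f)%E.
Proof. by apply: integral_ge0 => t _; exact: (interp_ge0 m theta f t). Qed.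

Lemma ge0_integral_parallelogram d' (T : measurableType d') (mu : {measure set T -> \bar R})
  (D : set T) (F1 F2 F3 F4 : T -> \bar R) : measurable D ->
  measurable_fun D F1 -> measurable_fun D F2 -> measurable_fun D F3 -> measurable_fun D F4 ->
  (forall x, 0 <= F1 x)%E -> (forall x, 0 <= F2 x)%E ->
  (forall x, 0 <= F3 x)%E -> (forall x, 0 <= F4 x)%E ->
  (forall x, D x -> F3 x + F4 x <= 2%:E * F1 x + 2%:E * F2 x)%E ->
  (\int[mu]_(x in D) F3 x + \int[mu]_(x in D) F4 x <=
   2%:E * \int[mu]_(x in D) F1 x + 2%:E * \int[mu]_(x in D) F2 x)%E.
Proof.
move=> mD m1 m2 m3 m4 p1 p2 p3 p4 h.
rewrite -ge0_integralD// -ge0_integralZl// -ge0_integralZl// -ge0_integralD//; first last.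
- by apply: emeasurable_funM.
- by move=> x _; rewrite mule_ge0.
- by apply: emeasurable_funM.
- by move=> x _; rewrite mule_ge0.
apply: ge0_le_integral => //.
- by move=> x _; rewrite adde_ge0.
- exact: emeasurable_funD.
- by apply: emeasurable_funD; apply: emeasurable_funM.
Qed.

Lemma interp_parallelogram m theta f1 f2 : L2 f1 -> L2 f2 ->
  (interp_sq Omega m theta (f1 + f2)%R + interp_sq Omega m theta (f1 - f2)%R <=
   2%:E * interp_sq Omega m theta f1 + 2%:E * interp_sq Omega m theta f2)%E.
Proof.
move=> Lf1 Lf2; have mI f := @measurable_interp m theta f.
apply: (@ge0_integral_parallelogram _ _ (@lebesgue_measure R) _ (interp_integrand m theta f1)
  (interp_integrand m theta f2) (interp_integrand m theta (f1 + f2))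
  (interp_integrand m theta (f1 - f2))).
- exact: (@measurable_itv R).
- exact: mI.
- exact: mI.
- exact: (mI _ (L2D Lf1 Lf2)).
- exact: (mI _ (L2B Lf1 Lf2)).
- exact: interp_ge0.
- exact: interp_ge0.
- exact: interp_ge0.
- exact: interp_ge0.
move=> t _; have := Ksq_parallelogram m t Lf1 Lf2; rewrite /interp_integrand.
have := Ksq_ge0 m t (f1 + f2); have := Ksq_ge0 m t (f1 - f2).
have := Ksq_ge0 m t f1; have := Ksq_ge0 m t f2.
move: (Ksq _ _ _ _) (Ksq _ _ _ _) (Ksq _ _ _ _) (Ksq _ _ _ _) => a b c e a0 b0 c0 e0 h.
rewrite !(muleCA 2%:E) -(ge0_muleDr _ e0 c0) -ge0_muleDr ?mule_ge0//.
by rewrite lee_wpmul2l ?lee_fin ?powR_ge0.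
Qed.

Lemma interp_scale m theta (c : R) f : c != 0 -> L2 f ->
  (interp_sq Omega m theta (c *: f) <= (c ^+ 2)%:E * interp_sq Omega m theta f)%E.
Proof.
move=> c0 Lf; have mIO : measurable (`]0, +oo[%classic : set R) by exact: (@measurable_itv R).
rewrite /interp_sq -ge0_integralZl//; first last.
- by rewrite lee_fin sqr_ge0.
- by move=> *; exact: interp_ge0.
- exact: measurable_interp.
apply: ge0_le_integral => //.
- by move=> *; exact: interp_ge0.
- exact: (measurable_interp m theta (L2Z c Lf)).
- by apply: emeasurable_funM => //; exact: (measurable_interp m theta Lf).
- by move=> t _; rewrite muleCA lee_wpmul2l ?lee_fin ?powR_ge0// Ksq_scale.
Qed.

Lemma interp_sq0 m theta : interp_sq Omega m theta 0 = 0%E.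
Proof.
rewrite /interp_sq integral0_eq// => t _; apply/eqP; rewrite mule_eq0; apply/orP; right.
rewrite eq_le Ksq_ge0 andbT; apply: le_trans (Ksq_le_L2sq _ _ _) _.
by rewrite L2sqE ?L2dot0l//; exact: L20.
Qed.

(** * The inner product of the reproducing kernel space *)

Section RKHS.
Variable r : R.
Notation Hsq := (Hsq Omega r).
Notation HrRKHS := (HrRKHS Omega r).

Lemma Hsq_ge0 f : (0 <= Hsq f)%E.
Proof. exact: interp_sq_ge0. Qed.

Lemma Hsq_parallelogram f g : L2 f -> L2 g ->
  (Hsq (f + g)%R + Hsq (f - g)%R <= 2%:E * Hsq f + 2%:E * Hsq g)%E.
Proof. exact: interp_parallelogram. Qed.

Lemma Hsq_scale (c : R) f : c != 0 -> L2 f -> (Hsq (c *: f) <= (c ^+ 2)%:E * Hsq f)%E.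
Proof. exact: interp_scale. Qed.

Lemma Hsq0 : Hsq 0 = 0%E.
Proof. exact: interp_sq0. Qed.

Opaque Defs.Hsq.

Lemma Hsq_fin f : HrRKHS f -> Hsq f \is a fin_num.
Proof. by move=> [_ _ h]; rewrite ge0_fin_numE ?Hsq_ge0. Qed.

Let lte_2add (x y : \bar R) : (0 <= x)%E -> (0 <= y)%E -> (x < +oo)%E -> (y < +oo)%E ->
  (2%:E * x + 2%:E * y < +oo)%E.
Proof. by move=> x0 y0 xoo yoo; rewrite lte_add_pinfty// lte_mul_pinfty. Qed.

Lemma HrRKHS_D f g : HrRKHS f -> HrRKHS g -> HrRKHS (f + g).
Proof.
move=> [Lf cf hf] [Lg cg hg]; split; first exact: L2D.
  by move=> x; apply: cvgD; [exact: cf|exact: cg].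
have h : (Hsq (f + g)%R <= 2%:E * Hsq f + 2%:E * Hsq g)%E.
  by apply: le_trans (Hsq_parallelogram Lf Lg); rewrite leeDl// Hsq_ge0.
exact: le_lt_trans h (lte_2add (Hsq_ge0 f) (Hsq_ge0 g) hf hg).
Qed.

Lemma HrRKHS_Z (c : R) f : HrRKHS f -> HrRKHS (c *: f).
Proof.
move=> [Lf cf hf]; split; first exact: L2Z.
  by move=> x; apply: cvgZr; exact: cf.
have [->|c0] := eqVneq c 0; first by rewrite scale0r Hsq0.
apply: le_lt_trans (Hsq_scale c0 Lf) _.
by apply: lte_mul_pinfty; rewrite ?lee_fin ?sqr_ge0.
Qed.

Lemma HrRKHS_B f g : HrRKHS f -> HrRKHS g -> HrRKHS (f - g).
Proof. by move=> Hf Hg; rewrite -scaleN1r; exact: HrRKHS_D (HrRKHS_Z (-1) Hg). Qed.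

Definition Hn f : R := fine (Hsq f).

Lemma Hn_E f : HrRKHS f -> Hsq f = (Hn f)%:E.
Proof. by move=> Hf; rewrite fineK// Hsq_fin. Qed.

Lemma Hn_ge0 f : HrRKHS f -> 0 <= Hn f.
Proof. by move=> _; rewrite fine_ge0// Hsq_ge0. Qed.

Lemma Hdot_polar f g : Hdot Omega r f g = polar Hn f g.
Proof. by []. Qed.

Opaque Hn.

Let Hn_scale (b : R) g : b != 0 -> HrRKHS g -> Hn (b *: g) <= b ^+ 2 * Hn g.
Proof.
move=> b0 Hg; have [Lg _ _] := Hg.
have := Hsq_scale b0 Lg; rewrite (Hn_E (HrRKHS_Z b Hg)) (Hn_E Hg).
by rewrite -EFinM lee_fin.
Qed.

(** The scaling inequality for the inverse of c is the opposite inequality. *)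
Lemma Hn_Z (c : R) f : HrRKHS f -> Hn (c *: f) = c ^+ 2 * Hn f.
Proof.
move=> Hf; have [c0|c0] := eqVneq c 0.
  rewrite c0 expr0n/= mul0r; apply: EFin_inj.
  by rewrite -(Hn_E (HrRKHS_Z 0 Hf)) scale0r Hsq0.
apply/eqP; rewrite eq_le (Hn_scale c0 Hf)/=.
have ci0 : c^-1 != 0 by rewrite invr_eq0.
have := Hn_scale ci0 (HrRKHS_Z c Hf).
rewrite scalerA mulVf// scale1r exprVn ler_pdivlMl//.
by rewrite exprn_even_gt0.
Qed.

Let Hn_le f g : HrRKHS f -> HrRKHS g -> Hn (f + g) + Hn (f - g) <= 2 * Hn f + 2 * Hn g.
Proof.
move=> Hf Hg; have [Lf _ _] := Hf; have [Lg _ _] := Hg.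
have := Hsq_parallelogram Lf Lg.
rewrite (Hn_E (HrRKHS_D Hf Hg)) (Hn_E (HrRKHS_B Hf Hg)) (Hn_E Hf) (Hn_E Hg).
move: (Hn _) (Hn _) (Hn _) (Hn _) => a b c e.
by rewrite -!EFinM -!EFinD lee_fin.
Qed.

(** The inequality of the parallelogram law, applied to f + g and f - g, is the opposite
    inequality. *)
Lemma Hn_parallelogram f g : HrRKHS f -> HrRKHS g ->
  Hn (f + g) + Hn (f - g) = 2 * Hn f + 2 * Hn g.
Proof.
move=> Hf Hg; apply/eqP; rewrite eq_le (Hn_le Hf Hg)/=.
have := Hn_le (HrRKHS_D Hf Hg) (HrRKHS_B Hf Hg).
have -> : f + g + (f - g) = 2 *: f by rewrite addrACA subrr addr0 scaler_nat mulr2n.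
have -> : f + g - (f - g) = 2 *: g by rewrite opprB (addrC f) addrACA subrr addr0 scaler_nat mulr2n.
rewrite (Hn_Z 2 Hf) (Hn_Z 2 Hg).
move: (Hn f) (Hn g) (Hn (f + g)) (Hn (f - g)) => a b c e; lra.
Qed.

Lemma Hdot_CauchySchwarz f g : HrRKHS f -> HrRKHS g -> Hdot Omega r f g ^+ 2 <= Hn f * Hn g.
Proof.
rewrite Hdot_polar.
exact: (polar_CauchySchwarz HrRKHS_D HrRKHS_Z Hn_ge0 Hn_Z Hn_parallelogram).
Qed.

(** The squared norm of a combination of kernel sections is the Gram form of the kernel, so
    Cauchy-Schwarz bounds a discrete measure applied to f by its kernel energy. *)
Lemma reproducing_discrete k n (x : 'I_n -> 'rV[R]_d) (b : 'I_n -> R) f :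
  reproducing_kernel Omega r k -> (forall i, X (x i)) -> HrRKHS f ->
  (\sum_i b i * f (x i)) ^+ 2 <= Hn f * \sum_i \sum_j b i * b j * k (x j) (x i).
Proof.
move=> hk Xx Hf.
have Hk i : HrRKHS (k (x i)) by have [] := hk _ (Xx i).
have sumP g Hg := polar_sum HrRKHS_D HrRKHS_Z Hn_ge0 Hn_Z Hn_parallelogram b (y := g) (x := fun i => k (x i)) Hg Hk.
have polC := polarC HrRKHS_D HrRKHS_Z Hn_Z.
have [Hu uf] := sumP f Hf.
have ev g i : HrRKHS g -> polar Hn (k (x i)) g = g (x i).
  move=> Hg; rewrite (polC _ _ (Hk i) Hg) -Hdot_polar.
  by have [_ h] := hk _ (Xx i); exact: h.
set u := \sum_i b i *: k (x i) in Hu uf.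
have E1 : polar Hn f u = \sum_i b i * f (x i).
  by rewrite (polC _ _ Hf Hu) uf; apply: eq_bigr => i _; rewrite (ev _ _ Hf).
have E2 : Hn u = \sum_i \sum_j b i * b j * k (x j) (x i).
  have [_ uu] := sumP u Hu.
  rewrite -(polar_diag Hn_Z Hu) uu; apply: eq_bigr => i _.
  rewrite (ev _ _ Hu) /u fct_sumE mulr_sumr; apply: eq_bigr => j _.
  by rewrite -[(b j *: k (x j)) (x i)]/(b j * k (x j) (x i)) mulrA.
by rewrite -E1 -E2 -Hdot_polar; exact: Hdot_CauchySchwarz.
Qed.

End RKHS.
End L2_theory.

(** * Power integrals *)

Section power_integrals.
Context {R : realType}.
Notation mu := (@lebesgue_measure R).
Implicit Types p q T x : R.

Lemma powR_is_derive p x : 0 < x -> is_derive x 1 (fun t => t `^ p) (p * x `^ (p - 1)).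
Proof.
move=> x0; have xI : x \in `]0, +oo[ by rewrite in_itv/= x0.
apply: DeriveDef; first exact: derivable_powR.
by rewrite -derive1E (powR_derive1 p xI).
Qed.

Lemma powR_continuous p x : 0 < x -> {for x, continuous (fun t => t `^ p)}.
Proof.
move=> x0; apply: differentiable_continuous; apply/derivable1_diffP.
by have := powR_is_derive p x0 => ?; exact: ex_derive.
Qed.

Lemma powR_cvgy0 p : 0 < p -> x `^ (- p) @[x --> +oo] --> 0.
Proof.
move=> p0; apply/cvgr0Pnorm_lt => e e0.
have ei0 : 0 < e^-1 by rewrite invr_gt0.
near=> x; have x0 : 0 < x by near: x; exact: nbhs_pinfty_gt.
rewrite powRN ger0_norm ?invr_ge0 ?powR_ge0// invf_plt ?posrE ?powR_gt0//.
have <- : (e^-1 `^ p^-1) `^ p = e^-1.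
  by rewrite -powRrM mulVf ?gt_eqF// powRr1// ltW.
apply: gt0_ltr_powR => //; rewrite ?nnegrE ?powR_ge0 ?(ltW x0)//.
Unshelve. all: by end_near. Qed.

Lemma integral_powR_tail p T : 0 < p -> 0 < T ->
  (\int[mu]_(x in `[T, +oo[) (x `^ (- p - 1))%:E = (T `^ (- p) / p)%:E)%E.
Proof.
move=> p0 T0.
have dF x : 0 < x -> is_derive x 1 (fun t => - p^-1 * t `^ (- p)) (x `^ (- p - 1)).
  move=> x0; have h := @is_deriveZ _ _ _ _ (- p^-1) x 1 _ (powR_is_derive (- p) x0).
  suff <- : - p^-1 *: (- p * x `^ (- p - 1)) = x `^ (- p - 1) by exact: h.
  by rewrite /GRing.scale/= mulrA mulrNN mulVf ?mul1r// gt_eqF.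
rewrite (@ge0_continuous_FTC2y _ _ (fun t => - p^-1 * t `^ (- p)) T 0).
- by rewrite sub0e -EFinN mulNr opprK mulrC.
- by move=> x _; exact: powR_ge0.
- apply: continuous_in_subspaceT => x; rewrite inE/= in_itv/= andbT => Tx.
  by apply: powR_continuous; exact: lt_le_trans T0 Tx.
- rewrite -[X in _ --> X](mulr0 (- p^-1)); apply: cvgMr; exact: powR_cvgy0.
- by move=> x Tx; have := dF x (lt_trans T0 Tx) => ?; exact: ex_derive.
- apply: cvg_at_right_filter.
  apply: (@differentiable_continuous _ _ _ T (fun t => - p^-1 * t `^ (- p))).
  by apply/derivable1_diffP; have := dF T T0 => ?; exact: ex_derive.
- move=> x; rewrite in_itv/= andbT => Tx; rewrite derive1E.
  by have := dF x (lt_trans T0 Tx) => ?; exact: derive_val.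
Qed.

Lemma integral_powR_head q T : 0 < q -> 0 < T ->
  (\int[mu]_(x in `]0%R, T]) (x `^ (q - 1))%:E <= (T `^ q / q)%:E)%E.
Proof.
move=> q0 T0.
have dF x : 0 < x -> is_derive x 1 (fun t => q^-1 * t `^ q) (x `^ (q - 1)).
  move=> x0; have h := @is_deriveZ _ _ _ _ (q^-1) x 1 _ (powR_is_derive q x0).
  suff <- : q^-1 *: (q * x `^ (q - 1)) = x `^ (q - 1) by exact: h.
  by rewrite /GRing.scale/= mulrA mulVf ?mul1r// gt_eqF.
pose F n : set R := `[T / n.+2%:R, T]%classic.
have a0 n : 0 < T / n.+2%:R by rewrite divr_gt0.
have mp : measurable_fun setT (fun x : R => (x `^ (q - 1))%:E).
  by apply/measurable_EFinP; exact: measurable_powR.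
have UF : \bigcup_n F n = `]0, T]%classic.
  apply/seteqP; split=> [x [n _]|x]; rewrite /F /= !in_itv/= => /andP[x0 xT].
    by rewrite xT andbT (lt_le_trans (a0 n) x0).
  exists (Num.truncn (T / x)) => //=; rewrite in_itv/= xT andbT.
  rewrite ler_pdivrMr// mulrC -ler_pdivrMr//; apply: ltW.
  by apply: (lt_le_trans (truncnS_gt _)); rewrite ler_nat.
rewrite -UF.
have ndF : nondecreasing_seq F.
  move=> n k nk; apply/subsetPset => x; rewrite /F /= !in_itv/= => /andP[x0 ->].
  rewrite andbT; apply: le_trans x0; rewrite ler_pM2l// lef_pV2 ?posrE//.
  by rewrite ler_nat !ltnS.
have mF n : measurable (F n) by exact: measurable_itv.
have p0 n x : F n x -> (0 <= (x `^ (q - 1))%:E)%E by rewrite lee_fin powR_ge0.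
have mpF n : measurable_fun (F n) (fun x : R => (x `^ (q - 1))%:E) by exact: measurable_funTS.
have h : (\int[mu]_(x in F i) (x `^ (q - 1))%:E @[i --> \oo] -->
    \int[mu]_(x in \bigcup_i F i) (x `^ (q - 1))%:E)%E.
  exact: ge0_nondecreasing_set_cvg_integral.
rewrite -(cvg_lim _ h)//; apply: lime_le.
  apply: ereal_nondecreasing_is_cvgn.
  exact: ge0_nondecreasing_set_nondecreasing_integral.
apply: nearW => n.
have aT : T / n.+2%:R < T by rewrite ltr_pdivrMr// ltr_pMr// ltr1n.
have cF x : 0 < x -> {for x, continuous (fun t => q^-1 * t `^ q)}.
  move=> x0; apply: differentiable_continuous.
  by apply/derivable1_diffP; have := dF x x0 => ?; exact: ex_derive.
rewrite (@continuous_FTC2 _ _ (fun t => q^-1 * t `^ q) _ _ aT).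
- rewrite lee_fin mulrC gerBl mulr_ge0// ?invr_ge0 ?powR_ge0//; exact: ltW.
- apply: continuous_in_subspaceT => x; rewrite inE/= in_itv/= => /andP[ax _].
  by apply: powR_continuous; exact: lt_le_trans (a0 n) ax.
- split.
  + move=> x; rewrite in_itv/= => /andP[ax _].
    by have := dF x (lt_trans (a0 n) ax) => ?; exact: ex_derive.
  + by apply: cvg_at_right_filter; exact: cF.
  + by apply: cvg_at_left_filter; exact: cF.
- move=> x; rewrite in_itv/= => /andP[ax _]; rewrite derive1E.
  by have := dF x (lt_trans (a0 n) ax) => ?; exact: derive_val.
Qed.

(** The Mellin integral of min(A, A (rho t)^2), computed by cutting at t = 1/rho. *)
Lemma mellin_le (theta A rho : R) (K : R -> \bar R) : 0 < theta < 1 -> 0 <= A -> 0 < rho ->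
  measurable_fun (`]0, +oo[%classic : set R) K -> (forall t, 0 <= K t)%E ->
  (forall t, (0 < t)%R -> K t <= A%:E)%E ->
  (forall t, (0 < t)%R -> K t <= (A * (rho * t) ^+ 2)%:E)%E ->
  (\int[mu]_(t in `]0%R, +oo[) ((t `^ (- (2 * theta) - 1)%R)%:E * K t) <=
   (A * rho `^ (2 * theta) * ((2 * (1 - theta))^-1 + (2 * theta)^-1))%:E)%E.
Proof.
move=> /andP[th0 th1] A0 rho0 mK K0 KA KB; pose T := rho^-1.
have T0 : 0 < T by rewrite invr_gt0.
have p0 : 0 < 2 * theta by rewrite mulr_gt0.
have q0 : 0 < 2 * (1 - theta) by rewrite mulr_gt0// subr_gt0.
have mI : measurable_fun (`]0, +oo[%classic : set R) (fun t => (t `^ (- (2 * theta) - 1)%R)%:E * K t)%E.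
  apply: emeasurable_funM => //; apply/measurable_EFinP; apply: measurable_funTS.
  exact: measurable_powR.
have I0 t : (0 <= (t `^ (- (2 * theta) - 1)%R)%:E * K t)%E by rewrite mule_ge0// lee_fin powR_ge0.
have U : `]0, +oo[%classic = `]0, T[%classic `|` `[T, +oo[%classic :> set R.
  apply/seteqP; split=> x /=; rewrite !in_itv/= ?andbT.
    by case: (ltP x T) => xT x0; [left; rewrite x0|right].
  by move=> [/andP[]//|]; exact: lt_le_trans.
have sub1 : `]0, T[%classic `<=` (`]0, +oo[%classic : set R).
  by move=> x /=; rewrite !in_itv/= andbT => /andP[].
have sub2 : `[T, +oo[%classic `<=` (`]0, +oo[%classic : set R).
  by move=> x /=; rewrite !in_itv/= !andbT; exact: lt_le_trans.
rewrite U ge0_integral_setU//; first last.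
- rewrite disj_set2E; apply/eqP/seteqP; split=> // x [] /=; rewrite !in_itv/= => /andP[_].
  by rewrite andbT ltNge => /negP.
- by rewrite -U.
rewrite mulrDr EFinD; apply: leeD.
- apply: (@le_trans _ _ (\int[mu]_(t in `]0%R, T[) ((A * rho ^+ 2)%:E * (t `^ (2 * (1 - theta) - 1))%:E))%E).
    apply: ge0_le_integral => //.
    + exact: measurable_funS mI.
    + apply: emeasurable_funM => //; apply/measurable_EFinP; apply: measurable_funTS.
      exact: measurable_powR.
    + move=> t; rewrite /= in_itv/= => /andP[t0 _].
      have := KB t t0; move/(lee_wpmul2l (_ : 0 <= (t `^ (- (2 * theta) - 1))%:E)%E).
      rewrite lee_fin powR_ge0 => /(_ isT) /le_trans; apply.
      rewrite -!EFinM lee_fin exprMn.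
      have -> : 2 * (1 - theta) - 1 = (- (2 * theta) - 1) + 2%:R by ring.
      rewrite (@powRD _ t (- (2 * theta) - 1) 2%:R); last by rewrite (gt_eqF t0) implybT.
      by rewrite powR_mulrn ?(ltW t0)// le_eqVlt; apply/orP; left; apply/eqP; ring.
  rewrite ge0_integralZl//; first last.
  + by rewrite lee_fin mulr_ge0// sqr_ge0.
  + by move=> x _; rewrite lee_fin powR_ge0.
  + by apply/measurable_EFinP; apply: measurable_funTS; exact: measurable_powR.
  apply: (@le_trans _ _ ((A * rho ^+ 2)%:E * (T `^ (2 * (1 - theta)) / (2 * (1 - theta)))%:E)%E).
    apply: lee_wpmul2l; first by rewrite lee_fin mulr_ge0// sqr_ge0.
    apply: le_trans (integral_powR_head q0 T0).
    apply: ge0_subset_integral => //.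
    + by apply/measurable_EFinP; apply: measurable_funTS; exact: measurable_powR.
    + by move=> x _; rewrite lee_fin powR_ge0.
    + by move=> x /=; rewrite !in_itv/= => /andP[-> /ltW].
  rewrite -EFinM lee_fin mulrA ler_wpM2r ?invr_ge0 ?(ltW q0)//.
  rewrite -mulrA ler_wpM2l// /T -powR_inv1 ?(ltW rho0)// -powRrM.
  rewrite -powR_mulrn ?(ltW rho0)// -powRD ?(gt_eqF rho0) ?implybT//.
  by rewrite (_ : 2%:R + _ = 2 * theta)//; ring.
- apply: (@le_trans _ _ (\int[mu]_(t in `[T, +oo[) (A%:E * (t `^ (- (2 * theta) - 1))%:E))%E).
    apply: ge0_le_integral => //.
    + exact: measurable_funS mI.
    + apply: emeasurable_funM => //; apply/measurable_EFinP; apply: measurable_funTS.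
      exact: measurable_powR.
    + move=> t; rewrite /= in_itv/= andbT => Tt.
      by rewrite muleC lee_wpmul2r ?lee_fin ?powR_ge0// KA// (lt_le_trans T0).
  rewrite ge0_integralZl//; first last.
  + by move=> x _; rewrite lee_fin powR_ge0.
  + by apply/measurable_EFinP; apply: measurable_funTS; exact: measurable_powR.
  rewrite integral_powR_tail// -EFinM lee_fin mulrA /T -powR_inv1 ?(ltW rho0)// -powRrM.
  by rewrite mulN1r opprK.
Qed.

End power_integrals.

(** * Integration by parts against test functions *)

Section integration_by_parts.
Context {R : realType} {d : nat}.
Implicit Types (f F : 'rV[R]_d -> R) (a b : 'I_d -> R) (i : 'I_d).
Notation lebd := (@leb R d).

Lemma integrable_box_supp f a b (M : R) : measurable_fun setT f -> (forall l, a l <= b l) ->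
  (forall x, `|f x| <= M) -> (forall x, ~ box a b x -> f x = 0) ->
  lebd.-integrable setT (EFin \o f).
Proof.
move=> mf ab fM f0; apply/integrableP; split; first exact/measurable_EFinP.
apply: (@le_lt_trans _ _ (\int[lebd]_x (M * \1_(box a b) x)%:E)%E).
  apply: ge0_le_integral => //.
  - by apply: measurableT_comp => //; exact/measurable_EFinP.
  - apply/measurable_EFinP; apply: measurable_funM => //; apply: measurable_indic.
    exact: measurable_box.
  - move=> x _ /=; rewrite lee_fin indicE; have [xb|xb] := pselect (box a b x).
      by rewrite mem_set// mulr1.
    by rewrite f0// normr0 memNset// mulr0.
under eq_integral do rewrite EFinM.
have M0 : 0 <= M.
  by apply: le_trans (fM 0); exact: normr_ge0.
have mB : measurable_fun setT (fun x => (\1_(box a b) x)%:E : \bar R).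
  by apply/measurable_EFinP; apply: measurable_indic; exact: measurable_box.
rewrite ge0_integralZl// integral_indic ?setIT//; last exact: measurable_box.
by rewrite /= leb_box// -EFinM ltry.
Qed.

(** The integral of a difference quotient vanishes by translation invariance; dominated
    convergence carries this to the derivative. *)
Lemma integral_partial_eq0 F dF i a b : (forall x, is_derive x (delta_mx ord0 i) F (dF x)) ->
  continuous F -> continuous dF -> (forall l, a l <= b l) ->
  (forall x, ~ box a b x -> F x = 0) -> (forall x, ~ box a b x -> dF x = 0) ->
  (\int[lebd]_x (dF x)%:E = 0)%E.
Proof.
move=> hF cF cdF ab F0 dF0.
have bnd (g : 'rV[R]_d -> R) : continuous g -> (forall x, ~ box a b x -> g x = 0) ->
    exists M, forall x, `|g x| <= M.
  move=> cg g0.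
  have [M [_ hM]] := compact_bounded (continuous_compact (continuous_subspaceT cg) (@compact_box R d a b)).
  exists (`|M| + 1) => x; have [xb|/g0 ->] := pselect (box a b x); last by rewrite normr0 addr_ge0.
  by apply: hM; [rewrite ltr_pwDr// ler_norm|exists x].
have [MF hMF] := bnd _ cF F0; have [M hM] := bnd _ cdF dF0.
have mF := continuous_measurable_rV cF; have mdF := continuous_measurable_rV cdF.
have IF : lebd.-integrable setT (EFin \o F) by exact: integrable_box_supp hMF F0.
pose e (n : nat) : 'rV[R]_d := n.+1%:R^-1 *: delta_mx ord0 i.
pose G n x := n.+1%:R * (F (x + e n) - F x).
have eE n x : x + e n = setc x i (n.+1%:R^-1 + x ord0 i) by rewrite -shift_setc addrC.
have mG n : measurable_fun setT (G n).
  apply: measurable_funM => //; apply: measurable_funB => //.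
  by apply: measurableT_comp => //; exact: measurable_shift_rV.
have G0 n : (\int[lebd]_x (G n x)%:E = 0)%E.
  have IFs : lebd.-integrable setT (EFin \o (fun x => F (x + e n))).
    apply/integrableP; split.
      by apply/measurable_EFinP/measurableT_comp => //; exact: measurable_shift_rV.
    have /integrableP[_] := IF.
    rewrite -(integral_leb_shift (e n)) //.
    by apply: measurableT_comp => //; exact/measurable_EFinP.
  under eq_integral do rewrite EFinM.
  rewrite integralZl//=; last first.
    by have := integrableB measurableT IFs IF; apply: eq_integrable => // x _.
  rewrite (_ : (\int[lebd]_x _ = 0)%E) ?mule0//.
  under eq_integral do rewrite EFinB.
  have mFE : measurable_fun setT (EFin \o F) by exact/measurable_EFinP.
  rewrite integralB//= (integral_leb_shift (e n) mFE).
  by rewrite subee// (integrable_fin_num measurableT IF).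
have GM n x : `|G n x| <= M.
  have h0 : 0 < n.+1%:R^-1 :> R by rewrite invr_gt0.
  rewrite /G normrM normr_nat eE mulrC -ler_pdivlMr//.
  have := @partial_MVT _ _ F dF i x (n.+1%:R^-1 + x ord0 i) M hF (fun s _ => hM _).
  by rewrite addrK (gtr0_norm h0).
pose a' l := a l - 1; pose b' l := b l + 1.
have ab' l : a' l <= b' l by rewrite /a' /b'; have := ab l; lra.
have Gsupp n x : ~ box a' b' x -> G n x = 0.
  move=> xb; rewrite /G F0; last first.
    move=> h; apply: xb => l; have := h l; rewrite eE setc_coord /a' /b'.
    have : n.+1%:R^-1 <= 1 :> R by rewrite invf_le1// ler1n.
    have : 0 <= n.+1%:R^-1 :> R by rewrite invr_ge0.
    move: (n.+1%:R^-1 : R) => z.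
    case: eqP => [->|_]; first by move: (x ord0 i) (a i) (b i) => X A B; lra.
    by move: (x ord0 l) (a l) (b l) => X A B; lra.
  rewrite F0 ?subr0 ?mulr0// => h; apply: xb => l; have := h l; rewrite /a' /b'; lra.
have M0 : 0 <= M by apply: le_trans (hM 0); exact: normr_ge0.
pose g x : \bar R := (M * \1_(box a' b') x)%:E.
have Ig : lebd.-integrable setT g.
  apply: (@integrable_box_supp (fun x => M * \1_(box a' b') x) a' b' M) => //.
  - apply: measurable_funM => //; apply: measurable_indic; exact: measurable_box.
  - move=> x; rewrite normrM (ger0_norm M0) ler_piMr// indicE.
    by case: (_ \in _); rewrite ?normr1 ?normr0.
  - by move=> x h; rewrite indicE memNset// mulr0.
have cvgG x : (G n x)%:E @[n --> \oo] --> (dF x)%:E.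
  apply: cvg_EFin; first exact: nearW.
  have [hd hv] := hF x.
  have hl : h^-1 *: (F (h *: delta_mx ord0 i + x) - F x) @[h --> 0^'] --> dF x.
    by rewrite -hv; exact: hd.
  have h0 : (n.+1%:R^-1 : R) @[n --> \oo] --> 0^'.
    move=> P; rewrite /dnbhs /within/= => hP.
    have H : \forall n \near \oo, (fun h : R => h != 0 -> P h) (harmonic n) by exact: (@cvg_harmonic R _ hP).
    suff : \forall n \near \oo, P (n.+1%:R^-1) by [].
    by apply: filterS H => n; apply; rewrite /harmonic/= invr_eq0.
  have := cvg_comp _ _ h0 hl; apply: cvg_trans; apply: near_eq_cvg; apply: nearW => n /=.
  by rewrite invrK /G /e (addrC x).
have mGE n : measurable_fun setT (fun x => (G n x)%:E) by exact/measurable_EFinP.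
have mdFE : measurable_fun setT (fun x => (dF x)%:E) by exact/measurable_EFinP.
have ae1 : {ae lebd, forall x, setT x -> (G n x)%:E @[n --> \oo] --> (dF x)%:E}.
  by apply: aeW => x _; exact: cvgG.
have ae2 : {ae lebd, forall x n, setT x -> (`|(G n x)%:E| <= g x)%E}.
  apply: aeW => x n _; rewrite /g lee_fin indicE; have [xb|xb] := pselect (box a' b' x).
    by rewrite mem_set// mulr1; exact: GM.
  by rewrite Gsupp// normr0 memNset// mulr0.
have [_ _] := dominated_convergence measurableT mGE mdFE ae1 Ig ae2.
rewrite (_ : [sequence _]_n = cst 0%E); last by apply/funext => n /=; exact: G0.
move=> h; apply/esym; apply: (cvg_unique _ _ h) => //; exact: cvg_cst.
Qed.

End integration_by_parts.

(** * Weak derivatives of products and the upper bound on the interpolation norm *)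

Lemma normr_coord {R : realType} {d : nat} (x : 'rV[R]_d) l : `|x ord0 l| <= `|x|.
Proof.
have -> : `|x| = mx_norm x by [].
by rewrite mx_normrE; exact: (le_bigmax _ (fun i => `|x i.1 i.2|) (ord0, l)).
Qed.

Lemma continuous_mulf {R : realType} {d : nat} (f g : 'rV[R]_d -> R) :
  continuous f -> continuous g -> continuous (f * g).
Proof. by move=> cf cg x; exact: (continuousM (cf x) (cg x)). Qed.

Section weak_derivatives.
Context {R : realType} {d : nat} (Omega : set 'rV[R]_d).
Let X := closure Omega.
Hypothesis Xfin : (@leb R d X < +oo)%E.
Implicit Types (f g : 'rV[R]_d -> R) (i l : 'I_d).
Notation lebd := (@leb R d).
Notation L2 := (L2 Omega).
Notation L2sq := (L2sq Omega).
Notation L2dot := (L2dot Omega).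
Let mX := measurable_closure Omega.

Lemma compact_in_box (K : set 'rV[R]_d) : compact K ->
  exists M, forall x, K x -> forall l, - M <= x ord0 l <= M.
Proof.
move=> cK; have [M [_ hM]] := compact_bounded cK.
exists (`|M| + 1) => x Kx l; have h : `|x| <= `|M| + 1 by apply: hM => //; rewrite ltr_pwDr// ler_norm.
by have := normr_coord x l; rewrite -ler_norml => /le_trans; apply.
Qed.

(** The product of f with the test function, which vanishes outside a compact subset of
    Omega, is integrated over the whole space. *)
Lemma integration_by_parts f phi i : smooth f -> L2 f -> L2 (partial i f) -> test_fun Omega phi ->
  L2dot f (partial i phi) = - L2dot (partial i f) phi.
Proof.
move=> sf Lf Lpf tphi; have [sphi [K [cK KO phi0]]] := tphi.
have tpphi := test_fun_partial i tphi.
have Lphi := test_fun_L2 Xfin tphi; have Lpphi := test_fun_L2 Xfin tpphi.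
have [sK [K' [cK' KO' pphi0]]] := tpphi.
pose F := f * phi; pose dF := f * partial i phi + partial i f * phi.
have hF x : is_derive x (delta_mx ord0 i) F (dF x).
  have := @is_deriveM _ _ f phi x (delta_mx ord0 i) _ _ (smooth_is_derive i x sf) (smooth_is_derive i x sphi).
  by rewrite /dF -[(f * _ + _ * _) x]/(f x * partial i phi x + partial i f x * phi x) (mulrC (partial i f x)).
have cF : continuous F by apply: continuous_mulf; exact: smooth_cont.
have cdF : continuous dF.
  have c1 : continuous (f * partial i phi) by apply: continuous_mulf; exact: smooth_cont.
  have c2 : continuous (partial i f * phi).
    by apply: continuous_mulf; [apply: smooth_cont; exact: smooth_partial|exact: smooth_cont].
  by move=> x; exact: (continuousD (c1 x) (c2 x)).
have [M1 h1] := compact_in_box cK; have [M2 h2] := compact_in_box cK'.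
pose M := `|M1| + `|M2|.
have hM x : K x \/ K' x -> box (fun=> - M) (fun=> M) x.
  have := normr_ge0 M1; have := normr_ge0 M2; have := ler_norm M1; have := ler_norm M2.
  by move=> ? ? ? ? [/h1|/h2] h l; have := h l; rewrite /M; lra.
have F0 x : ~ box (fun=> - M) (fun=> M) x -> F x = 0.
  by move=> xb; rewrite /F -[LHS]/(f x * phi x) phi0 ?mulr0// => Kx; apply: xb; apply: hM; left.
have dFX x : ~ (K x \/ K' x) -> dF x = 0.
  move=> h; rewrite /dF -[LHS]/(f x * partial i phi x + partial i f x * phi x).
  by rewrite phi0 ?pphi0 ?mulr0 ?addr0// => Kx; apply: h; [right|left].
have M0 l : - M <= M by have := normr_ge0 M1; have := normr_ge0 M2; rewrite /M; lra.
have dF0 x : ~ box (fun=> - M) (fun=> M) x -> dF x = 0.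
  by move=> xb; apply: dFX => h; apply: xb; exact: hM.
have E := integral_partial_eq0 hF cF cdF M0 F0 dF0.
have : \int[lebd]_(x in X) (dF x) = 0.
  rewrite /Rintegral integral_mkcond.
  rewrite (_ : (\int[lebd]_x _ = 0)%E)// -E; apply: eq_integral => x _.
  rewrite patchE; case: ifPn => // /negP xX; rewrite dFX// => h; apply: xX; apply/mem_set.
  by apply: subset_closure; case: h => [/KO|/KO'].
rewrite (_ : \int[lebd]_(x in X) _ = L2dot f (partial i phi) + L2dot (partial i f) phi); last first.
  rewrite /Defs.L2dot -RintegralD//.
    exact: (L2_integrableM Lf Lpphi).
  exact: (L2_integrableM Lpf Lphi).
by move/eqP; rewrite addr_eq0 => /eqP.
Qed.

Section tensor.
Variables (u : 'I_d -> R -> R).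
Hypotheses (su : forall l, smooth1 (u l))
  (bu : forall l n, exists2 M, 1 <= M & forall t, `|derive1n n (u l) t| <= M).

Definition tder (k : 'I_d -> nat) : 'rV[R]_d -> R := tens (fun l => derive1n (k l) (u l)).

Let stder k l : smooth1 (derive1n (k l) (u l)).
Proof. exact: smooth1_derive1n. Qed.

Lemma measurable_tder k : measurable_fun setT (tder k).
Proof.
by apply: measurable_tens => l; apply: continuous_measurable_fun; exact: smooth1_continuous.
Qed.

Lemma tder_L2 k : L2 (tder k).
Proof.
pose M l := projT1 (cid2 (bu l (k l))).
have hM l t : `|derive1n (k l) (u l) t| <= M l by rewrite /M; case: cid2.
have [] := @L2_bounded _ _ Omega Xfin (tder k) (\prod_l M l) => //.
  by apply: measurable_funTS; exact: measurable_tder.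
by move=> x _; rewrite /tder /tens normr_prod; apply: ler_prod => l _; rewrite normr_ge0 hM.
Qed.

Lemma partial_tder k i : partial i (tder k) = tder (fun l => k l + (l == i))%N.
Proof.
rewrite /tder partial_tens//; congr tens; apply/funext => l; rewrite /updf.
by case: eqP => [->|_]; rewrite ?addn1 ?addn0// derive1nS.
Qed.

Let tder_iter k i n phi : test_fun Omega phi ->
  L2dot (tder k) (iter n (partial i) phi) =
  (-1) ^+ n * L2dot (tder (fun l => k l + n * (l == i))%N) phi.
Proof.
elim: n k phi => [|n ih] k phi tphi.
  by rewrite expr0 mul1r; congr (L2dot (tder _) _); apply/funext => l; rewrite mul0n addn0.
rewrite iterS integration_by_parts ?partial_tder.
- rewrite ih// exprS mulN1r mulNr; congr (- (_ * L2dot (tder _) _)).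
  by apply/funext => l; rewrite -addnA mulSn.
- exact: smooth_tens.
- exact: tder_L2.
- exact: tder_L2.
- exact: test_fun_iter_partial.
Qed.

Lemma weak_derivative_tens m (al : multi d m) : weak_derivative Omega al (tens u) (tder (fun l => al l : nat)).
Proof.
move=> phi tphi; rewrite /mpartial /msize.
suff H (s : seq 'I_d) k : L2dot (tder k) (foldr (fun i => iter (al i) (partial i)) phi s) =
    (-1) ^+ (\sum_(i <- s) al i) *
    L2dot (tder (fun l => k l + \sum_(i <- s) al i * (l == i))%N) phi.
  have := H (enum 'I_d) (fun=> 0%N); rewrite !big_enum/= => E.
  rewrite (_ : tens u = tder (fun=> 0%N)) ?E//; congr (_ * L2dot (tder _) _).
  apply/funext => l; rewrite add0n big_enum (bigD1 l)//= eqxx muln1 big1 ?addn0// => i /negPf il.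
  by rewrite eq_sym il muln0.
elim: s k => [|i s ih] k /=.
  by rewrite !big_nil expr0 mul1r; congr (L2dot (tder _) _); apply/funext => l; rewrite big_nil addn0.
have tphi' : test_fun Omega (foldr (fun i => iter (al i) (partial i)) phi s).
  by elim: s {ih} => //= j s ih; exact: test_fun_iter_partial.
rewrite tder_iter// ih mulrA -exprD big_cons; congr (_ * L2dot (tder _) _).
by apply/funext => l; rewrite big_cons addnA.
Qed.

End tensor.

Lemma sob_adm_sum m (J : finType) (c : J -> R) (g : J -> 'rV[R]_d -> R)
    (h : J -> multi d m -> 'rV[R]_d -> R) :
  (forall j, L2 (g j)) -> (forall j, sob_adm Omega (g j) (h j)) ->
  sob_adm Omega (\sum_j c j *: g j) (fun al => \sum_j c j *: h j al).
Proof.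
move=> Lg gh al alm; split.
  by apply: (@L2_sum _ _ Omega Xfin _ _ (fun j => c j *: h j al)) => j; exact: (L2Z (c j) (gh j al alm).1).
move=> phi tphi; have Lphi := test_fun_L2 Xfin tphi.
have Lpphi := test_fun_L2 Xfin (test_fun_mpartial al tphi).
rewrite !L2dot_suml//; last by move=> j; exact: (gh j al alm).1.
rewrite mulr_sumr; apply: eq_bigr => j _.
by rewrite (gh j al alm).2// mulrCA.
Qed.

(** Scaling: K(t, g)^2 is at most O(D^2), by the decomposition g + 0, and at most O((D a^m
    t)^2), by the decomposition 0 + g. The integral of the smaller of both is computed by
    [mellin_le], with rho = a^m. *)
Lemma Hsq_upper (r : R) : 0 < r -> exists2 C, 0 < C &
  forall g (h : multi d (Num.truncn r).+1 -> 'rV[R]_d -> R) (a D : R), 1 <= a -> 0 <= D ->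
  L2 g -> sob_adm Omega g h -> (forall x, X x -> `|g x| <= D) ->
  (forall al, (msize al <= (Num.truncn r).+1)%N -> forall x, X x ->
     `|h al x| <= D * a ^+ (Num.truncn r).+1) ->
  (Hsq Omega r g <= (C * D ^+ 2 * a `^ (2 * r))%:E)%E.
Proof.
move=> r0; set m := (Num.truncn r).+1; pose theta := r / m%:R.
have m0 : 0 < m%:R :> R by rewrite ltr0n.
have th : 0 < theta < 1.
  by rewrite divr_gt0//= ltr_pdivrMr// mul1r /m truncnS_gt.
pose v := fine (lebd X).
have vE : lebd X = v%:E by rewrite fineK// ge0_fin_numE.
have v0 : 0 <= v by rewrite fine_ge0.
pose cnt : R := #|multi d m|%:R.
pose cth := (2 * (1 - theta))^-1 + (2 * theta)^-1.
have cth0 : 0 < cth by move/andP: th => [? ?]; apply: addr_gt0; rewrite invr_gt0; lra.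
exists ((cnt + 1) * (v + 1) * cth).
  by rewrite !mulr_gt0//; [rewrite ltr_wpDl// ler0n|lra].
move=> g h a D a1 D0 Lg gh gD hD.
pose A := (cnt + 1) * (v + 1) * D ^+ 2.
have a0 : 0 < a by lra.
have cnt0 : 0 <= cnt by rewrite ler0n.
have A0 : 0 <= A by rewrite !mulr_ge0 ?sqr_ge0//; lra.
have L2g : (L2sq g <= (D ^+ 2 * v)%:E)%E.
  by have [_] := L2_bounded Xfin Lg.1 gD; rewrite -/X vE -EFinM.
have sob : (sobolev_sq Omega m g <= (cnt * ((D * a ^+ m) ^+ 2 * v))%:E)%E.
  apply: le_trans (sobolev_sq_le gh) _.
  apply: (@le_trans _ _ (\sum_(al : multi d m) ((D * a ^+ m) ^+ 2 * v)%:E)%E); last first.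
    by rewrite sumEFin sumr_const mulr_natl.
  rewrite /sob_form big_mkcond/=; apply: lee_sum => al _; case: ifPn => alm.
    by have [_] := L2_bounded Xfin (gh al alm).1.1 (hD al alm); rewrite -/X vE -EFinM.
  by rewrite lee_fin mulr_ge0 ?sqr_ge0.
have K1 t : 0 < t -> (Ksq Omega m t g <= A%:E)%E.
  move=> t0; apply: le_trans (Ksq_le_L2sq Xfin _ _ _) _; apply: le_trans L2g _.
  rewrite lee_fin /A mulrC ler_wpM2r ?sqr_ge0//; nra.
have K2 t : 0 < t -> (Ksq Omega m t g <= (A * (a ^+ m * t) ^+ 2)%:E)%E.
  move=> t0; apply: le_trans (Ksq_le m t g Lg) _.
  rewrite subrr (L2sqE (L20 Xfin)) (L2dot0l Xfin (L20 Xfin)) add0e.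
  apply: (@le_trans _ _ ((t ^+ 2)%:E * (cnt * ((D * a ^+ m) ^+ 2 * v))%:E)%E).
    by apply: lee_wpmul2l => //; rewrite lee_fin sqr_ge0.
  rewrite -EFinM lee_fin /A.
  have -> : t ^+ 2 * (cnt * ((D * a ^+ m) ^+ 2 * v)) = cnt * v * (D ^+ 2 * (a ^+ m * t) ^+ 2) by ring.
  have -> : (cnt + 1) * (v + 1) * D ^+ 2 * (a ^+ m * t) ^+ 2 =
    (cnt + 1) * (v + 1) * (D ^+ 2 * (a ^+ m * t) ^+ 2) by ring.
  apply: ler_wpM2r; first by rewrite mulr_ge0 ?sqr_ge0.
  by apply: ler_pM => //; rewrite lerDl.
have am0 : 0 < a ^+ m by rewrite exprn_gt0.
have := mellin_le th A0 am0 (measurable_Ksq Xfin m Lg) (fun t => Ksq_ge0 _ m t g) K1 K2.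
rewrite -[X in (X <= _)%E -> _]/(Hsq Omega r g) => /le_trans; apply.
rewrite lee_fin -/cth /A -(powR_mulrn m (ltW a0)) -powRrM.
have -> : m%:R * (2 * theta) = 2 * r by rewrite /theta; field; rewrite gt_eqF.
by rewrite le_eqVlt; apply/orP; left; apply/eqP; ring.
Qed.

End weak_derivatives.

(** * Bumps on a grid of small cells *)

(** Sums of functions with disjoint supports are no larger than their terms. *)
Lemma normr_sum_single {R : realType} (J : finType) (c psi : J -> R) (A B : R) :
  (forall j j', psi j != 0 -> psi j' != 0 -> j = j') ->
  0 <= A -> 0 <= B -> (forall j, `|c j| <= A) -> (forall j, `|psi j| <= B) ->
  `|\sum_j c j * psi j| <= A * B.
Proof.
move=> single A0 B0 cA psiB; case: (pickP (fun j => psi j != 0)) => [j0 j0P|all0].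
  rewrite (bigD1 j0)//= big1 ?addr0 => [|j jj0]; first by rewrite normrM ler_pM.
  by have [->|h] := eqVneq (psi j) 0; [rewrite mulr0|rewrite (single _ _ h j0P) eqxx in jj0].
by rewrite big1 ?normr0 ?mulr_ge0// => j _; have /negbFE/eqP -> := all0 j; rewrite mulr0.
Qed.


Lemma derive1n_bump_bounded {R : realType} m :
  exists2 W : R, 1 <= W & forall n t, (n <= m)%N -> `|derive1n n (@bump1 R) t| <= W.
Proof.
have h n : exists2 M : R, 1 <= M & forall t, `|derive1n n (@bump1 R) t| <= M.
  apply: (@supp_bounded _ _ (1/4) (3/4)).
    by apply: smooth1_continuous; apply: smooth1_derive1n; exact: smooth1_bump.
  by apply: derive1n_supp; [exact: smooth1_bump|exact: bump_supp].
elim: m => [|m [W W1 hW]].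
  by have [M M1 hM] := h 0%N; exists M => // n t; rewrite leqn0 => /eqP ->.
have [M M1 hM] := h m.+1; exists (W + M) => [|n t]; first lra.
rewrite leq_eqVlt => /orP[/eqP ->|]; first by have := hM t; lra.
by rewrite ltnS => nm; have := hW n t nm; lra.
Qed.

Section bumps.
Context {R : realType} {d : nat} (Omega : set 'rV[R]_d).
Let X := closure Omega.
Hypothesis Xfin : (@leb R d X < +oo)%E.
Notation lebd := (@leb R d).

Section grid.
Variables (N : nat) (a : R) (q : 'I_d -> R).
Hypothesis a1 : 1 <= a.
Implicit Types j : {ffun 'I_d -> 'I_N}.

Let a0 : 0 < a := lt_le_trans ltr01 a1.

Definition cell_coord j l (t : R) : R := bump1 (a * t + (- (a * q l) - (j l)%:R)).

(** The bump of the cell j is [bump1] in the coordinates in which the cell is the unit cube;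
    it lives on the middle half of the cell in each direction, so that the closed supports
    of the bumps are disjoint. *)
Definition cell_bump j : 'rV[R]_d -> R := tens (cell_coord j).

Lemma smooth1_cell_coord j l : smooth1 (cell_coord j l).
Proof. exact: (smooth1_affine a _ smooth1_bump). Qed.

Lemma derive1n_cell_coord j l n t : derive1n n (cell_coord j l) t =
  a ^+ n * derive1n n (@bump1 R) (a * t + (- (a * q l) - (j l)%:R)).
Proof. by rewrite (derive1n_affine a _ n smooth1_bump). Qed.

Lemma derive1n_cell_coord_bounded j l n :
  exists2 M, 1 <= M & forall t, `|derive1n n (cell_coord j l) t| <= M.
Proof.
have [W W1 hW] := @derive1n_bump_bounded R n; exists (a ^+ n * W).
  by apply: mulr_ege1 => //; exact: exprn_ege1.
move=> t; rewrite derive1n_cell_coord normrM ger0_norm ?exprn_ge0 ?(ltW a0)//.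
by apply: ler_wpM2l; [exact/exprn_ge0/ltW|exact: hW].
Qed.

Lemma tder_cell_supp j k x : tder (cell_coord j) k x != 0 ->
  forall l, 1/4 <= a * x ord0 l + (- (a * q l) - (j l)%:R) <= 3/4.
Proof.
move=> h l; apply: contraNP h => h; rewrite /tder /tens (bigD1 l)//= derive1n_cell_coord.
by rewrite (derive1n_supp (k l) smooth1_bump (@bump_supp R) h) mulr0 mul0r.
Qed.

Lemma tder_cell_single k x j j' :
  tder (cell_coord j) k x != 0 -> tder (cell_coord j') k x != 0 -> j = j'.
Proof.
move=> /tder_cell_supp h /tder_cell_supp h'; apply/ffunP => l; apply: val_inj => /=.
move: (h l) (h' l) => hl hl'; apply/eqP; rewrite eqn_leq; apply/andP; split.
  rewrite leqNgt; apply/negP; rewrite -(ler_nat R) -natr1; lra.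
rewrite leqNgt; apply/negP; rewrite -(ler_nat R) -natr1; lra.
Qed.

Lemma tder_cell_le j (k : 'I_d -> nat) m W x : 1 <= W ->
  (forall n t, (n <= m)%N -> `|derive1n n (@bump1 R) t| <= W) -> (\sum_l k l <= m)%N ->
  `|tder (cell_coord j) k x| <= W ^+ d * a ^+ m.
Proof.
move=> W1 hW km.
rewrite /tder /tens normr_prod.
apply: (@le_trans _ _ (\prod_(l < d) (W * a ^+ k l))).
  apply: ler_prod => l _; rewrite normr_ge0/= derive1n_cell_coord normrM mulrC.
  apply: ler_pM => //; last by rewrite ger0_norm ?exprn_ge0 ?(ltW a0).
  by apply: hW; apply: leq_trans km; rewrite (bigD1 l)//= leq_addr.
rewrite big_split/= prodr_const card_ord ler_wpM2l ?exprn_ge0//; first lra.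
by rewrite -expr_sum ler_weXn2l.
Qed.

Lemma cell_bumpE j : cell_bump j = tder (cell_coord j) (fun=> 0%N).
Proof. by []. Qed.

Lemma cell_bump_ge0 j x : 0 <= cell_bump j x.
Proof. by apply: prodr_ge0 => l _; exact: bump_ge0. Qed.

Lemma cell_bump_le1 j x : cell_bump j x <= 1.
Proof. by apply: Num.Theory.prodr_ile1 => l _; rewrite bump_ge0 bump_le1. Qed.

Lemma measurable_cell_bump j : measurable_fun setT (cell_bump j).
Proof. by rewrite cell_bumpE; apply: measurable_tder => l; exact: smooth1_cell_coord. Qed.

Lemma cell_bump_L2 j : L2 Omega (cell_bump j).
Proof.
have [] := @L2_bounded _ _ Omega Xfin (cell_bump j) 1 => //.
  by apply: measurable_funTS; exact: measurable_cell_bump.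
by move=> x _; rewrite ger0_norm ?cell_bump_ge0 ?cell_bump_le1.
Qed.

Definition bump_sum (c : {ffun 'I_d -> 'I_N} -> R) : 'rV[R]_d -> R :=
  \sum_j c j *: cell_bump j.

Lemma bump_sumE c x : bump_sum c x = \sum_j c j * cell_bump j x.
Proof. by rewrite /bump_sum fct_sumE. Qed.

Lemma bump_sum_le c (A : R) x : 0 <= A -> (forall j, `|c j| <= A) -> `|bump_sum c x| <= A.
Proof.
move=> A0 cA; rewrite bump_sumE -[A]mulr1; apply: normr_sum_single => //.
- by move=> j j'; exact: (tder_cell_single (k := fun=> 0%N)).
- by move=> j; rewrite ger0_norm ?cell_bump_ge0 ?cell_bump_le1.
Qed.

Lemma continuous_bump_sum c : continuous (bump_sum c).
Proof.
move=> x; rewrite /bump_sum; elim/big_ind : _ => [|f g cf cg|j _].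
- exact: cst_continuous.
- exact: (continuousD cf cg).
apply: (continuousM (@cst_continuous _ _ (c j) x)).
by apply: continuous_tens => l; apply: smooth1_continuous; exact: smooth1_cell_coord.
Qed.

Lemma bump_sum_L2 c : L2 Omega (bump_sum c).
Proof. by apply: (L2_sum Xfin) => j; apply: L2Z; exact: cell_bump_L2. Qed.

(** On the middle quarter of the cell in each direction the bump is at least exp(-16)^d. *)
Lemma cell_bump_mass j :
  (forall x : 'rV[R]_d, (forall l, q l <= x ord0 l <= q l + N%:R / a) -> X x) ->
  (expR (- 16) / (4 * a)) ^+ d <= \int[lebd]_(x in X) cell_bump j x.
Proof.
move=> qX.
pose lo l := q l + ((j l)%:R + 3/8) / a; pose hi l := q l + ((j l)%:R + 5/8) / a.
have lohi l : lo l <= hi l.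
  by rewrite /lo /hi lerD2l ler_pM2r ?invr_gt0//; lra.
have mX := measurable_closure Omega; have mB := @measurable_box R d lo hi.
have BX : box lo hi `<=` X.
  move=> x h; apply: qX => l; have /andP[h1 h2] := h l; apply/andP; split.
    apply: le_trans h1; rewrite /lo lerDl divr_ge0 ?(ltW a0)// addr_ge0//; lra.
  apply: le_trans h2 _; rewrite /hi lerD2l ler_pM2r ?invr_gt0//.
  have : (j l).+1%:R <= N%:R :> R by rewrite ler_nat.
  by rewrite -natr1; lra.
have mE : measurable_fun X (EFin \o cell_bump j).
  by apply/measurable_EFinP; apply: measurable_funTS; exact: measurable_cell_bump.
have fin : (\int[lebd]_(x in X) (cell_bump j x)%:E)%E \is a fin_num.
  apply: integrable_fin_num => //; apply: measurable_bounded_integrable => //.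
    by apply: measurable_funTS; exact: measurable_cell_bump.
  exists 1; split => // M M1 x _ /=; rewrite ger0_norm ?cell_bump_ge0//.
  by apply: le_trans (cell_bump_le1 _ _) (ltW M1).
rewrite -lee_fin /Rintegral fineK//.
apply: (@le_trans _ _ (\int[lebd]_(x in box lo hi) ((expR (- 16)) ^+ d)%:E)%E); last first.
  apply: (@le_trans _ _ (\int[lebd]_(x in box lo hi) (cell_bump j x)%:E)%E).
    apply: ge0_le_integral => //.
      exact: measurable_funS mE.
    move=> x h; rewrite lee_fin -[X in _ ^+ X](card_ord d) -prodr_const; apply: ler_prod => l _.
    rewrite expR_ge0/=; apply: bump_ge; have /andP[h1 h2] := h l.
    have aV : a * (q l + ((j l)%:R + 3/8) / a) = a * q l + (j l)%:R + 3/8.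
      by field; rewrite gt_eqF.
    have aV' : a * (q l + ((j l)%:R + 5/8) / a) = a * q l + (j l)%:R + 5/8.
      by field; rewrite gt_eqF.
    have := ler_wpM2l (ltW a0) h2; have := ler_wpM2l (ltW a0) h1; rewrite aV aV'; lra.
  by apply: ge0_subset_integral => // x _; rewrite lee_fin cell_bump_ge0.
rewrite integral_cst// [X in (_ * X)%E](leb_box lohi) -EFinM lee_fin -[X in _ <= _ * X](@eq_bigr _ _ _ _ _ _ (fun=> (4 * a)^-1)).
  by rewrite prodr_const card_ord exprMn.
by move=> l _; rewrite /lo /hi; field; rewrite gt_eqF.
Qed.

End grid.

(** At each point at most one term is nonzero, so that a derivative of order at most m =
    [(Num.truncn r).+1] is O(A a^m), and [Hsq_upper] applies. The constant is uniform in the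
    number and the position of the cells. *)
Lemma bump_sum_Hsq (r : R) : 0 < r -> exists2 C, 0 < C &
  forall N (a : R) (q : 'I_d -> R) (c : {ffun 'I_d -> 'I_N} -> R) A,
  1 <= a -> 0 <= A -> (forall j, `|c j| <= A) ->
  HrRKHS Omega r (bump_sum a q c) /\
  (Hsq Omega r (bump_sum a q c) <= (C * A ^+ 2 * a `^ (2 * r))%:E)%E.
Proof.
move=> r0; have [C C0 hC] := Hsq_upper Xfin r0.
have [W W1 hW] := @derive1n_bump_bounded R (Num.truncn r).+1.
have W0 : 0 <= W by lra.
exists (C * W ^+ d ^+ 2); first by rewrite mulr_gt0// !exprn_gt0//; lra.
move=> N a q c A a1 A0 cA.
suff H : (Hsq Omega r (bump_sum a q c) <= (C * W ^+ d ^+ 2 * A ^+ 2 * a `^ (2 * r))%:E)%E.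
  split => //; split; [exact: bump_sum_L2|apply: continuous_subspaceT; exact: continuous_bump_sum|].
  by apply: le_lt_trans H _; rewrite ltry.
have -> : C * W ^+ d ^+ 2 * A ^+ 2 * a `^ (2 * r) = C * (A * W ^+ d) ^+ 2 * a `^ (2 * r) by ring.
have Wd1 : 1 <= W ^+ d by exact: exprn_ege1.
apply: (hC _ (fun al => \sum_j c j *: tder (cell_coord a q j) (fun l => al l : nat))) => //.
- by rewrite mulr_ge0// exprn_ge0.
- exact: bump_sum_L2.
- apply: sob_adm_sum => // j; first exact: cell_bump_L2.
  move=> al _; split.
    by apply: tder_L2 => // [l|l n]; [exact: smooth1_cell_coord|exact: derive1n_cell_coord_bounded].
  apply: weak_derivative_tens => // [l|l n]; [exact: smooth1_cell_coord|exact: derive1n_cell_coord_bounded].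
- by move=> x _; apply: le_trans (bump_sum_le _ _ _ A0 cA) _ => //; rewrite ler_peMr.
move=> al alm x _; rewrite fct_sumE -mulrA; apply: normr_sum_single => //.
- by move=> j j'; exact: tder_cell_single.
- by rewrite mulr_ge0 ?exprn_ge0//; lra.
- by move=> j; exact: tder_cell_le.
Qed.

End bumps.

(** * One-dimensional kernels whose differences of scales are m-th derivatives *)

Section derive1n_rules.
Context {R : realType}.
Implicit Types u v w : R -> R.

Lemma derive1nZ (c : R) u n : smooth1 u -> derive1n n (c *: u) = c *: derive1n n u.
Proof.
move=> su; elim: n => [//|n ih]; rewrite !derive1nS ih; apply: der_derive1 => x.
exact: (@is_deriveZ _ _ _ _ c x 1 _ (smooth1_der (smooth1_derive1n n su) x)).
Qed.

Lemma derive1nB u v n : smooth1 u -> smooth1 v ->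
  derive1n n (u - v) = derive1n n u - derive1n n v.
Proof.
move=> su sv; elim: n => [//|n ih]; rewrite !derive1nS ih; apply: der_derive1 => x.
exact: (@is_deriveB _ _ _ _ _ x 1 _ _ (smooth1_der (smooth1_derive1n n su) x)
  (smooth1_der (smooth1_derive1n n sv) x)).
Qed.

Lemma smooth1Z (c : R) u : smooth1 u -> smooth1 (c *: u).
Proof. by move=> su; exact: (smooth1M (smooth1_cst c) su). Qed.

Lemma derive1n_open u v (U : set R) n : open U -> (forall t, U t -> u t = v t) ->
  forall t, U t -> derive1n n u t = derive1n n v t.
Proof.
move=> oU uv; elim: n => [|n ih] t Ut; first by rewrite !derive1n0; exact: uv.
rewrite !derive1nS !derive1E; apply: near_eq_derive.
move: oU; rewrite openE => /(_ t Ut); apply: filterS => s; exact: ih.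
Qed.

Lemma derive1n_cst0 n : derive1n n (cst (0 : R)) = cst 0.
Proof.
by elim: n => [//|n ih]; rewrite derive1nS ih; apply/funext => x; rewrite derive1_cst.
Qed.

Lemma derive1n_exprn n k : derive1n k (fun x : R => x ^+ n) = (fun x => (n ^_ k)%:R * x ^+ (n - k)).
Proof.
elim: k => [|k ih]; first by apply/funext => x; rewrite derive1n0 ffactn0 mul1r subn0.
rewrite derive1nS ih; apply: der_derive1 => x.
have hid : is_derive x 1 (id : R -> R) 1 by exact: is_derive_id.
have := @is_deriveZ _ _ _ _ (n ^_ k)%:R x 1 _ (@is_deriveX _ _ id (n - k) x 1 1 hid).
rewrite (_ : _ \*: _ = (fun y : R => (n ^_ k)%:R * y ^+ (n - k))); last first.
  by apply/funext => y; rewrite /= fctE.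
by move=> h; apply: (is_derive_eq h); rewrite /GRing.scale/= mulr1 subnS ffactnSr natrM !mulrA.
Qed.

End derive1n_rules.

Section kernel.
Context {R : realType}.
Variable m' : nat.
Let m := m'.+1.
Notation leb1 := (@lebesgue_measure R).

(** The derivative of order m' + 1 of the ramp is supported where [step] increases, since
    the ramp is a polynomial of degree m' beyond. *)
Definition ramp (v : R) : R := v ^+ m' * step v.

Lemma smooth1_ramp : smooth1 ramp.
Proof. by apply: smooth1M; [exact: smooth1_X|exact: smooth1_step]. Qed.

(** The powers of v beyond 1 cancel, so that the difference of two scales of the ramp has a
    compact support away from 0; its derivative of order m' + 1 is a difference of two
    scales of [kern]. *)
Definition ramp_gap : R -> R := ramp - (2^-1 ^+ m') *: (fun v => ramp (2 * v + 0)).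

Lemma smooth1_ramp_gap : smooth1 ramp_gap.
Proof.
apply: smooth1D; first exact: smooth1_ramp.
by apply: smooth1N; apply: smooth1Z; apply: smooth1_affine; exact: smooth1_ramp.
Qed.

Lemma ramp0 v : v <= 1/2 -> ramp v = 0.
Proof. by move=> v2; rewrite /ramp step0 ?mulr0. Qed.

Lemma ramp1 v : 1 <= v -> ramp v = v ^+ m'.
Proof. by move=> v1; rewrite /ramp step1 ?mulr1. Qed.

Lemma ramp_gap_supp v : ~ (1/4 <= v <= 1) -> ramp_gap v = 0.
Proof.
move=> h; rewrite /ramp_gap.
rewrite -[LHS]/(ramp v - 2^-1 ^+ m' * ramp (2 * v + 0)) addr0.
have [v4|v4] := ltP v (1/4); first by rewrite !ramp0 ?mulr0 ?subr0//; lra.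
have [v1|v1] := leP v 1; first by case: h; lra.
by rewrite !ramp1 ?exprMn ?mulrA -?exprMn ?mulVf ?expr1n ?mul1r ?subrr//; lra.
Qed.

Definition kern : R -> R := derive1n m ramp.

Lemma kern_supp v : ~ (1/2 <= v <= 1) -> kern v = 0.
Proof.
move=> h; have [v2|v2] := ltP v (1/2).
  rewrite /kern (@derive1n_open _ ramp (cst 0) [set t | t < 1/2])//.
  - by rewrite derive1n_cst0.
  - by move=> t /= t2; rewrite ramp0// ltW.
have [v1|v1] := leP v 1; first by case: h; lra.
rewrite /kern (@derive1n_open _ ramp (fun t => t ^+ m') [set t | 1 < t])//.
- by rewrite derive1n_exprn ffact_small ?mul0r.
- by move=> t /= t2; rewrite ramp1// ltW.
Qed.

Lemma derive1n_ramp0 n v : v < 1/2 -> derive1n n ramp v = 0.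
Proof.
move=> v2; rewrite (@derive1n_open _ ramp (cst 0) [set t | t < 1/2])//.
- by rewrite derive1n_cst0.
- by move=> t /= t2; rewrite ramp0// ltW.
Qed.

Lemma derive1n_ramp1 v : 1 < v -> derive1n m' ramp v = m'`!%:R.
Proof.
move=> v1; rewrite (@derive1n_open _ ramp (fun t => t ^+ m') [set t | 1 < t])//.
- by rewrite derive1n_exprn ffactnn subnn expr0 mulr1.
- by move=> t /= t2; rewrite ramp1// ltW.
Qed.

Lemma derive1n_ramp_gap : derive1n m ramp_gap = kern - 2 *: (fun v => kern (2 * v + 0)).
Proof.
have s2 : smooth1 (fun v => ramp (2 * v + 0)) by apply: smooth1_affine; exact: smooth1_ramp.
rewrite /ramp_gap derive1nB ?derive1nZ//; [|exact: smooth1_ramp|exact: smooth1Z].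
rewrite (derive1n_affine _ _ _ smooth1_ramp); congr (_ - _); apply/funext => v.
rewrite -[LHS]/(2^-1 ^+ m' * (2 ^+ m * kern (2 * v + 0))) mulrA exprS [2 * _]mulrC mulrA -exprMn.
by rewrite mulVf ?expr1n ?mul1r.
Qed.

(** The kernel rescaled to the signed scale del about x. *)
Definition skern (x del t : R) : R := del^-1 * kern (del^-1 * t + - (x / del)).

Definition sgap (x del t : R) : R := del ^+ m' * ramp_gap (del^-1 * t + - (x / del)).

Lemma smooth1_skern x del : smooth1 (skern x del).
Proof.
apply: (@smooth1Z _ _ (fun t => kern (del^-1 * t + - (x / del)))); apply: smooth1_affine.
by apply: smooth1_derive1n; exact: smooth1_ramp.
Qed.

Lemma smooth1_sgap x del : smooth1 (sgap x del).
Proof.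
apply: (@smooth1Z _ _ (fun t => ramp_gap (del^-1 * t + - (x / del)))); apply: smooth1_affine.
exact: smooth1_ramp_gap.
Qed.

Lemma skern_arg (x del t : R) : del^-1 * t + - (x / del) = (t - x) / del.
Proof. by rewrite mulrBl mulrC. Qed.

Lemma skern_supp x del t : ~ (1/2 <= (t - x) / del <= 1) -> skern x del t = 0.
Proof. by move=> h; rewrite /skern skern_arg kern_supp ?mulr0. Qed.

Lemma sgap_supp x del t : ~ (1/4 <= (t - x) / del <= 1) -> sgap x del t = 0.
Proof. by move=> h; rewrite /sgap skern_arg ramp_gap_supp ?mulr0. Qed.

Lemma derive1n_sgap x del : del != 0 ->
  derive1n m (sgap x del) = skern x del - skern x (del / 2).
Proof.
move=> d0; rewrite (derive1nZ _ _ (smooth1_affine _ _ smooth1_ramp_gap)).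
rewrite (derive1n_affine _ _ _ smooth1_ramp_gap) derive1n_ramp_gap; apply/funext => t.
rewrite -[LHS]/(del ^+ m' * (del^-1 ^+ m * (kern (del^-1 * t + - (x / del)) -
  2 * kern (2 * (del^-1 * t + - (x / del)) + 0)))).
rewrite mulrA exprS mulrCA -exprMn mulfV// expr1n mulr1 mulrBr.
rewrite -[RHS]/(skern x del t - skern x (del / 2) t) /skern; congr (_ - _).
rewrite mulrA addr0; congr (_ * kern _); field; rewrite ?d0//.
Qed.

Lemma kern_bounded : exists2 W, 1 <= W & forall v, `|kern v| <= W /\ `|ramp_gap v| <= W.
Proof.
have [W W1 hW] := supp_bounded (smooth1_continuous (smooth1_derive1n m smooth1_ramp)) kern_supp.
have [V V1 hV] := supp_bounded (smooth1_continuous smooth1_ramp_gap) ramp_gap_supp.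
exists (W + V) => [|v]; first lra.
by split; [have := hW v; rewrite -/kern; lra|have := hV v; lra].
Qed.

Lemma der_skern x del : del != 0 ->
  der (fun t => derive1n m' ramp (del^-1 * t + - (x / del))) (skern x del).
Proof.
move=> d0 t.
have := der_affine del^-1 (- (x / del)) (smooth1_der (smooth1_derive1n m' smooth1_ramp)) t.
by rewrite /skern /kern derive1nS.
Qed.

(** The kernel is the derivative of a function that passes from 0 to (m-1)! *)
Lemma integral_skern (x del : R) : del != 0 -> `|del| <= 1 ->
  leb1.-integrable setT (EFin \o skern x del) /\
  `|\int[leb1]_t skern x del t| = m'`!%:R.
Proof.
move=> d0 d1; pose D : set R := `[x - 2, x + 2]%classic.
have mD : measurable D by exact: measurable_itv.
have s0 t : ~ D t -> skern x del t = 0.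
  move=> h; apply: skern_supp => h1; apply: h; rewrite /D/= in_itv/=.
  suff : `|t - x| <= 1 by rewrite ler_norml; lra.
  rewrite (_ : t - x = (t - x) / del * del) ; last by rewrite divfK.
  by rewrite normrM mulr_ile1// ger0_norm; lra.
have cs : continuous (skern x del) by apply: smooth1_continuous; exact: smooth1_skern.
have E : (\int[leb1]_t (skern x del t)%:E = \int[leb1]_(t in D) (skern x del t)%:E)%E.
  rewrite [RHS]integral_mkcond; apply: eq_integral => t _; rewrite patchE.
  by case: ifPn => // /negP tD; rewrite s0// => tD'; apply: tD; exact/mem_set.
have iD : leb1.-integrable D (EFin \o skern x del).
  apply: continuous_compact_integrable; first exact: segment_compact.
  exact: continuous_subspaceT.
split.
  have /(@integrable_mkcond _ _ _ leb1 D (EFin \o skern x del) mD) := iD; apply: eq_integrable => // t _.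
  by rewrite patchE; case: ifPn => // /negP tD /=; rewrite s0// => tD'; apply: tD; exact/mem_set.
rewrite /Rintegral E.
pose F t := derive1n m' ramp (del^-1 * t + - (x / del)).
have cF : continuous F.
  apply: smooth1_continuous; apply: smooth1_affine; apply: smooth1_derive1n; exact: smooth1_ramp.
rewrite (@continuous_FTC2 _ (skern x del) F (x - 2) (x + 2)).
- rewrite /F !skern_arg -EFinB/=.
  have -> : x + 2 - x = 2 by ring.
  have -> : x - 2 - x = - 2 by ring.
  have [del0|del0] := ltP 0 del.
    have h : 2 <= 2 / del by rewrite ler_pdivlMr//; move: d1; rewrite gtr0_norm//; lra.
    by rewrite derive1n_ramp1 1?derive1n_ramp0 ?subr0 ?mulNr ?normr_nat//; lra.
  have {}del0 : del < 0 by rewrite lt_neqAle d0.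
  have h : 2 <= (- 2) / del.
    by rewrite -mulrNN -invrN opprK ler_pdivlMr ?oppr_gt0//; move: d1; rewrite ltr0_norm//; lra.
  have h' : 2 / del <= - 2 by move: h; rewrite mulNr; lra.
  by rewrite derive1n_ramp0 1?derive1n_ramp1 ?sub0r ?normrN ?normr_nat//; lra.
- lra.
- exact: continuous_subspaceT.
- split => [t _||].
  + by have := der_skern x d0 t => h; exact: ex_derive.
  + exact/cvg_at_right_filter/cF.
  + exact/cvg_at_left_filter/cF.
- by move=> t _; rewrite (der_derive1 (der_skern x d0)).
Qed.

End kernel.

(** * A cone condition, uniform over a domain with smooth boundary *)

(** The mean value theorem, changing one coordinate at a time; the bounds on the partial
    derivatives near u0 come from their continuity. *)
Lemma smooth_locally_lipschitz {R : realType} n (g : 'rV[R]_n -> R) (u0 : 'rV[R]_n) : smooth g ->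
  exists e L : R, [/\ 0 < e, 0 <= L & forall u v (D : R), ball u0 e u -> ball u0 e v ->
    (forall l, `|u ord0 l - v ord0 l| <= D) -> `|g u - g v| <= L * D].
Proof.
move=> sg; pose b l := `|partial l g u0| + 1.
have nearb : \forall u \near u0, forall l, `|partial l g u| <= b l.
  apply: (@filter_forall _ _ (fun l u => `|partial l g u| <= b l) (nbhs u0)) => l.
  have c : continuous (fun u => `|partial l g u|).
    by move=> u; apply: continuous_comp; [exact: smooth_cont (smooth_partial l sg) u|exact: norm_continuous].
  have lt_b : `|partial l g u0| < b l by rewrite ltrDl.
  by apply: filterS (cvgr_lt _ (c u0) _ lt_b) => u; exact: ltW.
have [e3 e30 he3] := (nbhs_ballP _ _).1 nearb.
pose e := e3 / 3; have e0 : 0 < e by rewrite divr_gt0.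
have ee3 : e < e3 by rewrite /e; move: (e30 : 0 < e3); lra.
pose M := \sum_l b l.
have b0 l : 0 <= b l by rewrite addr_ge0.
have bM l : b l <= M by rewrite /M (bigD1 l)//= lerDl sumr_ge0.
exists e, (n%:R * M); split => // [|u v D uu0 vu0 uvD].
  by rewrite mulr_ge0// sumr_ge0.
pose w k : 'rV[R]_n := \row_l (if (l < k)%N then u ord0 l else v ord0 l).
have [n0|n0] := posnP n.
  have -> : u = v by apply/rowP => l; exfalso; have := leq_ltn_trans (leq0n l) (ltn_ord l); rewrite lt0n n0.
  by rewrite subrr normr0 n0 mul0r mul0r.
have D0 : 0 <= D by apply: le_trans (uvD (Ordinal n0)); exact: normr_ge0.
suff H k : (k <= n)%N -> `|g (w k) - g v| <= k%:R * M * D.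
  have -> : u = w n by apply/rowP => l; rewrite mxE ltn_ord.
  exact: H.
elim: k => [_|k ih kn].
  have -> : w 0%N = v by apply/rowP => l; rewrite mxE.
  by rewrite subrr normr0 !mul0r.
have := ih (ltnW kn) => {}ih; pose i := Ordinal kn.
have wS : w k.+1 = setc (w k) i (u ord0 i).
  apply/rowP => l; rewrite !mxE ltnS leq_eqVlt -(inj_eq val_inj)/=.
  by case: eqP => //= li; congr (u ord0 _); exact: val_inj.
have wi : w k ord0 i = v ord0 i by rewrite mxE ltnn.
have step : `|g (w k.+1) - g (w k)| <= M * D.
  rewrite wS; apply: le_trans (@partial_MVT _ _ g (partial i g) i (w k) _ M _ _) _.
  - by move=> y; exact: smooth_is_derive.
  - move=> s; rewrite wi => hs; apply: le_trans (bM i); apply: he3.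
    apply/ball_rV => // l; rewrite setc_coord.
    have /(ball_rV _ _ e0) /(_ l) hu := uu0; have /(ball_rV _ _ e0) /(_ l) hv := vu0.
    have [li|li] := eqVneq l i.
      rewrite li in hu hv *; move: hs hu hv; rewrite /e.
      move: (u ord0 i) (v ord0 i) (u0 ord0 i) => U V O.
      rewrite !ltr_norml ler_norml.
      move=> /andP[a1 a2] /andP[b1 b2] /andP[c1 c2].
      have : `|U - V| <= 2 * (e3 / 3) by rewrite ler_norml; lra.
      lra.
    by rewrite mxE; case: ifP => _; [exact: lt_trans hu _|exact: lt_trans hv _].
  - by rewrite wi ler_wpM2l// sumr_ge0.
rewrite -natr1 2!mulrDl mul1r.
have -> : g (w k.+1) - g v = (g (w k) - g v) + (g (w k.+1) - g (w k)) by ring.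
by apply: le_trans (ler_normD _ _) _; exact: lerD.
Qed.

Section cones.
Context {R : realType} {d : nat} (Omega : set 'rV[R]_d).
Let X := closure Omega.
Hypothesis hOmega : smooth_bounded_domain Omega.

(** A box with a vertex at y and its scalings about y, without a neighbourhood of y; the
    edges kap may be negative. *)
Definition cone_at (c : R) (y : 'rV[R]_d) := exists2 kap : 'I_d -> R,
  (forall l, c <= `|kap l| <= 1) & forall (rho : R) (z : 'rV[R]_d), 0 < rho <= 1 ->
    (forall l, 1/4 <= (z ord0 l - y ord0 l) / (kap l * rho) <= 1) -> Omega z.

Lemma cone_at_le c c' y : c' <= c -> cone_at c y -> cone_at c' y.
Proof.
move=> cc' [kap hk H]; exists kap => // l; have /andP[h ->] := hk l.
by rewrite (le_trans cc').
Qed.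

Lemma cone_coord (kap rho zy : R) : kap != 0 -> 0 < rho <= 1 -> 1/4 <= zy / (kap * rho) <= 1 ->
  `|zy| <= `|kap| * rho /\ (exists2 v, 1/4 <= v <= 1 & zy = kap * rho * v).
Proof.
move=> k0 /andP[r0 r1] h.
have kr : kap * rho != 0 by rewrite mulf_neq0// gt_eqF.
have E : zy = kap * rho * (zy / (kap * rho)) by rewrite mulrC divfK.
split; last by exists (zy / (kap * rho)).
rewrite {1}E !normrM (gtr0_norm r0) -normrM ler_piMr ?mulr_ge0 ?(ltW r0)//.
by rewrite ger0_norm; lra.
Qed.

Lemma cone_interior x : Omega x -> exists2 c : R, 0 < c & \forall y \near x, Omega y -> cone_at c y.
Proof.
move=> Ox; have [_ oO _ _ _] := hOmega.
have [e e0 he] : exists2 e : R, 0 < e & ball x e `<=` Omega.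
  by have /nbhs_ballP[e e0 he] := open_nbhs_nbhs (conj oO Ox); exists e.
pose c : R := Num.min e 1 / 2.
have c0 : 0 < c by apply: divr_gt0; rewrite ?lt_min ?e0 ?ltr01 ?ltr0n.
have ce : c <= e / 2 by rewrite ler_pM2r// ge_min lexx.
have c1 : c <= 1 by rewrite /c ler_pdivrMr// mul1r ge_min; apply/orP; right; lra.
exists c => //; apply/nbhs_ballP; exists (e / 2) => [|y yx _]; first by rewrite /= divr_gt0.
exists (fun=> c) => [l|rho z rho1 hz]; first by rewrite gtr0_norm// lexx.
apply: he; apply/ball_rV => // l.
have e20 : 0 < e / 2 by rewrite divr_gt0.
have /(ball_rV _ _ e20) /(_ l) hy := yx.
have [hzl _] := cone_coord (lt0r_neq0 c0) rho1 (hz l).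
have : `|z ord0 l - y ord0 l| <= e / 2.
  apply: le_trans hzl _; rewrite gtr0_norm//; case/andP: rho1 => r0 r1.
  by apply: le_trans ce; rewrite ler_piMr// ltW.
have := ler_normB (x ord0 l - y ord0 l) (z ord0 l - y ord0 l).
by rewrite opprB addrA subrK; move: hy; lra.
Qed.

(** Near x the domain is the region on one side of the graph of a function with a Lipschitz
    constant L. A box that is h long in the direction of the graph and at most h / (4 L)
    wide in the others stays on the right side: moving by a fraction v >= 1/4 of its length
    in that direction compensates for the variation of the graph over its width. *)
Lemma cone_boundary x : X x -> ~ Omega x ->
  exists2 c : R, 0 < c & \forall y \near x, Omega y -> cone_at c y.
Proof.
move=> Xx nOx; have [_ _ _ _ sb] := hOmega.
have [i [b [g [eps [eps0 sg hg]]]]] := sb x (conj Xx nOx).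
have [e [L [e0 L0 gL]]] := smooth_locally_lipschitz (col' i x) sg.
pose h : R := Num.min (Num.min eps e) 1 / 2.
have h0 : 0 < h by apply: divr_gt0; rewrite ?lt_min ?eps0 ?e0 ?ltr01 ?ltr0n.
have heps : h <= eps / 2 by rewrite ler_pM2r// !ge_min lexx.
have he : h <= e / 2 by rewrite ler_pM2r// !ge_min lexx !orbT.
have h1 : h <= 1 by rewrite /h ler_pdivrMr// mul1r !ge_min; apply/orP; right; lra.
pose c := h / (4 * (L + 1)).
have L1 : 0 < 4 * (L + 1) by lra.
have c0 : 0 < c by rewrite divr_gt0.
have ch : c <= h by rewrite /c ler_pdivrMr// ler_peMr ?(ltW h0)//; lra.
have Lc : L * c <= h / 4.
  rewrite /c mulrA ler_pdivrMr//; have -> : h / 4 * (4 * (L + 1)) = L * h + h by field.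
  by rewrite lerDl ltW.
exists c => //; apply/nbhs_ballP; exists h => // y yx Oy.
pose kap l := if l == i then (-1) ^+ b * h else c.
have kapn l : `|kap l| = if l == i then h else c.
  rewrite /kap; case: ifP => _; last exact: gtr0_norm.
  by rewrite normrM normr_sign mul1r (gtr0_norm h0).
have kap0 l : kap l != 0 by rewrite -normr_gt0 kapn; case: ifP.
have kaph l : `|kap l| <= h by rewrite kapn; case: ifP.
exists kap => [l|rho z rho1 hz].
  by rewrite (le_trans (kaph l))// andbT kapn; case: ifP.
have [r0 r1] := andP rho1.
have /(ball_rV _ _ h0) yx' := yx.
have zy l : `|z ord0 l - y ord0 l| <= h.
  have [hzl _] := cone_coord (kap0 l) rho1 (hz l).
  apply: le_trans hzl _; apply: le_trans (kaph l); by rewrite ler_piMr.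
have zx l : `|x ord0 l - z ord0 l| < 2 * h.
  have := ler_normB (x ord0 l - y ord0 l) (z ord0 l - y ord0 l).
  by rewrite opprB addrA subrK; have := yx' l; have := zy l; lra.
have bz : ball x eps z by apply/ball_rV => // l; apply: lt_le_trans (zx l) _; lra.
have by_ : ball x eps y by apply/ball_rV => // l; apply: lt_le_trans (yx' l) _; lra.
apply/(hg _ bz); have /(hg _ by_) gy := Oy.
have gzy : `|g (col' i z) - g (col' i y)| <= L * (c * rho).
  apply: gL.
  - by apply/ball_rV => // l; rewrite !mxE; apply: lt_le_trans (zx _) _; lra.
  - by apply/ball_rV => // l; rewrite !mxE; apply: lt_le_trans (yx' _) _; lra.
  - move=> l; rewrite !mxE.
    have [] := cone_coord (kap0 (lift i l)) rho1 (hz (lift i l)).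
    by rewrite kapn eq_sym (negPf (neq_lift _ _)).
have [_ [v v1 Ev]] := cone_coord (kap0 i) rho1 (hz i).
have Ez : (-1) ^+ b * z ord0 i = (-1) ^+ b * y ord0 i + h * rho * v.
  have -> : z ord0 i = y ord0 i + kap i * rho * v by rewrite -Ev addrC subrK.
  rewrite mulrDr /kap eqxx; congr (_ + _); rewrite !mulrA -signr_addb addbb expr0 mul1r.
  by [].
rewrite Ez; move: gzy; rewrite ler_norml => /andP[_ gzy].
have : L * (c * rho) <= h * rho * v.
  rewrite mulrA; apply: le_trans (ler_wpM2r (ltW r0) Lc) _.
  have -> : h / 4 * rho = h * rho * (1/4) by ring.
  by apply: ler_wpM2l; [exact: mulr_ge0 (ltW h0) (ltW r0)|lra].
lra.
Qed.

Lemma bounded_in_box : exists M, Omega `<=` box (fun=> - M) (fun=> M).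
Proof.
have [_ _ _ [M [_ hM]] _] := hOmega; exists (`|M| + 1) => x Ox l.
have h : `|x| <= `|M| + 1 by apply: hM => //; rewrite ltr_pwDr// ler_norm.
by have := normr_coord x l; rewrite -ler_norml => /le_trans; apply.
Qed.

Lemma compact_closure_domain : compact X.
Proof.
have [M OM] := bounded_in_box; apply: (subclosed_compact _ (@compact_box R d (fun=> - M) (fun=> M))).
  exact: closed_closure.
have := closureS OM; rewrite -(closure_id (box _ _)).1//.
by apply: compact_closed; [exact: norm_hausdorff|exact: compact_box].
Qed.

(** Compactness of the closure turns the local constants into one. *)
Lemma uniform_cone : exists2 c : R, 0 < c <= 1 & forall y, Omega y -> cone_at c y.
Proof.
have cov : near_covering X by exact/compact_near_coveringP/compact_closure_domain.
have H : \forall c \near (0 : R)^'+, X `<=` (fun y => Omega y -> cone_at c y).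
  apply: cov => x Xx.
  have [c c0 hc] : exists2 c : R, 0 < c & \forall y \near x, Omega y -> cone_at c y.
    by have [Ox|nOx] := pselect (Omega x); [exact: cone_interior|exact: cone_boundary].
  near=> y c' => /= Oy; apply: (@cone_at_le c).
    by near: c'; exact: nbhs_right_le.
  by move: Oy; near: y.
near (0 : R)^'+ => c; exists c.
  by apply/andP; split; near: c; [exact: nbhs_right_gt|exact: nbhs_right_le].
by move=> y Oy; apply: (near H c) => //; exact: subset_closure.
Unshelve. all: by end_near. Qed.

End cones.

(** * The embedding of the interpolation space into the bounded functions *)

(** The factors are exchanged one by one, from the first on. *)
Lemma prod_telescope {R : comPzRingType} n (u v : 'I_n -> R) :
  \prod_l u l - \prod_l v l =
  \sum_(i < n) \prod_(l < n) (if (l < i)%N then v l else if l == i then u l - v l else u l).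
Proof.
elim: n u v => [|n ih] u v; first by rewrite !big_ord0 subrr.
rewrite [in LHS]big_ord_recl [in X in _ - X]big_ord_recl [RHS]big_ord_recl [X in _ = X + _]big_ord_recl /=.
under [X in _ = _ + X]eq_bigr => i _.
  rewrite big_ord_recl /=.
  under eq_bigr => l _ do rewrite /bump /= !add1n ltnS (inj_eq lift_inj).
  over.
rewrite -big_distrr/= -ih; ring.
Qed.

Section functionals.
Context {R : realType} {d : nat} (Omega : set 'rV[R]_d).
Let X := closure Omega.
Hypothesis Xfin : (@leb R d X < +oo)%E.
Notation lebd := (@leb R d).
Notation L2 := (L2 Omega).
Notation L2dot := (L2dot Omega).
Let mX := measurable_closure Omega.

(** The infima in the K-functional and in the Sobolev norm are removed together. *)
Lemma Ksq_ge m (A t : R) f : 0 < t -> L2 f ->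
  (forall g h, L2 g -> sob_adm Omega g h ->
    A <= L2dot (f - g) (f - g) + t ^+ 2 * \sum_(al : multi d m | (msize al <= m)%N) L2dot (h al) (h al)) ->
  (A%:E <= Ksq Omega m t f)%E.
Proof.
move=> t0 Lf H; apply: le_ereal_inf_tmp => _ [g Lg <-].
have Lfg : L2 (f - g) by exact: L2B.
have t20 : 0 < t ^+ 2 by rewrite exprn_gt0.
rewrite -[(f \- g)%R]/(f - g) (L2sqE Lfg); set a := L2dot (f - g) (f - g).
have : (((A - a) / t ^+ 2)%:E <= sobolev_sq Omega m g)%E.
  apply: le_ereal_inf_tmp => _ [h hg <-].
  rewrite (eq_bigr (fun al => (L2dot (h al) (h al))%:E)); last first.
    by move=> al alm; rewrite (L2sqE (hg al alm).1).
  by rewrite sumEFin lee_fin ler_pdivrMr// mulrC lerBlDl; exact: H.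
move: (sobolev_sq Omega m g) => S hS.
apply: (@le_trans _ _ (a%:E + (t ^+ 2)%:E * ((A - a) / t ^+ 2)%:E)%E).
  by rewrite -EFinM -EFinD lee_fin mulrC divfK ?gt_eqF// addrC subrK.
by apply: leeD => //; apply: lee_wpmul2l => //; rewrite lee_fin ltW.
Qed.

(** With f = (f - g) + g, the part f - g is tested against the derivative of om and is at
    most E |f - g|^2, while on g the derivative is moved from om to g, which gives at most
    t^2 E |h al|^2. The infimum over g is the K-functional. *)
Lemma test_functional m (al : multi d m) om f (t E : R) : (msize al <= m)%N -> 0 < t -> 0 < E ->
  L2 f -> test_fun Omega om ->
  L2dot (mpartial al om) (mpartial al om) <= E -> L2dot om om <= t ^+ 2 * E ->
  ((L2dot f (mpartial al om) ^+ 2)%:E <= (2 * E)%:E * Ksq Omega m t f)%E.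
Proof.
move=> alm t0 E0 Lf tom hE hom.
have Lom := test_fun_L2 Xfin tom; have Lmp := test_fun_L2 Xfin (test_fun_mpartial al tom).
have E20 : 0 < 2 * E by lra.
set c := L2dot f _.
have : ((c ^+ 2 / (2 * E))%:E <= Ksq Omega m t f)%E.
  apply: Ksq_ge => // g h Lg gh; have Lfg : L2 (f - g) by exact: L2B.
  have [Lh wh] := gh al alm.
  have cE : c = L2dot (f - g) (mpartial al om) + L2dot g (mpartial al om).
    by rewrite (L2dotBl Lf Lg Lmp) subrK.
  have h1 := L2dot_CauchySchwarz Lfg Lmp.
  have h2 : L2dot g (mpartial al om) ^+ 2 <= L2dot (h al) (h al) * L2dot om om.
    by rewrite wh// exprMn -exprM mulnC exprM sqrrN expr1n expr1n mul1r; exact: L2dot_CauchySchwarz.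
  have h3 : L2dot (h al) (h al) <= \sum_(al : multi d m | (msize al <= m)%N) L2dot (h al) (h al).
    by rewrite (bigD1 al)//= lerDl; apply: sumr_ge0 => be _; apply: Rintegral_ge0 => // x _; rewrite -expr2 sqr_ge0.
  have g1 := L2dot_ge0 Lfg; have g2 := L2dot_ge0 Lh.
  rewrite ler_pdivrMr// cE.
  move: h1 h2 h3 g1 g2 hE hom; move: (L2dot g (mpartial al om)) (L2dot (f - g) (mpartial al om)) (L2dot (f - g) (f - g))
    (L2dot (h al) _) (L2dot om om) (L2dot (mpartial al om) _) (\sum_(al | _) _).
  move=> x y ff hh oo mm S h1 h2 h3 g1 g2 hE hom.
  have k1 : y ^+ 2 <= ff * E by apply: le_trans h1 _; rewrite ler_wpM2l.
  have k2 : x ^+ 2 <= t ^+ 2 * S * E.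
    apply: le_trans h2 _; apply: le_trans (ler_wpM2l g2 hom) _.
    rewrite (_ : t ^+ 2 * S * E = S * (t ^+ 2 * E)); last ring.
    by apply: ler_wpM2r => //; rewrite mulr_ge0 ?sqr_ge0// ltW.
  have : 0 <= (y - x) ^+ 2 by exact: sqr_ge0.
  rewrite sqrrB sqrrD; move: k1 k2; rewrite (_ : _ * (2 * E) = 2 * (ff * E) + 2 * (t ^+ 2 * S * E)); last ring.
  by move: (ff * E) (t ^+ 2 * S * E) => p p'; rewrite !mulr2n; lra.
move: (Ksq Omega m t f) => K /(lee_wpmul2l (ltW E20 : (0 <= (2 * E)%:E)%E)).
by rewrite -EFinM mulrC divfK ?gt_eqF.
Qed.

(** The integrand is at least a multiple of its value at t on [t, 2 t], as the K-functional
    is increasing. *)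
Lemma Ksq_le_Hsq (r t : R) f : 0 < r -> 0 < t -> L2 f ->
  (Ksq Omega (Num.truncn r).+1 t f <=
   (8 * t `^ (2 * (r / (Num.truncn r).+1%:R)))%:E * Hsq Omega r f)%E.
Proof.
move=> r0 t0 Lf; set m := (Num.truncn r).+1; set theta := r / m%:R.
have th0 : 0 < theta by rewrite divr_gt0// ltr0n.
have th1 : theta < 1 by rewrite /theta ltr_pdivrMr ?ltr0n// mul1r /m truncnS_gt.
have KE := fineK (Ksq_fin Xfin m t Lf); set K := fine _ in KE.
have K0 : 0 <= K by rewrite -lee_fin KE Ksq_ge0.
pose q := 2 * theta + 1; pose D : set R := `[t, 2 * t]%classic.
have t20 : 0 < 2 * t by lra.
have tq : 0 < (2 * t) `^ q by rewrite powR_gt0.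
have mD : measurable D by exact: measurable_itv.
have D0 : D `<=` `]0, +oo[%classic.
  by move=> x; rewrite /D/= !in_itv/= andbT => /andP[h _]; exact: lt_le_trans h.
have le : ((((2 * t) `^ q)^-1 * K * t)%:E <= Hsq Omega r f)%E.
  apply: (@le_trans _ _ (\int[lebesgue_measure]_(x in D) interp_integrand Omega m theta f x)%E); last first.
    rewrite -[leRHS]/(\int[lebesgue_measure]_(x in `]0%R, +oo[) interp_integrand Omega m theta f x)%E.
    apply: ge0_subset_integral => //.
      exact: measurable_interp.
    by move=> x _; exact: interp_ge0.
  apply: (@le_trans _ _ (\int[lebesgue_measure]_(x in D) (((2 * t) `^ q)^-1 * K)%:E)%E).
    rewrite integral_cst// [X in (_ * X)%E](_ : _ = t%:E)//.
    rewrite [LHS]lebesgue_measure_itv/= lte_fin ifT; last by lra.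
    by rewrite -EFinD; congr EFin; ring.
  apply: ge0_le_integral => //.
  - by move=> x _; rewrite lee_fin mulr_ge0// invr_ge0 ltW.
  - by apply: measurable_funS D0 _ => //; exact: measurable_interp.
  move=> x; rewrite /D/= in_itv/= => /andP[tx xt]; rewrite /interp_integrand EFinM KE.
  have x0 : 0 < x by exact: lt_le_trans tx.
  apply: lee_pmul; rewrite ?lee_fin ?invr_ge0 ?(ltW tq) ?Ksq_ge0//.
    rewrite -opprD -/q powRN lef_pV2 ?posrE ?powR_gt0//.
    by apply: ge0_ler_powR; rewrite ?nnegrE ?(ltW x0) ?(ltW t20)// addr_ge0// mulr_ge0// ltW.
  by apply: Ksq_nondecreasing; rewrite (ltW t0).
rewrite -KE; have : ((8 * t `^ (2 * theta))%:E * ((((2 * t) `^ q)^-1 * K * t)%:E) <=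
    (8 * t `^ (2 * theta))%:E * Hsq Omega r f)%E.
  by apply: lee_wpmul2l => //; rewrite lee_fin mulr_ge0// powR_ge0.
apply: le_trans; rewrite -EFinM lee_fin.
have t2q : (2 * t) `^ q = 2 `^ q * (t `^ (2 * theta) * t).
  rewrite powRM//; last exact: ltW.
  congr (_ * _); rewrite -[X in _ = _ * X](powRr1 (ltW t0)) -powRD//.
  by rewrite (gt_eqF t0) implybT.
have tt0 : 0 < t `^ (2 * theta) by rewrite powR_gt0.
have q8 : 2 `^ q <= 8 :> R.
  have -> : 8 = 2 `^ 3%:R :> R by rewrite powR_mulrn//; ring.
  by apply: ler_powR; [lra|rewrite /q; lra].
have q0 : 0 < 2 `^ q :> R by rewrite powR_gt0.
rewrite t2q; have -> : 8 * t `^ (2 * theta) * ((2 `^ q * (t `^ (2 * theta) * t))^-1 * K * t) = 8 / 2 `^ q * K.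
  by field; rewrite ?gt_eqF.
by rewrite ler_peMl// ler_pdivlMr// mul1r.
Qed.

Lemma Rintegral_box_le (F : 'rV[R]_d -> R) (D rho : R) (lo hi : 'I_d -> R) : 0 <= D ->
  (forall l, 0 <= hi l - lo l <= rho) -> measurable_fun X F ->
  (forall y, X y -> box lo hi y -> `|F y| <= D) -> (forall y, X y -> ~ box lo hi y -> F y = 0) ->
  lebd.-integrable X (EFin \o F) /\ `|\int[lebd]_(y in X) F y| <= D * rho ^+ d.
Proof.
move=> D0 lohi mF FD F0.
have FX y : X y -> `|F y| <= D * \1_(box lo hi) y.
  move=> Xy; rewrite indicE; have [yb|yb] := pselect (box lo hi y).
    by rewrite mem_set// mulr1; exact: FD.
  by rewrite F0// normr0 memNset// mulr0.
have mB := measurable_box lo hi.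
have i1 : lebd.-integrable X (EFin \o F).
  apply: measurable_bounded_integrable => //; exists D; split; first exact: num_real.
  move=> M DM y Xy /=; apply: le_trans (FX y Xy) _; apply: le_trans (ltW DM).
  by rewrite ler_piMr// indicE; case: (_ \in _).
split=> //; apply: le_trans (le_normr_Rintegral _ _) _ => //.
have ge : (\int[lebd]_(y in X) `|F y|%:E <= (D * rho ^+ d)%:E)%E.
  apply: (@le_trans _ _ (\int[lebd]_(y in X) (D * \1_(box lo hi) y)%:E)%E).
    apply: ge0_le_integral => //.
    - by apply/measurable_EFinP; apply: measurableT_comp.
    - by apply/measurable_EFinP; apply: measurable_funM => //; exact: measurable_indic.
  under eq_integral do rewrite EFinM.
  rewrite ge0_integralZl//; last by apply/measurable_EFinP; exact: measurable_indic.
  rewrite integral_indic// EFinM; apply: lee_wpmul2l => //.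
  apply: (@le_trans _ _ (lebd (box lo hi))).
    by apply: le_measure; rewrite ?inE//; exact: measurableI.
  rewrite [leLHS]leb_box => [|l]; last by have := lohi l; lra.
  rewrite lee_fin -[X in _ ^+ X](card_ord d) -prodr_const; apply: ler_prod => l _; exact: lohi.
rewrite -lee_fin /Rintegral fineK// ge0_fin_numE ?(le_lt_trans ge) ?ltry//.
by apply: integral_ge0 => y _; rewrite lee_fin.
Qed.

End functionals.

Section cone_interval.
Context {R : realType}.
Implicit Types x del t : R.

Definition cone_lo x del : R := Num.min (x + del / 4) (x + del).
Definition cone_hi x del : R := Num.max (x + del / 4) (x + del).

Lemma cone_itv x del t : del != 0 ->
  (cone_lo x del <= t <= cone_hi x del) = (1/4 <= (t - x) / del <= 1).
Proof.
move=> d0; rewrite /cone_lo /cone_hi; have [del0|del0] := ltP 0 del.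
  rewrite min_l ?max_r; [|lra|lra].
  rewrite ler_pdivlMr// ler_pdivrMr//; apply/idP/idP; lra.
have {}del0 : del < 0 by rewrite lt_neqAle d0.
rewrite min_r ?max_l; [|lra|lra].
rewrite ler_ndivlMr// ler_ndivrMr//; apply/idP/idP; lra.
Qed.

Lemma cone_width x del : 0 <= cone_hi x del - cone_lo x del <= `|del|.
Proof.
rewrite /cone_lo /cone_hi; have [del0|del0] := leP 0 del.
  by rewrite min_l ?max_r ?ger0_norm//; lra.
by rewrite min_r ?max_l ?ltr0_norm//; lra.
Qed.

End cone_interval.

Lemma tens_box0 {R : realType} {d : nat} (w : 'I_d -> R -> R) lo hi y :
  (forall l t, ~ (lo l <= t <= hi l) -> w l t = 0) -> ~ box lo hi y -> tens w y = 0.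
Proof.
move=> w0 /existsNP[l hl]; rewrite /tens (bigD1 l)//= w0 ?mul0r//.
Qed.

Section sup_bound.
Context {R : realType} {d : nat} (Omega : set 'rV[R]_d).
Let X := closure Omega.
Hypothesis Xfin : (@leb R d X < +oo)%E.
Notation lebd := (@leb R d).
Notation L2dot := (L2dot Omega).
Let mX := measurable_closure Omega.
Variable r : R.
Hypothesis r0 : 0 < r.
Notation m' := (Num.truncn r).
Notation m := (Num.truncn r).+1.

Section point.
Variables (W c : R) (x : 'rV[R]_d) (kap : 'I_d -> R).
Hypotheses (W1 : 1 <= W) (hW : forall v, `|kern m' v| <= W /\ `|ramp_gap m' v| <= W).
Hypotheses (c0 : 0 < c) (c1 : c <= 1) (hkap : forall l, c <= `|kap l| <= 1).
Hypothesis hcone : forall (rho : R) (z : 'rV[R]_d), 0 < rho <= 1 ->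
  (forall l, 1/4 <= (z ord0 l - x ord0 l) / (kap l * rho) <= 1) -> Omega z.

Let C1 : R := 3 * W / c.

Definition cone_kern (rho : R) l : R -> R := skern m' (x ord0 l) (kap l * rho).

Definition cone_test rho : 'rV[R]_d -> R := tens (cone_kern rho).

(** The functions between [cone_test] at the scale rho and at rho / 2, telescoped over the
    coordinates: those below i are at the scale rho / 2 already, those above i still at rho,
    and the coordinate i carries the primitive of order m of the difference. *)
Definition cone_gap (i : 'I_d) rho (l : 'I_d) : R -> R :=
  if (l < i)%N then cone_kern (rho / 2) l
  else if l == i then sgap m' (x ord0 l) (kap l * rho) else cone_kern rho l.

Definition multi1 (i : 'I_d) : multi d m := [ffun l => if l == i then ord_max else ord0].

Let lo rho l := cone_lo (x ord0 l) (kap l * rho).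
Let hi rho l := cone_hi (x ord0 l) (kap l * rho).

Section scale.
Variable rho : R.
Hypothesis hrho : 0 < rho <= 1.

Let rho0 : 0 < rho. Proof. by case/andP: hrho. Qed.
Let C10 : 0 < C1. Proof. by rewrite divr_gt0// mulr_gt0//; apply: lt_le_trans W1. Qed.
Let kap0 l : 0 < `|kap l|.
Proof. by have /andP[h _] := hkap l; exact: lt_le_trans h. Qed.
Let del0 l : kap l * rho != 0.
Proof. by apply: mulf_neq0; [rewrite -normr_gt0; exact: kap0|rewrite gt_eqF]. Qed.

Lemma cone_box_sub : box (lo rho) (hi rho) `<=` Omega.
Proof. by move=> z hz; apply: (hcone hrho) => l; rewrite -cone_itv//; exact: hz. Qed.

Lemma cone_box_width l : 0 <= hi rho l - lo rho l <= rho.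
Proof.
have /andP[-> h] := cone_width (x ord0 l) (kap l * rho); apply: le_trans h _.
by rewrite normrM (gtr0_norm rho0) ler_piMl ?(ltW rho0)//; have /andP[] := hkap l.
Qed.

Lemma cone_kern_le l t : `|cone_kern rho l t| <= C1 / 3 / rho.
Proof.
rewrite /cone_kern /skern normrM normfV normrM (gtr0_norm rho0).
have -> : C1 / 3 / rho = (c * rho)^-1 * W by rewrite /C1; field; rewrite !gt_eqF.
apply: ler_pM => //; [by rewrite invr_ge0 mulr_ge0// ltW| |by have [] := hW (
   (kap l * rho)^-1 * t - x ord0 l / (kap l * rho))].
rewrite lef_pV2 ?posrE ?mulr_gt0// ler_pM2r//.
by have /andP[] := hkap l.
Qed.

Lemma cone_kern_supp l t : ~ (lo rho l <= t <= hi rho l) -> cone_kern rho l t = 0.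
Proof.
by rewrite /lo /hi cone_itv// => h; apply: skern_supp => h'; apply: h; lra.
Qed.

Lemma cone_kern_half_supp l t : ~ (lo rho l <= t <= hi rho l) -> cone_kern (rho / 2) l t = 0.
Proof.
rewrite /lo /hi cone_itv// => h; apply: skern_supp => h'; apply: h.
move: h'; have -> : (t - x ord0 l) / (kap l * (rho / 2)) = 2 * ((t - x ord0 l) / (kap l * rho)).
  have := del0 l; rewrite mulf_eq0 negb_or => /andP[k0 _].
  by field; rewrite k0 gt_eqF.
lra.
Qed.

Lemma smooth1_cone_kern l rho' : smooth1 (cone_kern rho' l).
Proof. exact: smooth1_skern. Qed.

Lemma smooth1_cone_gap i l : smooth1 (cone_gap i rho l).
Proof.
rewrite /cone_gap; case: ifP => _; first exact: smooth1_cone_kern.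
by case: ifP => _; [exact: smooth1_sgap|exact: smooth1_cone_kern].
Qed.

Lemma cone_gap_supp i l t : ~ (lo rho l <= t <= hi rho l) -> cone_gap i rho l t = 0.
Proof.
move=> h; rewrite /cone_gap; case: ifP => _; first exact: cone_kern_half_supp.
case: ifP => _; last exact: cone_kern_supp.
by apply: sgap_supp => h'; apply: h; rewrite /lo /hi cone_itv.
Qed.

Definition cone_diff (i l : 'I_d) : R -> R :=
  if (l < i)%N then cone_kern (rho / 2) l
  else if l == i then cone_kern rho l - cone_kern (rho / 2) l else cone_kern rho l.

Lemma mpartial_cone_gap i : mpartial (multi1 i) (tens (cone_gap i rho)) = tens (cone_diff i).
Proof.
rewrite mpartial_tens => [|l]; last exact: smooth1_cone_gap.
congr tens; apply/funext => l; rewrite ffunE /cone_gap /cone_diff.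
have [->|il] := eqVneq l i; last by case: ifP.
by rewrite ltnn [LHS](derive1n_sgap m' _ (del0 i)) /cone_kern mulrA.
Qed.

Lemma cone_test_telescope :
  cone_test rho - cone_test (rho / 2) = \sum_i mpartial (multi1 i) (tens (cone_gap i rho)).
Proof.
apply/funext => y; rewrite fct_sumE -[LHS]/(cone_test rho y - cone_test (rho / 2) y).
rewrite /cone_test /tens prod_telescope; apply: eq_bigr => i _.
rewrite mpartial_cone_gap; apply: eq_bigr => l _; rewrite /cone_diff.
by case: ifP => // _; case: ifP.
Qed.

Lemma cone_kern_half_le l t : `|cone_kern (rho / 2) l t| <= 2 * C1 / 3 / rho.
Proof.
rewrite /cone_kern /skern normrM normfV normrM normrM (gtr0_norm rho0) normfV normr_nat.
have -> : 2 * C1 / 3 / rho = (c * (rho / 2))^-1 * W by rewrite /C1; field; rewrite !gt_eqF.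
apply: ler_pM => //; [by rewrite invr_ge0 mulr_ge0// divr_ge0// ltW| |by have [] := hW (
   (kap l * (rho / 2))^-1 * t - x ord0 l / (kap l * (rho / 2)))].
rewrite lef_pV2 ?posrE ?mulr_gt0// ?divr_gt0// ler_pM2r ?divr_gt0//.
by have /andP[] := hkap l.
Qed.

Let C1r0 : 0 <= C1 / rho. Proof. by rewrite divr_ge0 ?ltW. Qed.

Lemma cone_diff_le i y : `|tens (cone_diff i) y| <= (C1 / rho) ^+ d.
Proof.
rewrite /tens normr_prod -[X in _ ^+ X](card_ord d) -prodr_const; apply: ler_prod => l _.
rewrite normr_ge0/=; have a := cone_kern_le l (y ord0 l); have b := cone_kern_half_le l (y ord0 l).
have e1 : C1 / 3 / rho = (C1 / rho) / 3 by ring.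
have e2 : 2 * C1 / 3 / rho = 2 * ((C1 / rho) / 3) by ring.
have z0 := C1r0; rewrite e1 in a; rewrite e2 in b; rewrite /cone_diff; case: ifP => _; first lra.
case: ifP => _; last lra.
by apply: le_trans (ler_normB _ _) _; lra.
Qed.

Lemma cone_gap_le i y : `|tens (cone_gap i rho) y| <= rho ^+ m * (C1 / rho) ^+ d.
Proof.
have -> : rho ^+ m * (C1 / rho) ^+ d = \prod_(l < d) ((if l == i then rho ^+ m else 1) * (C1 / rho)).
  rewrite big_split/= prodr_const card_ord; congr (_ * _).
  by rewrite (bigD1 i)//= eqxx big1 ?mulr1// => l /negPf ->.
rewrite /tens normr_prod; apply: ler_prod => l _.
rewrite normr_ge0/=; have a := cone_kern_le l (y ord0 l); have b := cone_kern_half_le l (y ord0 l).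
have e1 : C1 / 3 / rho = (C1 / rho) / 3 by ring.
have e2 : 2 * C1 / 3 / rho = 2 * ((C1 / rho) / 3) by ring.
have z0 := C1r0; rewrite e1 in a; rewrite e2 in b; rewrite /cone_gap; have [->|il] := eqVneq l i; last first.
  by rewrite mul1r; case: ifP => _; lra.
have [_ hg] := hW ((kap i * rho)^-1 * y ord0 i + - (x ord0 i / (kap i * rho))).
rewrite ltnn /sgap normrM exprS.
have -> : rho * rho ^+ m' * (C1 / rho) = rho ^+ m' * C1 by field; rewrite gt_eqF.
have WC : W <= C1 by rewrite /C1 ler_pdivlMr// mulrC; apply: ler_wpM2r; move: W1 c1; lra.
apply: ler_pM => //; last exact: le_trans WC.
rewrite normrX normrM (gtr0_norm rho0); apply: lerXn2r; rewrite ?nnegrE ?mulr_ge0 ?(ltW rho0)//.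
by rewrite ler_piMl ?(ltW rho0)//; have /andP[] := hkap i.
Qed.

Lemma cone_test_le y : `|cone_test rho y| <= (C1 / rho) ^+ d.
Proof.
rewrite /cone_test /tens normr_prod -[X in _ ^+ X](card_ord d) -prodr_const; apply: ler_prod => l _.
rewrite normr_ge0/=; have a := cone_kern_le l (y ord0 l).
have e1 : C1 / 3 / rho = (C1 / rho) / 3 by ring.
have z0 := C1r0; rewrite e1 in a; lra.
Qed.

Lemma cone_test_fun i : test_fun Omega (tens (cone_gap i rho)).
Proof.
by apply: test_fun_tens cone_box_sub => [l|l t]; [exact: smooth1_cone_gap|exact: cone_gap_supp].
Qed.

Lemma test_fun_cone_test : test_fun Omega (cone_test rho).
Proof.
by apply: test_fun_tens cone_box_sub => [l|l t]; [exact: smooth1_cone_kern|exact: cone_kern_supp].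
Qed.

Lemma L2dot_tens_le (w : 'I_d -> R -> R) P : 0 <= P -> (forall l, smooth1 (w l)) ->
  (forall l t, ~ (lo rho l <= t <= hi rho l) -> w l t = 0) -> (forall y, `|tens w y| <= P) ->
  L2dot (tens w) (tens w) <= P ^+ 2 * rho ^+ d.
Proof.
move=> P0 sw w0 wP; apply: le_trans (ler_norm _) _.
have mw : measurable_fun X (tens w).
  apply: measurable_funTS; apply: measurable_tens => l.
  by apply: continuous_measurable_fun; exact: smooth1_continuous.
have [] := @Rintegral_box_le _ _ Omega Xfin (fun y => tens w y * tens w y) (P ^+ 2) rho (lo rho) (hi rho) => //.
- by rewrite exprn_ge0.
- exact: cone_box_width.
- exact: measurable_funM.
- by move=> y _ _; rewrite normrM -expr2 lerXn2r ?nnegrE.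
- by move=> y _ yb; rewrite (tens_box0 w0 yb) mul0r.
Qed.

Lemma cone_test_mass : 1 <= `|\int[lebd]_(y in X) cone_test rho y|.
Proof.
have d1 l : `|kap l * rho| <= 1.
  have /andP[_ h] := hkap l; case/andP: hrho => _ h'.
  by rewrite normrM (gtr0_norm rho0) mulr_ile1// ltW.
have I l := integral_skern m' (x ord0 l) (del0 l) (d1 l).
have [_ E] := @integral_leb_tens R d (cone_kern rho) (fun l => (I l).1).
have -> : \int[lebd]_(y in X) cone_test rho y =
    \prod_(l < d) \int[lebesgue_measure]_t cone_kern rho l t.
  rewrite /Rintegral -[RHS]/(fine (\prod_(l < d) \int[lebesgue_measure]_t cone_kern rho l t)%:E).
  congr fine; rewrite -prodEFin [LHS]integral_mkcond.
  rewrite (eq_integral (fun y => (tens (cone_kern rho) y)%:E)); last first.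
    move=> y _; rewrite patchE; case: ifPn => // /negP yX.
    rewrite [in RHS](tens_box0 (@cone_kern_supp))// => yb; apply: yX; apply/mem_set.
    exact/subset_closure/cone_box_sub.
  rewrite E; apply: eq_bigr => l _; rewrite /Rintegral fineK//.
  by apply: integrable_fin_num => //; exact: (I l).1.
rewrite normr_prod; apply: (big_ind (fun v : R => 1 <= v)) => // [a b|l _].
  exact: mulr_ege1.
by rewrite (I l).2 ler1n fact_gt0.
Qed.

Lemma cone_test_limit f (eps : R) : L2 Omega f -> 0 <= eps ->
  (forall y, box (lo rho) (hi rho) y -> `|f y - f x| <= eps) ->
  `|f x| <= `|L2dot f (cone_test rho)| + eps * C1 ^+ d.
Proof.
move=> Lf eps0 feps.
have Lx : L2 Omega (cst (f x)).
  by have [] := @L2_bounded _ _ Omega Xfin (cst (f x)) `|f x|.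
have Lc : L2 Omega (cone_test rho) by exact: test_fun_L2 test_fun_cone_test.
have ic : lebd.-integrable X (EFin \o cone_test rho).
  have L1 : L2 Omega (cst 1) by have [] := @L2_bounded _ _ Omega Xfin (cst 1) 1 => // y _; rewrite normr1.
  by have := L2_integrableM L1 Lc; apply: eq_integrable => // y _ /=; rewrite mul1r.
have E : L2dot (cst (f x)) (cone_test rho) = f x * \int[lebd]_(y in X) cone_test rho y.
  by rewrite -RintegralZl.
have D : `|L2dot (f - cst (f x)) (cone_test rho)| <= eps * C1 ^+ d.
  have mF : measurable_fun X (fun y => (f - cst (f x)) y * cone_test rho y).
    by apply: measurable_funM; [exact: (L2B Lf Lx).1|exact: Lc.1].
  have [] := @Rintegral_box_le _ _ Omega Xfin _ (eps * (C1 / rho) ^+ d) rho (lo rho) (hi rho) _ _ mF.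
  - by rewrite mulr_ge0// exprn_ge0.
  - exact: cone_box_width.
  - by move=> y _ yb; rewrite normrM; apply: ler_pM => //; [exact: feps|exact: cone_test_le].
  - by move=> y _ yb; rewrite /cone_test (tens_box0 (@cone_kern_supp) yb) mulr0.
  by move=> _; rewrite -mulrA -exprMn divfK ?gt_eqF.
have := cone_test_mass; rewrite (L2dotBl Lf Lx Lc) E in D; move: D.
move: (L2dot f _) (f x) (\int[lebd]_(y in X) _) => a b I D I1.
have : `|b| <= `|b * I| by rewrite normrM ler_peMr.
have : `|b * I| <= `|a| + `|a - b * I|.
  by have := ler_normB a (a - b * I); rewrite opprB addrC subrK.
lra.
Qed.

Lemma msize_multi1 i : msize (multi1 i) = m.
Proof.
by rewrite /msize (bigD1 i)//= ffunE eqxx big1 ?addn0// => l /negPf il; rewrite ffunE il.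
Qed.

(** The function [cone_gap] is of size rho^m (C1 / rho)^d, its derivative of order m of size
    (C1 / rho)^d, both on a box of side rho; so [test_functional] applies at t = rho^m, and
    [Ksq_le_Hsq] contributes the factor t^(2 r / m) = rho^(2 r). *)
Lemma cone_step f i : HrRKHS Omega r f ->
  L2dot f (mpartial (multi1 i) (tens (cone_gap i rho))) ^+ 2 <=
  16 * C1 ^+ d ^+ 2 * (rho `^ (2 * r) / rho ^+ d) * Hn Omega r f.
Proof.
move=> Hf; have [Lf _ _] := Hf; pose E := (C1 / rho) ^+ d ^+ 2 * rho ^+ d.
have t0 : 0 < rho ^+ m by rewrite exprn_gt0.
have P0 : 0 <= (C1 / rho) ^+ d by rewrite exprn_ge0.
have E0 : 0 < E by rewrite mulr_gt0 ?exprn_gt0// divr_gt0.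
have h1 : L2dot (mpartial (multi1 i) (tens (cone_gap i rho))) (mpartial (multi1 i) (tens (cone_gap i rho))) <= E.
  rewrite mpartial_cone_gap; apply: L2dot_tens_le => //.
  - move=> l; rewrite /cone_diff; case: ifP => _; first exact: smooth1_cone_kern.
    case: ifP => _; last exact: smooth1_cone_kern.
    by apply: smooth1D; [|apply: smooth1N]; exact: smooth1_cone_kern.
  - move=> l t h; rewrite /cone_diff; case: ifP => _; first exact: cone_kern_half_supp.
    case: ifP => _; last exact: cone_kern_supp.
    by rewrite -[LHS]/(cone_kern rho l t - cone_kern (rho / 2) l t) cone_kern_supp// cone_kern_half_supp// subr0.
  - exact: cone_diff_le.
have h2 : L2dot (tens (cone_gap i rho)) (tens (cone_gap i rho)) <= (rho ^+ m) ^+ 2 * E.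
  rewrite /E mulrA -exprMn; apply: L2dot_tens_le => //.
  - by rewrite mulr_ge0// ltW.
  - by move=> l; exact: smooth1_cone_gap.
  - by move=> l t; exact: cone_gap_supp.
  - exact: cone_gap_le.
have := test_functional Xfin _ t0 E0 Lf (cone_test_fun i) h1 h2.
rewrite msize_multi1 => /(_ (leqnn _)) le1.
have := Ksq_le_Hsq Xfin r0 t0 Lf => /(lee_wpmul2l (_ : (0 <= (2 * E)%:E)%E)) => le2.
have {}le2 := le2 _; have E2 : (0 <= (2 * E)%:E)%E by rewrite lee_fin mulr_ge0// ltW.
have := le_trans le1 (le2 E2); rewrite (Hn_E Hf) -!EFinM lee_fin => /le_trans; apply.
have -> : (rho ^+ m) `^ (2 * (r / m%:R)) = rho `^ (2 * r).
  rewrite -(powR_mulrn m (ltW rho0)) -powRrM; congr (_ `^ _); field.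
  by rewrite gt_eqF// ltr0n.
rewrite le_eqVlt; apply/orP; left; apply/eqP; rewrite /E (expr_div_n C1 rho d).
have : rho ^+ d != 0 by rewrite expf_neq0// gt_eqF.
by move: (rho ^+ d) (C1 ^+ d) (rho `^ _) (Hn _ _ _) => p q z v p0; field.
Qed.

End scale.

Lemma cone_step0 f : HrRKHS Omega r f ->
  L2dot f (cone_test 1) ^+ 2 <= 16 * C1 ^+ d ^+ 2 * Hn Omega r f.
Proof.
move=> Hf; have [Lf _ _] := Hf.
have h1 : 0 < (1 : R) <= 1 by rewrite ltr01 lexx.
have C10 : 0 < C1 by rewrite divr_gt0// mulr_gt0//; apply: lt_le_trans W1.
pose E := C1 ^+ d ^+ 2; have E0 : 0 < E by rewrite !exprn_gt0.
pose al : multi d m := [ffun=> ord0].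
have mp : mpartial al (cone_test 1) = cone_test 1.
  rewrite /cone_test mpartial_tens => [|l]; last exact: smooth1_cone_kern.
  by congr tens; apply/funext => l; rewrite ffunE.
have h2 : L2dot (cone_test 1) (cone_test 1) <= E.
  have -> : E = (C1 / 1) ^+ d ^+ 2 * 1 ^+ d by rewrite divr1 expr1n mulr1.
  apply: L2dot_tens_le => //.
  - by rewrite exprn_ge0// divr1 ltW.
  - by move=> l; exact: smooth1_cone_kern.
  - by move=> l t; exact: cone_kern_supp.
  - exact: cone_test_le.
have sal : (msize al <= m)%N by rewrite /msize big1// => l _; rewrite ffunE.
have := test_functional Xfin sal ltr01 E0 Lf (test_fun_cone_test h1).
rewrite mp expr1n mul1r => /(_ h2 h2) le1.
have E2 : (0 <= (2 * E)%:E)%E by rewrite lee_fin mulr_ge0// ltW.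
have le2 := lee_wpmul2l E2 (Ksq_le_Hsq Xfin r0 ltr01 Lf).
have := le_trans le1 le2; rewrite powR1 mulr1 (Hn_E Hf) -!EFinM lee_fin => /le_trans; apply.
by rewrite le_eqVlt; apply/orP; left; apply/eqP; rewrite /E; ring.
Qed.

End point.

Lemma geometric_telescope (F : nat -> R) (S g : R) : 0 <= S -> 0 <= g < 1 ->
  (forall j, `|F j - F j.+1| <= S * g ^+ j) -> forall j, `|F j| <= `|F 0%N| + S / (1 - g).
Proof.
move=> S0 /andP[g0 g1] hF j.
have q0 : 0 < 1 - g by lra.
suff : `|F j| <= `|F 0%N| + S * (1 - g ^+ j) / (1 - g).
  move=> /le_trans; apply; rewrite lerD2l ler_pM2r ?invr_gt0// ler_piMr//.
  by have := exprn_ge0 j g0; lra.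
elim: j => [|j ih]; first by rewrite expr0 subrr mulr0 mul0r addr0.
have -> : F j.+1 = F j - (F j - F j.+1) by ring.
apply: le_trans (ler_normB _ _) _; apply: le_trans (lerD ih (hF j)) _.
rewrite -addrA lerD2l le_eqVlt; apply/orP; left; apply/eqP; rewrite exprS.
by field; rewrite gt_eqF.
Qed.

Hypothesis hr : d%:R / 2 < r.
Hypothesis hOmega : smooth_bounded_domain Omega.

(** Tested at the scales 2^-j of its cone, f yields numbers that converge to a multiple of
    f(x) of modulus at least |f(x)| by continuity; successive differences are at most d S
    g^j, where g^2 = 2^(d - 2 r) is less than 1. Points of the boundary are limits of points
    of Omega. *)
Lemma sup_bound : exists2 K, 0 < K & forall f x, HrRKHS Omega r f -> X x ->
  f x ^+ 2 <= K * Hn Omega r f.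
Proof.
have [c /andP[c0 c1] cone] := uniform_cone hOmega.
have [W W1 hW] := @kern_bounded R m'.
pose C1 := 3 * W / c; have C10 : 0 < C1 by rewrite divr_gt0// mulr_gt0//; apply: lt_le_trans W1.
have dle : d%:R < 2 * r by move: hr; rewrite ltr_pdivrMr// mulrC.
have h2d : 0 < 2 ^+ d :> R by rewrite exprn_gt0.
pose q : R := 2^-1 `^ (2 * r) / 2^-1 ^+ d.
have half0 : 0 < 2^-1 :> R by rewrite invr_gt0.
have q0 : 0 < q by rewrite divr_gt0 ?powR_gt0 ?exprn_gt0.
have q1 : q < 1.
  rewrite /q ltr_pdivrMr ?exprn_gt0// mul1r -(powR_mulrn d (ltW half0)).
  have e0 : 0 < 2 * r - d%:R by lra.
  rewrite (_ : 2 * r = d%:R + (2 * r - d%:R)); last ring.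
  rewrite powRD ?(gt_eqF half0) ?implybT// gtr_pMr ?powR_gt0//.
  rewrite [ltRHS](_ : 1 = 1 `^ (2 * r - d%:R)); last by rewrite powR1.
  by apply: gt0_ltr_powR; rewrite ?nnegrE ?(ltW half0)// invf_lt1// ltr1n.
pose g := Num.sqrt q.
have gq : g ^+ 2 = q by rewrite sqr_sqrtr// ltW.
have g0 : 0 <= g by exact: sqrtr_ge0.
have g1 : g < 1.
  by rewrite ltNge; apply/negP => h; move: (exprn_ege1 2 h); rewrite gq; lra.
pose A := 16 * C1 ^+ d ^+ 2.
have A0 : 0 < A by rewrite mulr_gt0// !exprn_gt0.
pose L := 1 + d%:R / (1 - g).
have L1 : 1 <= L by rewrite lerDl divr_ge0//; lra.
(* A times the squared norm of f bounds the square of the test at the scale 1, and L sums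
   the geometric series of the differences. *)
exists (A * L ^+ 2); first by rewrite mulr_gt0// exprn_gt0//; lra.
suff H f x : HrRKHS Omega r f -> Omega x -> f x ^+ 2 <= A * L ^+ 2 * Hn Omega r f.
  move=> f x Hf Xx; rewrite leNgt; apply/negP => hx.
  have [_ cf _] := Hf.
  have cf2 : {within X, continuous (fun y => f y ^+ 2)}.
    by move=> y; apply: (continuousM (cf y) (cf y)).
  have nx : \forall y \near within X (nbhs x), A * L ^+ 2 * Hn Omega r f < f y ^+ 2.
    have /subspace_continuousP/(_ x Xx) cx := cf2.
    exact: (cvgr_gt _ cx _ hx).
  have [y [Oy hy]] := Xx _ nx.
  have := H f y Hf Oy; rewrite leNgt => /negP; apply.
  by apply: hy; exact: subset_closure.
move=> Hf Ox; have [Lf cf _] := Hf.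
have [kap hkap hcone] := cone x Ox.
have Hn0 : 0 <= Hn Omega r f by exact: Hn_ge0.
pose S := Num.sqrt (A * Hn Omega r f).
have S2 : S ^+ 2 = A * Hn Omega r f by rewrite sqr_sqrtr// mulr_ge0// ltW.
have S0 : 0 <= S by exact: sqrtr_ge0.
have rho01 j : 0 < (2^-1 : R) ^+ j <= 1.
  by rewrite exprn_gt0// exprn_ile1 ?ltW// invf_lt1// ltr1n.
pose F j := L2dot f (cone_test x kap (2^-1 ^+ j)).
have step j : `|F j - F j.+1| <= d%:R * S * g ^+ j.
  have Lct rho' : 0 < rho' <= 1 -> L2 Omega (cone_test x kap rho').
    by move=> h; apply: (test_fun_L2 Xfin); exact: (test_fun_cone_test c0 hkap hcone h).
  have tel := cone_test_telescope x c0 hkap (rho01 j).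
  have -> : F j - F j.+1 = L2dot f (cone_test x kap (2^-1 ^+ j) - cone_test x kap (2^-1 ^+ j / 2)).
    rewrite L2dotC L2dotBl//; [|exact: Lct|by rewrite -exprSr; exact: Lct].
    by rewrite !(L2dotC Omega _ f) -exprSr.
  have Lmp i : L2 Omega (mpartial (multi1 i) (tens (cone_gap x kap i (2^-1 ^+ j)))).
    by apply: (test_fun_L2 Xfin); apply: test_fun_mpartial; exact: (cone_test_fun c0 hkap hcone (rho01 j)).
  rewrite tel L2dotC.
  rewrite (eq_bigr (fun i => 1 *: mpartial (multi1 i) (tens (cone_gap x kap i (2^-1 ^+ j))))); last first.
    by move=> i _; rewrite scale1r.
  rewrite L2dot_suml//; apply: le_trans (ler_norm_sum _ _ _) _.
  have -> : d%:R * S * g ^+ j = \sum_(i < d) S * g ^+ j.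
    by rewrite sumr_const card_ord -mulrA mulr_natl.
  apply: ler_sum => i _; rewrite mul1r L2dotC.
  rewrite -ler_sqr ?nnegrE ?mulr_ge0 ?exprn_ge0// real_normK ?num_real//.
  have := cone_step W1 hW c0 c1 hkap hcone (rho01 j) i Hf.
  move=> /le_trans; apply; rewrite -/C1 -/A exprMn S2 mulrAC.
  rewrite -[X in _ <= _ * X]exprM mulnC exprM gq /q expr_div_n.
  have -> : (2^-1 ^+ j) `^ (2 * r) = (2^-1 `^ (2 * r)) ^+ j.
    by rewrite -(powR_mulrn j (ltW half0)) -powRrM mulrC (powRrM _ (2 * r)) powR_mulrn ?powR_ge0.
  by rewrite -!exprM (mulnC d).
have F0 : `|F 0%N| <= S.
  rewrite -ler_sqr ?nnegrE// real_normK ?num_real// S2 /F expr0.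
  exact: (cone_step0 W1 hW c0 hkap hcone Hf).
have Fb j : `|F j| <= S * L.
  have dS : 0 <= d%:R * S by rewrite mulr_ge0.
  have g01 : 0 <= g < 1 by rewrite g0 g1.
  apply: le_trans (geometric_telescope dS g01 step j) _.
  by rewrite /L mulrDr mulr1; apply: lerD => //; rewrite mulrA (mulrC S).
have fx : `|f x| <= S * L.
  apply/ler_addgt0Pr => e e0.
  have C1d : 0 < C1 ^+ d by rewrite exprn_gt0.
  pose eps := e / C1 ^+ d; have eps0 : 0 < eps by rewrite divr_gt0.
  have [_ oO _ _ _] := hOmega.
  have nx : \forall y \near x, `|f y - f x| <= eps.
    have cx : f y @[y --> x] --> f x.
      have nO : nbhs x Omega by exact: open_nbhs_nbhs.
      have /subspace_continuousP/(_ x (subset_closure Ox)) cx := cf; move=> P /cx.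
      by rewrite /= /within/=; apply: filterS2 nO => y Oy; apply; exact: subset_closure.
    by apply: cvgr_distC_le cx _ eps0.
  have [e1 e10 he1] := (nbhs_ballP _ _).1 nx.
  have [j hj] : exists j, (2^-1 : R) ^+ j < e1.
    exists (Num.truncn e1^-1).+1; rewrite exprVn invf_plt ?posrE ?exprn_gt0//.
    apply: (lt_le_trans (truncnS_gt _)); rewrite -natrX ler_nat ltnW//.
    exact: ltn_expl.
  have box_e y : box (fun l => cone_lo (x ord0 l) (kap l * 2^-1 ^+ j))
      (fun l => cone_hi (x ord0 l) (kap l * 2^-1 ^+ j)) y -> `|f y - f x| <= eps.
    move=> hy; apply: he1; apply/ball_rV => // l.
    have kl : kap l != 0.
      by have /andP[h _] := hkap l; rewrite -normr_gt0; exact: lt_le_trans h.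
    have kr : kap l * 2^-1 ^+ j != 0 by rewrite mulf_neq0// gt_eqF ?exprn_gt0.
    have := hy l; rewrite cone_itv// => /(cone_coord kl (rho01 j)) [h _].
    rewrite distrC; apply: le_lt_trans h _; apply: le_lt_trans hj.
    have /andP[_ k1] := hkap l; by rewrite ler_piMl ?exprn_ge0 ?(ltW half0).
  have := cone_test_limit W1 hW c0 hkap hcone (rho01 j) Lf (ltW eps0) box_e.
  by rewrite -/C1 /eps divfK ?gt_eqF// => /le_trans; apply; rewrite lerD2r; exact: Fb.
have -> : A * L ^+ 2 * Hn Omega r f = (S * L) ^+ 2 by rewrite exprMn S2; ring.
rewrite -(real_normK (num_real (f x))); apply: lerXn2r; rewrite ?nnegrE//.
by rewrite mulr_ge0//; lra.
Qed.

End sup_bound.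

(** * From point values to integrals by sampling *)

Section uniform.
Context d (T : measurableType d) (R : realType) (mu : {measure set T -> \bar R}) (A : set T).
Hypotheses (mA : measurable A) (A0 : (0 < mu A)%E) (Afin : (mu A < +oo)%E).
Let v := fine (mu A).
Local Open Scope ereal_scope.

Let vE : mu A = v%:E. Proof. by rewrite fineK// ge0_fin_numE. Qed.
Let v0 : (0 < v)%R. Proof. by rewrite -lte_fin -vE. Qed.

Lemma uniform_probability : exists U : probability T R, forall F : T -> \bar R,
  measurable_fun setT F -> (forall x, 0 <= F x) ->
  \int[U]_x F x = (v^-1)%:E * \int[mu]_(x in A) F x.
Proof.
pose L x := (v^-1 * \1_A x)%R.
have mI : measurable_fun setT (\1_A : T -> R) by exact: measurable_indic.
have mL : measurable_fun setT L by apply: measurable_funM.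
have L0 x : (0 <= L x)%R by rewrite mulr_ge0// invr_ge0 ltW.
have LF F : measurable_fun setT F -> (forall x, 0 <= F x) ->
    \int[mu]_x (F x * (L x)%:E) = (v^-1)%:E * \int[mu]_(x in A) F x.
  move=> mF F0; rewrite [in RHS]integral_mkcond -ge0_integralZl//.
  - apply: eq_integral => x _; rewrite patchE /L indicE; case: ifPn => _.
      by rewrite mulr1 muleC.
    by rewrite mulr0 !mule0.
  - exact/(measurable_restrictT _ mA)/measurable_funTS.
  - by move=> x _; rewrite patchE; case: ifP.
  - by rewrite lee_fin invr_ge0 ltW.
have L1 : \int[mu]_x (L x)%:E = 1.
  have := LF (cst 1) (measurable_cst _) (fun=> lee01).
  under eq_integral do rewrite mul1e.
  by move=> ->; rewrite integral_cst// mul1e vE -EFinM mulVf ?gt_eqF.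
have [U hU] := density_probability mL L0 L1.
by exists U => F mF F0; rewrite (ge0_integral_density mL L0 hU)// LF.
Qed.

Variable U : probability T R.
Hypothesis hU : forall F : T -> \bar R, measurable_fun setT F -> (forall x, 0 <= F x) ->
  \int[U]_x F x = (v^-1)%:E * \int[mu]_(x in A) F x.

Let restrictE (F : T -> R) x : (EFin \o F \_ A) x = ((EFin \o F) \_ A) x.
Proof. by rewrite /= !patchE; case: ifP. Qed.

Lemma uniform_restrict_integral (F : T -> \bar R) : measurable_fun A F ->
  (forall x, A x -> 0 <= F x) ->
  \int[U]_x (F \_ A) x = (v^-1)%:E * \int[mu]_(x in A) F x.
Proof.
move=> mF F0; rewrite hU; first last.
- by move=> x; rewrite patchE; case: ifPn => // /set_mem; exact: F0.
- exact/(measurable_restrictT _ mA).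
by congr (_ * _); apply: eq_integral => x xA; rewrite patchE xA.
Qed.

Lemma uniform_integrable (F : T -> R) : mu.-integrable A (EFin \o F) ->
  U.-integrable setT (EFin \o (F \_ A)) /\
  \int[U]_x ((F \_ A) x)%:E = (v^-1 * \int[mu]_(x in A) F x)%:E.
Proof.
move=> iF; have mF := measurable_int _ iF.
have mP : measurable_fun A (EFin \o F)^\+ by exact: measurable_funepos.
have mN : measurable_fun A (EFin \o F)^\- by exact: measurable_funeneg.
have iP := integrable_funepos mA iF; have iN := integrable_funeneg mA iF.
have E : (fun x => ((F \_ A) x)%:E) = (EFin \o F) \_ A by apply/funext => x; exact: restrictE.
split.
  apply/integrableP; split.
    by rewrite (_ : EFin \o _ = (EFin \o F) \_ A)//; exact/(measurable_restrictT _ mA).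
  rewrite (eq_integral ((fun x => `|(F x)%:E|) \_ A)); last first.
    by move=> x _; rewrite /= !patchE; case: ifP => // _; rewrite normr0.
  rewrite uniform_restrict_integral//; last exact: measurableT_comp.
  apply: lte_mul_pinfty; rewrite ?lee_fin ?invr_ge0 ?(ltW v0)//.
  by have /integrableP[] := iF.
rewrite E integralE.
rewrite funepos_restrict funeneg_restrict !uniform_restrict_integral//.
have fP := integrable_fin_num mA iP; have fN := integrable_fin_num mA iN.
rewrite /Rintegral [in RHS]integralE -(fineK fP) -(fineK fN) /=.
by rewrite -!EFinM -EFinB mulrBr.
Qed.

End uniform.

Lemma sum_CauchySchwarz {R : realType} (I : Type) (s : seq I) (P : pred I) (a b : I -> R) :
  (\sum_(i <- s | P i) a i * b i) ^+ 2 <=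
  (\sum_(i <- s | P i) a i ^+ 2) * \sum_(i <- s | P i) b i ^+ 2.
Proof.
apply: le_discriminant; last by apply: sumr_ge0 => i _; exact: sqr_ge0.
move=> t; rewrite (_ : _ + _ = \sum_(i <- s | P i) (a i - t * b i) ^+ 2); last first.
  rewrite !mulr_sumr -sumrB -big_split/=; apply: eq_bigr => i _; ring.
by apply: sumr_ge0 => i _; exact: sqr_ge0.
Qed.

Lemma le_of_forall_natM {R : realType} (x y : R) : (forall n, n%:R * x <= y) -> x <= 0.
Proof.
move=> h; rewrite leNgt; apply/negP => x0.
have := h (Num.truncn (y / x)).+1; rewrite leNgt => /negP; apply.
by rewrite -ltr_pdivrMr// truncnS_gt.
Qed.

Lemma cvg_sumr {R : realType} (I : Type) (s : seq I) (F : I -> nat -> R) (l : I -> R) :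
  (forall i, F i n @[n --> \oo] --> l i) ->
  \sum_(i <- s) F i n @[n --> \oo] --> \sum_(i <- s) l i.
Proof.
move=> h; elim: s => [|i s ih].
  by under eq_fun do rewrite big_nil; rewrite big_nil; exact: cvg_cst.
by under eq_fun do rewrite big_cons; rewrite big_cons; apply: cvgD.
Qed.

Section sampling.
Context {R : realType} {d : nat} (Omega : set 'rV[R]_d).
Let X := closure Omega.
Hypothesis X0 : (0 < @leb R d X)%E.
Hypothesis Xfin : (@leb R d X < +oo)%E.
Notation lebd := (@leb R d).
Notation L2dot := (L2dot Omega).
Notation L2 := (L2 Omega).
Let mX := measurable_closure Omega.
Variables (r K : R) (k : 'rV[R]_d -> 'rV[R]_d -> R) (lam : nat -> R) (e : nat -> 'rV[R]_d -> R).
Hypotheses (hk : reproducing_kernel Omega r k) (hm : mercer_expansion Omega lam e k).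
Hypothesis K0 : 0 < K.
Hypothesis hK : forall f x, HrRKHS Omega r f -> X x -> f x ^+ 2 <= K * Hn Omega r f.

Lemma lam_gt0 j : 0 < lam j. Proof. by have [h _ _ _] := hm; exact: h. Qed.
Lemma e_L2 j : L2 (e j). Proof. by have [_ h _ _] := hm; exact: h. Qed.
Lemma e_orthonormal i j : L2dot (e i) (e j) = (i == j)%:R.
Proof. by have [_ _ h _] := hm; exact: h. Qed.

Lemma Hdot_diag f : HrRKHS Omega r f -> Hdot Omega r f f = Hn Omega r f.
Proof.
move=> Hf; rewrite Hdot_polar /polar.
have -> : f - f = 0 *: f by rewrite subrr scale0r.
have -> : f + f = 2 *: f by rewrite scaler_nat mulr2n.
by rewrite !(Hn_Z Xfin)//; field.
Qed.

Lemma kernel_diag_le (x : 'rV[R]_d) : X x -> k x x <= K.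
Proof.
move=> Xx; have [Hk rep] := hk Xx.
have E : Hn Omega r (k x) = k x x by rewrite -Hdot_diag// rep.
have := hK Hk Xx; rewrite E; have := Hn_ge0 Hk; rewrite E.
move: (k x x) => z z0; rewrite expr2; case: (ltP 0 z) => [z1|z1 _]; last by apply: le_trans z1 (ltW K0).
by rewrite ler_pM2r.
Qed.

Lemma eigen_sum_le N (x : 'rV[R]_d) : X x -> \sum_(j < N) lam j * e j x ^+ 2 <= K.
Proof.
move=> Xx; apply: le_trans (kernel_diag_le Xx).
have [_ _ _ h] := hm; have cv := h x x Xx Xx.
pose u N := \sum_(j < N) lam j * e j x * e j x.
have nu : nondecreasing_seq u.
  apply/nondecreasing_seqP => n; rewrite /u big_ord_recr/= lerDl -mulrA -expr2.
  by rewrite mulr_ge0 ?sqr_ge0// ltW ?lam_gt0.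
have := nondecreasing_cvgn_le nu (cvgP _ cv) N.
rewrite (cvg_lim (@Rhausdorff R) cv) => /(le_trans _); apply.
by rewrite /u; apply: ler_sum => j _; rewrite -mulrA -expr2.
Qed.

Lemma eigen_le j (x : 'rV[R]_d) : X x -> e j x ^+ 2 <= K / lam j.
Proof.
move=> Xx; rewrite ler_pdivlMr ?lam_gt0// mulrC.
apply: le_trans (eigen_sum_le j.+1 Xx); rewrite big_ord_recr/= lerDr.
by apply: sumr_ge0 => i _; rewrite mulr_ge0 ?sqr_ge0// ltW ?lam_gt0.
Qed.

Lemma L2M_bounded (b f : 'rV[R]_d -> R) (M : R) : L2 b -> measurable_fun X f -> (forall x, X x -> f x ^+ 2 <= M) -> L2 (b * f).
Proof.
move=> Lb mf fM; split; first by apply: measurable_funM => //; exact: Lb.1.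
have [x0|nX] := pselect (exists x, X x); last first.
  rewrite /L2sq (_ : closure Omega = set0) ?integral_set0//.
  by rewrite -subset0 => x Xx; apply: nX; exists x.
have M0 : 0 <= M by have [x Xx] := x0; apply: le_trans (fM x Xx); exact: sqr_ge0.
apply: (@le_lt_trans _ _ (\int[lebd]_(x in X) (M%:E * (b x ^+ 2)%:E))%E).
  apply: ge0_le_integral => //.
  - by move=> x _; rewrite lee_fin sqr_ge0.
  - by apply/measurable_EFinP/measurable_funX/measurable_funM => //; exact: Lb.1.
  - by apply: emeasurable_funM => //; apply/measurable_EFinP/measurable_funX; exact: Lb.1.
  - move=> x Xx; rewrite -EFinM lee_fin -[(b * f) x]/(b x * f x) exprMn mulrC.
    by rewrite ler_wpM2r ?sqr_ge0//; exact: fM.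
rewrite ge0_integralZl//; last 2 first.
- by apply/measurable_EFinP/measurable_funX; exact: Lb.1.
- by move=> x _; rewrite lee_fin sqr_ge0.
by apply: lte_mul_pinfty => //; exact: Lb.2.
Qed.

(** The Mercer expansion on the diagonal is at most K; integrate it against b^2. *)
Lemma weighted_eigen_sum_le b N : L2 b ->
  \sum_(j < N) lam j * L2dot (b * e j) (b * e j) <= K * L2dot b b.
Proof.
move=> Lb; have Lbe j : L2 (b * e j) by apply: L2M_bounded (eigen_le j) => //; exact: (e_L2 j).1.
have Lb2 := L2_integrable_sq Lb.
have mbe j : measurable_fun X (fun x => ((b * e j) x ^+ 2)%:E).
  by apply/measurable_EFinP/measurable_funX; exact: (Lbe j).1.
rewrite -lee_fin EFinM -(L2sqE Lb) -sumEFin.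
rewrite (eq_bigr (fun j : 'I_N => \int[lebd]_(x in X) (lam j * (b * e j) x ^+ 2)%:E)%E); last first.
  move=> j _; rewrite EFinM -(L2sqE (Lbe j)) /Defs.L2sq -ge0_integralZl//.
  - by move=> x _; rewrite lee_fin sqr_ge0.
  - by rewrite lee_fin ltW ?lam_gt0.
have mb2 : measurable_fun X (fun x => (b x ^+ 2)%:E : \bar R).
  by apply/measurable_EFinP/measurable_funX; exact: Lb.1.
have ge0 j x : (0 <= (lam j * (b * e j) x ^+ 2)%:E)%E.
  by rewrite lee_fin mulr_ge0 ?sqr_ge0// ltW ?lam_gt0.
have ms j : measurable_fun X (fun x => (lam j * (b * e j) x ^+ 2)%:E).
  by apply/measurable_EFinP/measurable_funM => //; apply/measurable_funX; exact: (Lbe j).1.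
rewrite -ge0_integral_sum// /Defs.L2sq -ge0_integralZl//; last 2 first.
- by move=> x _; rewrite lee_fin sqr_ge0.
- by rewrite lee_fin ltW.
apply: ge0_le_integral => //.
- by move=> x _; apply: sume_ge0.
- by apply: emeasurable_sum.
- exact: emeasurable_funM.
move=> x Xx; rewrite sumEFin -EFinM lee_fin mulrC.
rewrite (eq_bigr (fun j : 'I_N => b x ^+ 2 * (lam j * e j x ^+ 2))).
  by rewrite -mulr_sumr ler_wpM2l ?sqr_ge0// eigen_sum_le.
by move=> j _; rewrite -[(b * e j) x]/(b x * e j x) exprMn; ring.
Qed.

Section bound.
Variables (b f : 'rV[R]_d -> R) (Q : R).
Hypotheses (Lb : L2 b) (Hf : HrRKHS Omega r f).
Hypothesis hQ : forall N, \sum_(j < N) lam j * L2dot b (e j) ^+ 2 <= Q.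

Let v := fine (lebd X).
Let vE : lebd X = v%:E. Proof. by rewrite fineK// ge0_fin_numE. Qed.
Let v0 : 0 < v. Proof. by rewrite -lte_fin -vE. Qed.

(** The discrete inequality at n uniform random points, with the values of b as weights, is
    averaged. The left side has the mean n^2 <b, f>^2 / v^2 + O(n), and the kernel energy,
    expanded along the eigenfunctions, n^2 Q / v^2 + O(n), where the terms on the diagonal
    are bounded by [weighted_eigen_sum_le]. Letting n grow leaves the terms in n^2. *)
Lemma L2dot_reproducing : L2dot b f ^+ 2 <= Hn Omega r f * Q.
Proof.
have [U hU] := uniform_probability mX X0 Xfin.
have [Lf _ _] := Hf.
have Lbf : L2 (b * f) by apply: (L2M_bounded Lb Lf.1) => x Xx; exact: hK.
have Lbe j : L2 (b * e j) by apply: L2M_bounded (eigen_le j) => //; exact: (e_L2 j).1.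
pose Z (g : 'rV[R]_d -> R) := (b * g) \_ X.
have iZ g : L2 g -> U.-integrable setT (EFin \o Z g) /\
    (\int[U]_x (Z g x)%:E = (v^-1 * L2dot b g)%:E)%E.
  by move=> Lg; exact: (uniform_integrable mX X0 Xfin hU (L2_integrableM Lb Lg)).
have iZ2 g : L2 (b * g) -> U.-integrable setT (EFin \o (fun x => Z g x ^+ 2)) /\
    (\int[U]_x (Z g x ^+ 2)%:E = (v^-1 * L2dot (b * g) (b * g))%:E)%E.
  move=> Lbg; have [h1 h2] := uniform_integrable mX X0 Xfin hU (L2_integrable_sq Lbg).
  have E x : (fun x => (b * g) x ^+ 2) \_ X x = Z g x ^+ 2.
    by rewrite /Z !patchE; case: ifP => // _; rewrite expr0n.
  split; first by apply: eq_integrable h1 => // x _; rewrite /= E.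
  by under eq_integral do rewrite -E; exact: h2.
have [x0 Xx0] : exists x, X x.
  apply: contrapT => nX; move: X0; rewrite (_ : X = set0) ?measure0 ?ltxx//.
  by rewrite -subset0 => x Xx; apply: nX; exists x.
pose S n g (t : n.-tuple 'rV[R]_d) := \sum_i Z g (tnth t i).
have pt n (t : n.-tuple 'rV[R]_d) : (((S n f t) ^+ 2)%:E <=
    (Hn Omega r f)%:E * \sum_(j <oo) (lam j * (S n (e j) t) ^+ 2)%:E)%E.
  (* Points outside X, which have probability 0, are replaced by x0 with the weight 0. *)
  pose x i := if tnth t i \in X then tnth t i else x0.
  pose c i := if tnth t i \in X then b (tnth t i) else 0.
  have Xx i : X (x i) by rewrite /x; case: ifPn => // /set_mem.
  have SE g : S n g t = \sum_i c i * g (x i).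
    apply: eq_bigr => i _; rewrite /Z patchE /c /x.
    by case: ifP => // _; rewrite mul0r.
  have := reproducing_discrete Xfin c hk Xx Hf; rewrite -SE => h.
  have cv : \sum_(j < N) lam j * (S n (e j) t) ^+ 2 @[N --> \oo] -->
      \sum_i \sum_j c i * c j * k (x j) (x i).
    rewrite (_ : (fun N : nat => _) =
      (fun N => \sum_i \sum_j c i * c j * \sum_(l < N) lam l * e l (x j) * e l (x i))); last first.
      apply/funext => N; under [RHS]eq_bigr => i _.
        under eq_bigr do rewrite mulr_sumr.
        rewrite exchange_big/=; over.
      rewrite exchange_big/=; apply: eq_bigr => l _.
      rewrite SE expr2 mulr_suml mulr_sumr; apply: eq_bigr => i _.
      by rewrite mulr_sumr mulr_sumr; apply: eq_bigr => j _; ring.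
    apply: cvg_sumr => i; apply: cvg_sumr => j; apply: cvgMr.
    by have [_ _ _ hcv] := hm; exact: (hcv _ _ (Xx j) (Xx i)).
  rewrite (_ : (\sum_(j <oo) _ = (\sum_i \sum_j c i * c j * k (x j) (x i))%:E)%E).
    by rewrite -EFinM lee_fin.
  apply: cvg_lim => //; under eq_fun do rewrite sumEFin big_mkord.
  by apply: cvg_EFin; [exact: nearW|exact: cv].
have EX n g : L2 g -> L2 (b * g) -> (\int[mpow U n]_t (S n g t ^+ 2)%:E =
    (n%:R * (v^-1 * L2dot (b * g) (b * g)) + n%:R * (n%:R - 1) * (v^-1 * L2dot b g) ^+ 2)%:E)%E.
  move=> Lg Lbg; have [i1 E1] := iZ g Lg; have [i2 E2] := iZ2 g Lbg.
  have := integral_sqr_sum i1 i2 n 0; rewrite E1 E2 /=.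
  under eq_integral do rewrite add0r.
  by move=> ->; congr EFin; ring.
have mS n g : L2 g -> measurable_fun setT (fun t : n.-tuple 'rV[R]_d => (S n g t ^+ 2)).
  move=> Lg; have mZ : measurable_fun setT (Z g).
    by apply/measurable_EFinP; exact: measurable_int (iZ g Lg).1.
  by apply: measurable_funX; exact: (measurable_tuple_sum (fun=> mZ)).
have Hn0 := Hn_ge0 Hf.
have main n : n%:R * ((v^-1 * L2dot b f) ^+ 2 - Hn Omega r f * (v^-1 ^+ 2 * Q)) <=
    Hn Omega r f * (v^-1 * (K * L2dot b b)).
  pose c j t := (lam j * S n.+1 (e j) t ^+ 2)%:E : \bar R.
  have c0 j t : (0 <= c j t)%E by rewrite lee_fin mulr_ge0 ?sqr_ge0// ltW ?lam_gt0.
  have mc j : measurable_fun setT (c j).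
    by apply/measurable_EFinP; apply: measurable_funM => //; exact: mS (e_L2 j).
  have msum : measurable_fun setT (fun t => \sum_(j <oo) c j t)%E.
    by apply: ge0_emeasurable_sum => //.
  have le1 : (\int[mpow U n.+1]_t (S n.+1 f t ^+ 2)%:E <=
      \int[mpow U n.+1]_t ((Hn Omega r f)%:E * \sum_(j <oo) c j t))%E.
    apply: ge0_le_integral => //.
    - by move=> t _; rewrite lee_fin sqr_ge0.
    - by apply/measurable_EFinP; exact: mS.
    - exact: emeasurable_funM.
  rewrite EX// ge0_integralZl// in le1; last by move=> t _; apply: nneseries_ge0.
  rewrite integral_nneseries// in le1.
  pose N1 : R := n.+1%:R.
  have N10 : 0 < N1 by rewrite ltr0n.
  have N11 : N1 - 1 = n%:R by rewrite /N1 -natr1 addrK.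
  pose Bd := N1 * (v^-1 * (K * L2dot b b)) + N1 * n%:R * (v^-1 ^+ 2 * Q).
  have le2 : (\sum_(j <oo) \int[mpow U n.+1]_t c j t <= Bd%:E)%E.
    apply: lime_le; first by apply: is_cvg_nneseries => j _ _; apply: integral_ge0.
    apply: nearW => N; rewrite big_mkord.
    rewrite (eq_bigr (fun j : 'I_N => (N1 * v^-1 * (lam j * L2dot (b * e j) (b * e j)) +
      N1 * n%:R * v^-1 ^+ 2 * (lam j * L2dot b (e j) ^+ 2))%:E)); last first.
      move=> j _; rewrite /c; under eq_integral do rewrite EFinM.
      rewrite ge0_integralZl//; last 3 first.
      - by apply/measurable_EFinP; exact: mS (e_L2 j).
      - by move=> t _; rewrite lee_fin sqr_ge0.
      - by rewrite lee_fin ltW ?lam_gt0.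
      rewrite (EX _ _ (e_L2 j) (Lbe j)) -[LHS]EFinM -/N1 N11; congr EFin; ring.
    rewrite sumEFin lee_fin big_split/= -!mulr_sumr /Bd !mulrA; apply: lerD.
      rewrite -!mulrA; apply: ler_wpM2l; first exact: ltW.
      by apply: ler_wpM2l; [rewrite invr_ge0 ltW|exact: weighted_eigen_sum_le].
    by apply: ler_wpM2l (hQ N); rewrite !mulr_ge0 ?invr_ge0 ?(ltW v0) ?(ltW N10)//.
  have := le_trans le1 (lee_wpmul2l (_ : (0 <= (Hn Omega r f)%:E)%E) le2).
  rewrite lee_fin => /(_ Hn0); rewrite -EFinM lee_fin -/N1 N11 /Bd => le3.
  have g0 : 0 <= L2dot (b * f) (b * f) by exact: L2dot_ge0.
  rewrite -(ler_pM2l N10); apply: le_trans (_ : _ <= N1 * n%:R * (v^-1 * L2dot b f) ^+ 2 -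
    N1 * n%:R * Hn Omega r f * (v^-1 ^+ 2 * Q)) _; first by rewrite le_eqVlt; apply/orP; left; apply/eqP; ring.
  have : 0 <= N1 * (v^-1 * L2dot (b * f) (b * f)) by rewrite !mulr_ge0// ?invr_ge0 ltW.
  move: le3; rewrite mulrDr.
  have -> : N1 * (Hn Omega r f * (v^-1 * (K * L2dot b b))) = Hn Omega r f * (N1 * (v^-1 * (K * L2dot b b))) by ring.
  have -> : Hn Omega r f * (N1 * n%:R * (v^-1 ^+ 2 * Q)) = N1 * n%:R * Hn Omega r f * (v^-1 ^+ 2 * Q) by ring.
  lra.
have := le_of_forall_natM main; rewrite subr_le0 exprMn [leRHS]mulrCA.
by rewrite ler_pM2l// exprn_gt0 ?invr_gt0.
Qed.

End bound.
End sampling.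

(** * Expansions along the eigenfunctions *)

Lemma sum_ord_widen_le {R : realType} N N' (t : nat -> R) : (forall j, 0 <= t j) -> (N <= N')%N ->
  \sum_(j < N) t j <= \sum_(j < N') t j.
Proof.
move=> t0 NN'; rewrite (big_ord_widen _ t NN') [leLHS]big_mkcond/=.
by apply: ler_sum => j _; case: ifP.
Qed.

Section spectral.
Context {R : realType} {d : nat} (Omega : set 'rV[R]_d).
Let X := closure Omega.
Hypothesis X0 : (0 < @leb R d X)%E.
Hypothesis Xfin : (@leb R d X < +oo)%E.
Notation lebd := (@leb R d).
Notation L2dot := (L2dot Omega).
Notation L2 := (L2 Omega).
Let mX := measurable_closure Omega.
Variables (r K : R) (k : 'rV[R]_d -> 'rV[R]_d -> R) (lam : nat -> R) (e : nat -> 'rV[R]_d -> R).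
Hypotheses (hk : reproducing_kernel Omega r k) (hm : mercer_expansion Omega lam e k).
Hypothesis K0 : 0 < K.
Hypothesis hK : forall f x, HrRKHS Omega r f -> X x -> f x ^+ 2 <= K * Hn Omega r f.

Let Le j : L2 (e j) := e_L2 hm j.
Let lam0 j : 0 < lam j := lam_gt0 hm j.

Definition coef f j : R := L2dot f (e j).

Definition esum (a : nat -> R) N : 'rV[R]_d -> R := \sum_(j < N) a j *: e j.

Lemma esumE a N x : esum a N x = \sum_(j < N) a j * e j x.
Proof. by rewrite /esum fct_sumE. Qed.

Lemma esum_L2 a N : L2 (esum a N).
Proof. by apply: (L2_sum Xfin) => j; exact: L2Z. Qed.

Lemma L2dot_esum a N f : L2 f -> L2dot (esum a N) f = \sum_(j < N) a j * coef f j.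
Proof.
move=> Lf; rewrite /esum L2dot_suml//.
by apply: eq_bigr => j _; rewrite /coef L2dotC.
Qed.

Lemma coef_esum a N i : coef (esum a N) i = if (i < N)%N then a i else 0.
Proof.
rewrite /coef L2dot_esum// /coef; case: ifPn => iN.
  rewrite (bigD1 (Ordinal iN))//= (e_orthonormal hm) eqxx mulr1 big1 ?addr0// => j ji.
  rewrite (e_orthonormal hm) [i == j](_ : _ = false) ?mulr0//.
  by apply/negP => /eqP ij; move: ji; rewrite -(inj_eq val_inj)/= ij eqxx.
rewrite big1// => j _; rewrite (e_orthonormal hm) [i == j](_ : _ = false) ?mulr0//.
by apply/negP => /eqP ij; move: iN; rewrite ij ltn_ord.
Qed.

Lemma L2dot_sub_esum a N f : L2 f ->
  L2dot (f - esum a N) (f - esum a N) = L2dot f f - 2 * (\sum_(j < N) a j * coef f j) + \sum_(j < N) a j ^+ 2.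
Proof.
move=> Lf; have LE := esum_L2 a N; rewrite (L2dotBB Lf LE) (L2dotC _ f (esum a N)) !L2dot_esum//.
by congr (_ + _); apply: eq_bigr => j _; rewrite coef_esum ltn_ord expr2.
Qed.

Lemma L2dot_sub_coef f N : L2 f ->
  L2dot (f - esum (coef f) N) (f - esum (coef f) N) = L2dot f f - \sum_(j < N) coef f j ^+ 2.
Proof.
move=> Lf; rewrite L2dot_sub_esum// (eq_bigr (fun j : 'I_N => coef f j ^+ 2)).
  by ring.
by move=> j _; rewrite expr2.
Qed.

Lemma bessel f N : L2 f -> \sum_(j < N) coef f j ^+ 2 <= L2dot f f.
Proof.
move=> Lf; rewrite -subr_ge0 -L2dot_sub_coef//; apply: L2dot_ge0.
by apply: L2B => //; exact: esum_L2.
Qed.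

(** In [L2dot_reproducing] take b = sum_j <f, e_j> / lam_j e_j over j < N: then the sum S of
    the statement is <b, f> and bounds the last factor, so that S^2 <= |f|_H^2 S. *)
Lemma coef_sum_le f N : HrRKHS Omega r f ->
  \sum_(j < N) coef f j ^+ 2 / lam j <= Hn Omega r f.
Proof.
move=> Hf; have [Lf _ _] := Hf.
pose t j := coef f j ^+ 2 / lam j; have t0 j : 0 <= t j by rewrite divr_ge0 ?sqr_ge0// ltW.
set S := \sum_(j < N) _.
have S0 : 0 <= S by apply: sumr_ge0 => j _; exact: t0.
pose b := esum (fun j => coef f j / lam j) N.
have bf : L2dot b f = S.
  by rewrite L2dot_esum//; apply: eq_bigr => j _; rewrite expr2 mulrAC.
have hQ N' : \sum_(j < N') lam j * L2dot b (e j) ^+ 2 <= S.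
  apply: (@le_trans _ _ (\sum_(j < N' | (j < N)%N) t j)).
    rewrite [leRHS]big_mkcond/=; apply: ler_sum => j _.
    rewrite -[L2dot _ _]/(coef b j) coef_esum; case: ifP => _; last by rewrite expr0n mulr0.
    rewrite /t le_eqVlt; apply/orP; left; apply/eqP; field; rewrite gt_eqF//.
  rewrite /S (big_ord_widen _ t (leq_addl N' N)).
  rewrite (big_ord_widen_cond _ (fun j => (j < N)%N) t (leq_addr N N')).
  rewrite [leLHS]big_mkcond [leRHS]big_mkcond/=; apply: ler_sum => j _.
  by do 2 case: (_ < _)%N => //=.
have := L2dot_reproducing X0 Xfin hk hm K0 hK (esum_L2 _ N) Hf hQ.
rewrite -/b bf expr2; have [S1|S1 _] := ltP 0 S; first by rewrite ler_pM2r.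
by apply: le_trans S1 _; exact: Hn_ge0.
Qed.

(** Integrating the diagonal of the kernel bounds the trace. *)
Lemma lam_bounded : exists2 La, 0 < La & forall j, lam j <= La.
Proof.
have L1 : L2 (cst 1) by have [] := @L2_bounded _ _ Omega Xfin (cst 1) 1 => // y _; rewrite normr1.
exists (K * L2dot (cst 1) (cst 1) + 1).
  by rewrite ltr_wpDl// mulr_ge0 ?L2dot_ge0// ltW.
move=> j; have := weighted_eigen_sum_le Xfin hk hm K0 hK j.+1 L1.
rewrite big_ord_recr/=.
have -> : cst 1 * e j = e j by apply/funext => x; rewrite -[LHS]/(1 * e j x) mul1r.
rewrite (e_orthonormal hm) eqxx mulr1.
have : 0 <= \sum_(i < j) lam i * L2dot (cst 1 * e i) (cst 1 * e i).
  apply: sumr_ge0 => i _; apply: mulr_ge0; first exact: ltW.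
  have -> : cst 1 * e i = e i by apply/funext => x; rewrite -[LHS]/(1 * e i x) mul1r.
  exact: L2dot_ge0.
by move: (\sum_(i < j) _) (L2dot _ _) => u w; lra.
Qed.

(** In [L2dot_reproducing] take for b the remainder of the expansion: <b, f> is the square
    of its norm, and the last factor is at most a multiple of a tail of the convergent
    series of the squared coefficients. *)
Lemma expansion_cvg f : HrRKHS Omega r f ->
  L2dot f f - \sum_(j < N) coef f j ^+ 2 @[N --> \oo] --> 0.
Proof.
move=> Hf; have [Lf _ _] := Hf; have [La La0 hLa] := lam_bounded.
pose S N := \sum_(j < N) coef f j ^+ 2.
have ndS : nondecreasing_seq S.
  by move=> M N MN; apply: (@sum_ord_widen_le _ _ _ (fun j => coef f j ^+ 2)) => // j; exact: sqr_ge0.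
have cS : cvgn S.
  apply: nondecreasing_is_cvgn => //; exists (L2dot f f) => _ [N _ <-]; exact: bessel.
pose Sl := limn S.
have SSl N : S N <= Sl by exact: nondecreasing_cvgn_le.
have D0 N : 0 <= L2dot f f - S N by rewrite subr_ge0; exact: bessel.
have key N : (L2dot f f - S N) ^+ 2 <= Hn Omega r f * (La * (Sl - S N)).
  pose b := f - esum (coef f) N.
  have Lb : L2 b by apply: L2B => //; exact: esum_L2.
  have cb i : L2dot b (e i) = if (i < N)%N then 0 else coef f i.
    rewrite (L2dotBl Lf (esum_L2 _ _) (Le i)) -/(coef f i) -/(coef (esum _ _) i) coef_esum.
    by case: ifP; rewrite ?subrr ?subr0.
  have bf : L2dot b f = L2dot f f - S N.
    have E := L2dot_esum (coef f) N Lf.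
    rewrite (L2dotBl Lf (esum_L2 _ _) Lf) E; congr (_ - _).
  rewrite -bf; apply: (L2dot_reproducing X0 Xfin hk hm K0 hK Lb Hf) => M.
  pose t j := if (j < N)%N then 0 else coef f j ^+ 2.
  have t0 j : 0 <= t j by rewrite /t; case: ifP => // _; exact: sqr_ge0.
  apply: (@le_trans _ _ (\sum_(j < M) La * t j)).
    apply: ler_sum => j _; rewrite cb /t; case: ifP => _; first by rewrite expr0n/= !mulr0.
    by rewrite ler_wpM2r ?sqr_ge0.
  rewrite -mulr_sumr ler_wpM2l ?(ltW La0)//.
  apply: le_trans (sum_ord_widen_le t0 (leq_addr N M)) _.
  apply: (@le_trans _ _ (S (M + N)%N - S N)); last by rewrite lerD2r.
  rewrite /S (big_ord_widen _ (fun j => coef f j ^+ 2) (leq_addl M N)) [X in _ <= _ - X]big_mkcond.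
  rewrite -sumrB; apply: ler_sum => j _; rewrite /t; case: ifP => _; last by rewrite subr0.
  by rewrite subrr.
apply/cvgr0Pnorm_le => eps eps0.
pose c := Hn Omega r f * La + 1.
have c0 : 0 < c by rewrite ltr_wpDl// mulr_ge0 ?(ltW La0)// Hn_ge0.
have e20 : 0 < eps ^+ 2 / c by rewrite divr_gt0// exprn_gt0.
have cS' : S N @[N --> \oo] --> Sl by exact: cS.
have H : \forall N \near \oo, `|S N - Sl| <= eps ^+ 2 / c by apply: cvgr_distC_le cS' _ e20.
near=> N.
rewrite ger0_norm; last exact: D0.
rewrite -ler_sqr ?nnegrE ?(ltW eps0)//; last exact: D0.
apply: le_trans (key N) _.
have h : Sl - S N <= eps ^+ 2 / c.
  apply: le_trans (ler_norm _) _; rewrite distrC; near: N.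
  exact: H.
rewrite mulrA; apply: (@le_trans _ _ (c * (Sl - S N))).
  by rewrite ler_wpM2r ?subr_ge0// lerDl.
by rewrite mulrC -ler_pdivlMr.
Unshelve. all: by end_near. Qed.

(** Where lam_j >= tau, lam_j^(-s) is at most tau^(-s); elsewhere, if s <= 1, it is at most
    tau^(1-s) / lam_j. *)
Lemma power_coef_le s tau f j : 0 < s -> 0 < tau -> s <= 1 \/ tau <= lam j ->
  (coef f j * lam j `^ (- (s / 2))) ^+ 2 <=
  tau `^ (- s) * (coef f j ^+ 2 + tau * (coef f j ^+ 2 / lam j)).
Proof.
move=> s0 t0 h; have l0 := lam0 j.
rewrite exprMn -(powR_mulrn 2 (powR_ge0 _ _)) -powRrM.
have -> : - (s / 2) * 2%:R = - s by field.
have -> : tau `^ (- s) * (coef f j ^+ 2 + tau * (coef f j ^+ 2 / lam j)) =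
  coef f j ^+ 2 * (tau `^ (- s) * (1 + tau / lam j)) by field; rewrite gt_eqF.
apply: ler_wpM2l; first exact: sqr_ge0.
have ts0 : 0 < tau `^ s by rewrite powR_gt0.
have ls0 : 0 < lam j `^ s by rewrite powR_gt0.
have [tl|lt] := leP tau (lam j).
  apply: (@le_trans _ _ (tau `^ (- s))); last first.
    by rewrite ler_peMr ?powR_ge0// lerDl divr_ge0 ?ltW.
  rewrite !powRN lef_pV2 ?posrE//.
  by apply: ge0_ler_powR; rewrite ?nnegrE// ltW.
have s1 : s <= 1 by case: h => //; rewrite leNgt lt.
apply: (@le_trans _ _ (tau `^ (- s) * (tau / lam j))); last first.
  by rewrite ler_wpM2l ?powR_ge0// lerDr.
have E x : 0 < x -> x `^ (- s) = x `^ (1 - s) / x.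
  move=> x0; rewrite powRD ?(gt_eqF x0) ?implybT// powRr1 ?ltW//.
  by rewrite mulrAC mulfV ?mul1r// gt_eqF.
rewrite (E _ l0) (E _ t0) mulrA divfK ?gt_eqF//.
rewrite ler_wpM2r ?invr_ge0 ?(ltW l0)//.
by apply: ge0_ler_powR; rewrite ?nnegrE ?subr_ge0// ltW.
Qed.

Lemma series_sqr_cvg (a : nat -> R) M : (forall N, \sum_(j < N) a j ^+ 2 <= M) ->
  cvgn (series (fun j => a j ^+ 2)) /\ limn (series (fun j => a j ^+ 2)) <= M.
Proof.
move=> aM; have aM' N : series (fun j => a j ^+ 2) N <= M by rewrite /series/= big_mkord.
have c : cvgn (series (fun j => a j ^+ 2)).
  apply: nondecreasing_is_cvgn; last by exists M => _ [N _ <-].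
  by apply: nondecreasing_series => j _ _; exact: sqr_ge0.
by split => //; apply: limr_le => //; exact: nearW.
Qed.

Lemma power_norm_le s f a B : 0 <= B -> power_expansion Omega lam e s f a ->
  (forall N, \sum_(j < N) a j ^+ 2 <= B ^+ 2) -> (power_norm Omega lam e s f <= B%:E)%E.
Proof.
move=> B0 pe aB; apply: (@le_trans _ _ (Num.sqrt (limn (series (fun j => a j ^+ 2))))%:E).
  by apply: ereal_inf_lbound; exists a.
rewrite lee_fin -(ger0_norm B0) -sqrtr_sqr ler_wsqrtr//.
by have [] := series_sqr_cvg aB.
Qed.

(** If s <= 1, f is g itself and only its norm has to be bounded. If s > 1, f is the part of
    the expansion of g with lam_j >= tau, cut at a finite J at the cost of eps; the part
    left out has a squared norm at most tau times sum_j <g, e_j>^2 / lam_j. In that case the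
    pointwise bound on f comes from Cauchy-Schwarz, since the sum of lam_j e_j(x)^2 is at
    most K. *)
Lemma spectral_approx s tau eps D g : 0 < s -> 0 < tau -> 0 < eps -> 0 <= D -> HrRKHS Omega r g ->
  (s <= 1 -> forall x, X x -> `|g x| <= D) -> (1 < s -> K * Hn Omega r g <= D ^+ 2) ->
  exists f a, [/\ L2 f, forall x, X x -> `|f x| <= D,
    L2dot (g - f) (g - f) <= tau * Hn Omega r g + eps & L2dot f f <= L2dot g g] /\
    (power_expansion Omega lam e s f a /\ forall N, \sum_(j < N) a j ^+ 2 <=
      tau `^ (- s) * (L2dot g g + tau * Hn Omega r g)).
Proof.
move=> s0 t0 eps0 D0 Hg gs1 gs2; have [Lg _ _] := Hg; have Hn0 := Hn_ge0 Hg.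
have powK j : lam j `^ (- (s / 2)) * lam j `^ (s / 2) = 1.
  by rewrite powRN mulVf// gt_eqF// powR_gt0.
have [s1|s1] := leP s 1.
  pose a j := coef g j * lam j `^ (- (s / 2)).
  have aM N : \sum_(j < N) a j ^+ 2 <= tau `^ (- s) * (L2dot g g + tau * Hn Omega r g).
    apply: (@le_trans _ _ (\sum_(j < N) tau `^ (- s) * (coef g j ^+ 2 + tau * (coef g j ^+ 2 / lam j)))).
      by apply: ler_sum => j _; apply: power_coef_le => //; left.
    rewrite -mulr_sumr big_split/= -mulr_sumr ler_wpM2l ?powR_ge0// lerD ?bessel//.
    by rewrite ler_wpM2l ?(ltW t0)// coef_sum_le.
  exists g, a; split; split => //; first exact: gs1.
  - rewrite subrr (L2dot0l Xfin (L20 Xfin)) addr_ge0 ?mulr_ge0 ?(ltW t0) ?(ltW eps0)//.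
  - split => //; first by have [] := series_sqr_cvg aM.
    have E N : L2sq Omega (fun x => g x - \sum_(j < N) a j * lam j `^ (s / 2) * e j x) =
        (L2dot g g - \sum_(j < N) coef g j ^+ 2)%:E.
      rewrite -L2dot_sub_coef// -(L2sqE (L2B Lg (esum_L2 _ _))); congr (L2sq Omega _).
      apply/funext => x; rewrite -[RHS]/(g x - esum (coef g) N x) esumE; congr (_ - _).
      by apply: eq_bigr => j _; rewrite /a -(mulrA (coef g j)) powK mulr1.
    under eq_fun do rewrite E.
    by apply: cvg_EFin; [exact: nearW|exact: expansion_cvg].
have [J hJ] : exists J, L2dot g g - \sum_(j < J) coef g j ^+ 2 <= eps.
  have /cvgr0Pnorm_le/(_ _ eps0) [J _ hJ] := expansion_cvg Hg.
  by exists J; apply: le_trans (ler_norm _) _; apply: hJ => /=.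
pose b j := if tau <= lam j then coef g j else 0.
pose a j := if (j < J)%N && (tau <= lam j) then coef g j * lam j `^ (- (s / 2)) else 0.
pose f := esum b J.
have Lf : L2 f by exact: esum_L2.
have bc j : b j * coef g j = b j ^+ 2 by rewrite /b; case: ifP => _; rewrite ?mul0r ?expr0n// expr2.
have ff : L2dot f f = \sum_(j < J) b j ^+ 2.
  by rewrite L2dot_esum//; apply: eq_bigr => j _; rewrite coef_esum ltn_ord expr2.
have gf : L2dot (g - f) (g - f) = L2dot g g - \sum_(j < J) b j ^+ 2.
  rewrite L2dot_sub_esum// (eq_bigr (fun j : 'I_J => b j ^+ 2)); first by ring.
  by move=> j _; exact: bc.
have bb j : b j ^+ 2 <= coef g j ^+ 2 by rewrite /b; case: ifP => _; rewrite ?expr0n ?sqr_ge0.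
have aM N : \sum_(j < N) a j ^+ 2 <= tau `^ (- s) * (L2dot g g + tau * Hn Omega r g).
  apply: (@le_trans _ _ (\sum_(j < N) tau `^ (- s) * (coef g j ^+ 2 + tau * (coef g j ^+ 2 / lam j)))).
    apply: ler_sum => j _; rewrite /a; case: ifP => [/andP[_ h]|_].
      by apply: power_coef_le => //; right.
    by rewrite expr0n mulr_ge0 ?powR_ge0// addr_ge0 ?sqr_ge0// mulr_ge0 ?divr_ge0 ?sqr_ge0// ltW.
  rewrite -mulr_sumr big_split/= -mulr_sumr ler_wpM2l ?powR_ge0// lerD ?bessel//.
  by rewrite ler_wpM2l ?(ltW t0)// coef_sum_le.
exists f, a; split; split => //.
- move=> x Xx; rewrite -ler_sqr ?nnegrE// real_normK ?num_real//.
  apply: le_trans (gs2 s1); rewrite /f esumE.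
  pose p j := b j / Num.sqrt (lam j); pose q j := Num.sqrt (lam j) * e j x.
  rewrite (eq_bigr (fun j : 'I_J => p j * q j)); last first.
    by move=> j _; rewrite /p /q mulrA divfK// gt_eqF// sqrtr_gt0.
  apply: le_trans (sum_CauchySchwarz _ _ _ _) _; rewrite mulrC; apply: ler_pM.
  + by apply: sumr_ge0 => j _; exact: sqr_ge0.
  + by apply: sumr_ge0 => j _; exact: sqr_ge0.
  + rewrite (eq_bigr (fun j : 'I_J => lam j * e j x ^+ 2)); first exact: (eigen_sum_le Xfin hk hm K0 hK).
    by move=> j _; rewrite /q exprMn sqr_sqrtr// ltW.
  apply: le_trans (coef_sum_le J Hg); apply: ler_sum => j _.
  by rewrite /p expr_div_n sqr_sqrtr ?ler_pM2r ?invr_gt0// ltW.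
- rewrite gf; have tail : \sum_(j < J) coef g j ^+ 2 - \sum_(j < J) b j ^+ 2 <= tau * Hn Omega r g.
    apply: (@le_trans _ _ (tau * \sum_(j < J) coef g j ^+ 2 / lam j)); last first.
      by rewrite ler_wpM2l ?(ltW t0)// coef_sum_le.
    rewrite mulr_sumr -sumrB; apply: ler_sum => j _; rewrite /b; case: (leP tau (lam j)) => [_|lt].
      by rewrite subrr mulr_ge0 ?divr_ge0 ?sqr_ge0// ltW.
    by rewrite expr0n subr0 mulrCA ler_peMr ?sqr_ge0// ler_pdivlMr// mul1r ltW.
  lra.
- by rewrite ff; apply: le_trans (bessel J Lg); apply: ler_sum => j _; exact: bb.
- split => //; first by have [] := series_sqr_cvg aM.
  apply: cvg_near_cst; exists J => // N /= JN.
  rewrite (_ : (fun x => _) = 0) ?(L2sqE (L20 Xfin)) ?(L2dot0l Xfin (L20 Xfin))//.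
  apply/funext => x; rewrite /f esumE (big_ord_widen _ (fun j => b j * e j x) JN) big_mkcond/=.
  rewrite -sumrB big1// => j _; rewrite /a /b; case: ifP => _ /=; last by rewrite !mul0r subrr.
  by case: ifP => _; [rewrite -(mulrA (coef g j)) powK mulr1 subrr|rewrite !mul0r subrr].
Qed.

End spectral.

(** * Averaging over the hypotheses *)

(** A vector is weighted by (1/4)^k, where k is the number of disagreements: the total
    weight is (5/4)^M, and each vector of the ball has a weight at least (6/5)^(-M), because
    (6/5)^8 >= 4. *)
Lemma hamming_ball_card {R : realType} (J : finType) (b : J -> bool) :
  #|[pred sg : {ffun J -> bool} | (8 * #|[pred j | sg j != b j]| < #|J|)%N]|%:R <= (3/2 : R) ^+ #|J|.
Proof.
pose w (j : J) (v : bool) : R := if v != b j then 1/4 else 1.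
have total : \sum_(sg : {ffun J -> bool}) \prod_j w j (sg j) = (5/4) ^+ #|J|.
  rewrite -(bigA_distr_bigA w) -prodr_const; apply: eq_bigr => j _.
  by rewrite big_bool /w; case: (b j) => /=; field.
have wE (sg : {ffun J -> bool}) : \prod_j w j (sg j) = (1/4) ^+ #|[pred j | sg j != b j]|.
  rewrite -prodr_const big_mkcond [RHS]big_mkcond/=; apply: eq_bigr => j _.
  by rewrite inE /w.
rewrite -sum1_card natr_sum big_mkcond/=.
have -> : (3/2 : R) ^+ #|J| = (6/5) ^+ #|J| * (5/4) ^+ #|J|.
  by rewrite -exprMn; congr (_ ^+ _); field.
rewrite -total mulr_sumr; apply: ler_sum => sg _.
have w0 : 0 <= \prod_j w j (sg j).
  by apply: prodr_ge0 => j _; rewrite /w; case: ifP => _; lra.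
rewrite inE; case: ifP => h; last by rewrite mulr_ge0// exprn_ge0//; lra.
rewrite wE; set k := #|_| in h *.
apply: (@le_trans _ _ ((6/5) ^+ (8 * k) * (1/4) ^+ k)).
  rewrite exprM -exprMn; apply: exprn_ege1.
  have h2 : 2 <= (6/5 : R) ^+ 4 by lra.
  by rewrite -[8%N]/(4 * 2)%N exprM; move: h2; move: ((6/5 : R) ^+ 4) => u h2; nra.
by apply: ler_wpM2r; [apply: exprn_ge0; lra|apply: ler_weXn2l; [lra|exact: ltnW]].
Qed.

Section averaging.
Context d (T : measurableType d) (R : realType) (P : {measure set T -> \bar R}) (S : finType).
Variables (L : S -> T -> R) (A : S -> set T) (E t H : R).
Hypotheses (PT : (P setT = 1)%E) (mL : forall s, measurable_fun setT (L s)) (L0 : forall s x, 0 <= L s x).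
Hypotheses (mA : forall s, measurable (A s)) (t0 : 0 < t).
Hypothesis LE : forall s, (\int[P]_x (L s x ^+ 2)%:E <= E%:E)%E.
Hypothesis AH : forall x, \sum_s \1_(A s) x <= H.

(** Where the likelihood exceeds t it is at most its square divided by t, and elsewhere at
    most t, so that the mass of A s is at most E / t + t P (A s); the sum over s of the last
    terms is at most t H. *)
Lemma average_change_of_measure :
  (\sum_s \int[P]_(x in A s) (L s x)%:E <= (#|S|%:R * (E / t) + t * H)%:E)%E.
Proof.
have m1 s : measurable_fun setT (fun x => (\1_(A s) x)%:E : \bar R).
  by apply/measurable_EFinP; exact: measurable_indic.
have m2 s : measurable_fun setT (fun x => (L s x ^+ 2)%:E).
  by apply/measurable_EFinP; exact: measurable_funX.
have tE0 : (0 <= (t^-1)%:E)%E by rewrite lee_fin invr_ge0 ltW.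
apply: (@le_trans _ _ (\sum_s ((t^-1)%:E * \int[P]_x (L s x ^+ 2)%:E + t%:E * \int[P]_x (\1_(A s) x)%:E))%E).
  apply: lee_sum => s _; rewrite integral_mkcond -!ge0_integralZl//; last 2 first.
  - by rewrite lee_fin ltW.
  - by move=> x _; rewrite lee_fin sqr_ge0.
  rewrite -ge0_integralD//; last 4 first.
  - by move=> x _; rewrite mule_ge0// lee_fin sqr_ge0.
  - exact: emeasurable_funM.
  - by move=> x _; rewrite mule_ge0// lee_fin// ltW.
  - exact: emeasurable_funM.
  apply: ge0_le_integral => //.
  - by move=> x _; rewrite patchE; case: ifP => // _; rewrite lee_fin.
  - apply/(measurable_restrictT _ (mA s)); apply: measurable_funTS; exact/measurable_EFinP.
  - by apply: emeasurable_funD; exact: emeasurable_funM.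
  move=> x _; rewrite patchE indicE -!EFinM -EFinD; case: ifP => _; last first.
    by rewrite lee_fin mulr0 addr0 mulr_ge0 ?sqr_ge0// invr_ge0 ltW.
  rewrite lee_fin mulr1; have [Lt|tL] := leP (L s x) t.
    by apply: le_trans Lt _; rewrite lerDr mulr_ge0 ?sqr_ge0// invr_ge0 ltW.
  apply: (@le_trans _ _ (t^-1 * L s x ^+ 2)); last by rewrite lerDl ltW.
  by rewrite mulrC ler_pdivlMr// expr2 ler_wpM2l// ltW.
rewrite big_split/= EFinD; apply: leeD.
  apply: (@le_trans _ _ (\sum_(s : S) (E / t)%:E)%E).
    by apply: lee_sum => s _; rewrite [in leRHS]mulrC EFinM; apply: lee_wpmul2l.
  by rewrite sumEFin sumr_const mulr_natl.
rewrite -ge0_sume_distrr; last by move=> s _; apply: integral_ge0 => x _; rewrite lee_fin.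
rewrite EFinM; apply: lee_wpmul2l; first by rewrite lee_fin ltW.
rewrite -ge0_integral_sum//.
apply: (@le_trans _ _ (\int[P]_x H%:E)%E); last by rewrite integral_cst// PT mule1.
apply: ge0_le_integral => //.
- by move=> x _; apply: sume_ge0 => s _; rewrite lee_fin.
- exact: emeasurable_sum.
by move=> x _; rewrite sumEFin lee_fin.
Qed.

End averaging.

(** The event to bound from below is not assumed measurable; a cover of nearly the same
    measure replaces it. *)
Lemma outer_measure_cover d (T : measurableType d) (R : realType)
    (mu : {measure set T -> \bar R}) (A : set T) (x : \bar R) : ((mu^*)%mu A < x)%E ->
  exists2 G, measurable G & A `<=` G /\ (mu G < x)%E.
Proof.
move=> /ereal_inf_lt[_ [F [mF AF] <-] lt].
exists (\bigcup_k F k); first exact: bigcup_measurable.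
split => //; apply: le_lt_trans lt.
by apply: measure_sigma_subadditive => //; exact: bigcup_measurable.
Qed.

(** * The distributions with uniform marginal and a given Bayes function *)

Section model.
Context {R : realType} {d : nat} (Omega : set 'rV[R]_d).
Let X := closure Omega.
Hypothesis X0 : (0 < @leb R d X)%E.
Hypothesis Xfin : (@leb R d X < +oo)%E.
Notation lebd := (@leb R d).
Notation row := 'rV[R]_d.
Let mX := measurable_closure Omega.
Let v := fine (lebd X).
Let vE : lebd X = v%:E. Proof. by rewrite fineK// ge0_fin_numE. Qed.
Let v0 : 0 < v. Proof. by rewrite -lte_fin -vE. Qed.
Let int1 : (\int[lebd]_(x in X) (cst 1%E) x = v%:E)%E.
Proof. by rewrite integral_cst// mul1e -vE. Qed.

Definition label (y : bool) : R := if y then 1 else -1.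

(** The density at (x, y) of the distribution with a uniform marginal and the Bayes function
    f, with respect to a uniform point and a fair coin. *)
Definition tilt (f : row -> R) (z : row * bool) : R := 1 + label z.2 * (f \_ X) z.1.

Lemma measurable_tilt f : measurable_fun X f -> measurable_fun setT (tilt f).
Proof.
move=> mf; apply: measurable_funD => //; apply: measurable_funM.
  by apply: (measurableT_comp (f := label)).
by apply: measurableT_comp => //; exact/(measurable_restrictT _ mX).
Qed.

Lemma tilt_ge0 f z : (forall x, X x -> `|f x| <= 1) -> 0 <= tilt f z.
Proof.
move=> f1; have : `|(f \_ X) z.1| <= 1.
  by rewrite patchE; case: ifPn => [/set_mem /f1//|_]; rewrite normr0.
by rewrite /tilt /label ler_norml; case: z.2; lra.
Qed.

(** The reference measure of all the hypotheses, given by its integrals: a uniform point of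
    X together with a fair coin. *)
Lemma fair_model : exists P : probability (row * bool)%type R, forall F : row * bool -> \bar R,
  measurable_fun setT F -> (forall z, 0 <= F z)%E ->
  (\int[P]_z F z = (v^-1)%:E * \int[lebd]_(x in X) (2^-1%:E * (F (x, true) + F (x, false))))%E.
Proof.
have [U hU] := uniform_probability mX X0 Xfin.
have h01 : 0 <= (2^-1 : R) <= 1 by rewrite invr_ge0 ler0n/= invf_le1// ler1n.
pose P : probability (row * bool)%type R := (U \x (bernoulli_prob (2^-1 : R)))%E.
exists P => F mF F0; rewrite /P fubini_tonelli1//=.
rewrite (eq_integral (fun x => 2^-1%:E * (F (x, true) + F (x, false)))%E); last first.
  move=> x _; rewrite /fubini_F integral_bernoulli_prob// ge0_muleDr//; congr (_ + _ * _)%E.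
  by congr EFin; transitivity (1 - 2^-1 : R) => //; field.
rewrite hU//.
- apply: emeasurable_funM => //; apply: emeasurable_funD; apply: measurableT_comp => //.
- by move=> x; rewrite mule_ge0// ?lee_fin ?invr_ge0// adde_ge0.
Qed.

Variable P : probability (row * bool)%type R.
Hypothesis hP : forall F : row * bool -> \bar R,
  measurable_fun setT F -> (forall z, 0 <= F z)%E ->
  (\int[P]_z F z = (v^-1)%:E * \int[lebd]_(x in X) (2^-1%:E * (F (x, true) + F (x, false))))%E.

Lemma tilt_sqr_integral f : L2 Omega f ->
  (\int[P]_z (tilt f z ^+ 2)%:E = (1 + v^-1 * L2dot Omega f f)%:E)%E.
Proof.
move=> Lf; rewrite hP//.
- rewrite (eq_integral (fun x => 1%:E + (f x ^+ 2)%:E)%E); last first.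
    move=> x Xx; rewrite -!EFinD -EFinM; congr EFin; by rewrite /tilt /label/= patchE Xx; field.
  rewrite ge0_integralD//; last 2 first.
  + by move=> x _; rewrite lee_fin sqr_ge0.
  + by apply/measurable_EFinP/measurable_funX; exact: Lf.1.
  rewrite [X in (_ * (X + _))%E]int1 -/(L2sq Omega f) (L2sqE Lf) -EFinD -EFinM.
  by rewrite mulrDr mulVf ?gt_eqF.
- by apply/measurable_EFinP/measurable_funX; apply: measurable_tilt; exact: Lf.1.
- by move=> z; rewrite lee_fin sqr_ge0.
Qed.

Lemma tilted_probability (f : row -> R) : measurable_fun X f -> (forall x, X x -> `|f x| <= 1) ->
  exists rho : probability (row * bool)%type R,
    forall A, measurable A -> (rho A = \int[P]_(z in A) (tilt f z)%:E)%E.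
Proof.
move=> mf f1; apply: density_probability.
- exact: measurable_tilt.
- by move=> z; exact: tilt_ge0.
rewrite /dens hP//.
- rewrite (eq_integral (cst 1%E)); last first.
    by move=> x Xx; rewrite -!EFinD -EFinM; congr EFin; rewrite /tilt /label/=; field.
  by rewrite int1 -EFinM mulVf// gt_eqF.
- by apply/measurable_EFinP; exact: measurable_tilt.
- by move=> z; rewrite lee_fin tilt_ge0.
Qed.

Section tilted.
Variables (f : row -> R) (rho : probability (row * bool)%type R).
Hypotheses (mf : measurable_fun X f) (f1 : forall x, X x -> `|f x| <= 1).
Hypothesis hrho : forall A, measurable A -> (rho A = \int[P]_(z in A) (tilt f z)%:E)%E.

Let f12 x : X x -> 0 <= (1 + f x) / 2 /\ 0 <= (1 - f x) / 2.
Proof. by move=> /f1; rewrite ler_norml => /andP[h1 h2]; split; apply: divr_ge0 => //; lra. Qed.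

Lemma tilted_integral (F : row * bool -> R) : measurable_fun setT F -> (forall z, 0 <= F z) ->
  (\int[rho]_z (F z)%:E = (v^-1)%:E * \int[lebd]_(x in X)
    (F (x, true) * ((1 + f x) / 2) + F (x, false) * ((1 - f x) / 2))%:E)%E.
Proof.
move=> mF F0; have mt := measurable_tilt mf.
have t0 z : 0 <= tilt f z by exact: tilt_ge0.
rewrite (ge0_integral_density mt t0 hrho)//; last exact/measurable_EFinP.
rewrite hP.
- congr (_ * _)%E; apply: eq_integral => x Xx.
  transitivity ((2^-1 * (F (x, true) * tilt f (x, true) + F (x, false) * tilt f (x, false)))%:E)%E => //.
  by congr EFin; rewrite /tilt /label/= patchE Xx; field.
- by apply/measurable_EFinP; apply: measurable_funM.
- by move=> z; rewrite lee_fin mulr_ge0.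
Qed.

Lemma tilted_measure (A : set (row * bool)) : measurable A ->
  (rho A = (v^-1)%:E * \int[lebd]_(x in X)
    (\1_A (x, true) * ((1 + f x) / 2) + \1_A (x, false) * ((1 - f x) / 2))%:E)%E.
Proof.
move=> mA; rewrite -tilted_integral.
- by rewrite integral_indic// setIT.
- exact: measurable_indic.
- by move=> z.
Qed.

Lemma tilted_concentrated : rho (X `*` setT) = 1%E.
Proof.
rewrite tilted_measure; last exact: measurableX.
rewrite (eq_integral (cst 1%E)); first by rewrite int1 -EFinM mulVf// gt_eqF.
move=> x /set_mem Xx; have h y : \1_(X `*` [set: bool]) (x, y) = 1 :> R.
  by rewrite indicE mem_set.
by rewrite /= !h; congr EFin; field.
Qed.

Lemma tilted_has_density : has_density Omega rho (cst v^-1).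
Proof.
move=> A mA; rewrite /marginal /pushforward tilted_measure; last first.
  by rewrite -[X in measurable X]setTI; exact: measurable_fst.
have mAX : measurable (A `&` X) by exact: measurableI.
rewrite [RHS](_ : _ = \int[lebd]_(x in A `&` X) (cst (v^-1)%:E) x)%E// integral_cst//.
congr (_ * _)%E; rewrite -[RHS]integral_indic//; apply: eq_integral => x Xx.
have h y : \1_(fst @^-1` A) (x, y) = \1_A x :> R by [].
by rewrite !h; congr EFin; field.
Qed.

Lemma tilted_cond_prob : cond_prob Omega rho (fun x => (1 + f x) / 2).
Proof.
have mh : measurable_fun X (fun x => (1 + f x) / 2) by apply: measurable_funM => //; apply: measurable_funD.
split => //.
  move=> x Xx; have [h1 h2] := f12 Xx; rewrite h1/=.
  by move: h2; lra.
move=> A mA.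
have mAX : measurable (A `&` X) by exact: measurableI.
rewrite tilted_measure; last exact: measurableX.
rewrite /marginal (ge0_integral_pushforward measurable_fst)//; last 2 first.
- by apply/measurable_EFinP; apply: measurable_funS mh => //; exact: subIsetr.
- by move=> x /set_mem [_ Xx]; rewrite lee_fin; have [] := f12 Xx.
rewrite integral_mkcond.
pose F (x : row) := ((fun x => \1_(A `&` X) x * ((1 + f x) / 2)) \_ X) x.
have F0 x : 0 <= F x.
  rewrite /F patchE; case: ifPn => // /set_mem Xx; rewrite mulr_ge0//.
  by have [] := f12 Xx.
rewrite [RHS](eq_integral (fun z => (F z.1)%:E)); last first.
  move=> z _; rewrite !patchE /F /= patchE /= indicE.
  have -> : (z \in fst @^-1` (A `&` X)) = (z.1 \in A `&` X) by [].
  have [h|h] := boolP (z.1 \in A `&` X).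
    by rewrite mem_set; [rewrite mul1r|have [] := set_mem h].
  by case: ifP => //; rewrite mul0r.
rewrite (tilted_integral (F := fun z => F z.1)).
- congr (_ * _)%E; apply: eq_integral => x xX; congr EFin.
  have h1 : \1_(A `*` [set true]) (x, true) = \1_(A `&` X) x :> R.
    have Xx := set_mem xX; rewrite !indicE; have [Ax|nAx] := pselect (A x).
      by rewrite !mem_set.
    by rewrite !memNset//=; case.
  have h2 : \1_(A `*` [set true]) (x, false) = 0 :> R by rewrite indicE memNset//= => -[].
  by rewrite h1 h2 /F patchE xX; field.
- apply: measurableT_comp => //; apply/(measurable_restrictT _ mX); exact: measurable_funM.
- by move=> z.
Qed.

Lemma measurable_error (h : row -> R) : measurable_fun X h ->
  measurable [set z : row * bool | X z.1 /\ (0 <= h z.1) != z.2].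
Proof.
move=> mh.
have m1 : measurable (X `&` h @^-1` `[0, +oo[%classic) by apply: mh.
have m2 : measurable (X `&` h @^-1` `]-oo, 0[%classic) by apply: mh.
rewrite (_ : [set z | _] = (X `&` h @^-1` `[0, +oo[%classic) `*` [set false] `|`
  (X `&` h @^-1` `]-oo, 0[%classic) `*` [set true]); first by apply: measurableU; exact: measurableX.
apply/seteqP; split => [[x y]|[x y]] /=; rewrite !in_itv/= ?andbT.
  move=> [Xx]; case: (leP 0 (h x)) => hx; case: y => // _; [left|right]; split => //; split => //.
by move=> [[[Xx hx] ->]|[[Xx hx] ->]]; split => //; [rewrite hx|rewrite leNgt hx].
Qed.

(** Given x, the label 1 is wrong with probability (1 - f x) / 2 and the label -1 with
    probability (1 + f x) / 2. *)
Lemma tilted_risk (h : row -> R) : measurable_fun X h ->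
  risk Omega rho h = v^-1 * \int[lebd]_(x in X) ((1 - label (0 <= h x) * f x) / 2).
Proof.
move=> mh; have mA := measurable_error mh.
have ml : measurable_fun X (fun x => label (0 <= h x)).
  apply: (measurableT_comp (f := label)) => //.
  by apply: measurable_fun_ler.
rewrite /risk tilted_measure//.
have E x : x \in X -> ((\1_[set z : row * bool | X z.1 /\ (0 <= h z.1) != z.2] (x, true) * ((1 + f x) / 2) +
   \1_[set z : row * bool | X z.1 /\ (0 <= h z.1) != z.2] (x, false) * ((1 - f x) / 2))%:E =
   ((1 - label (0 <= h x) * f x) / 2)%:E)%E.
  move=> /set_mem Xx; congr EFin; rewrite /label; case: (boolP (0 <= h x)) => hx.
    rewrite !indicE memNset ?mem_set/= ?hx ?eqxx; [by field|by []|by case].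
  rewrite !indicE mem_set ?memNset/= ?(negPf hx) ?eqxx; [by field|by case|by []].
rewrite (eq_integral _ _ E) fineM// /Rintegral.
apply: integrable_fin_num => //; apply: measurable_bounded_integrable => //.
  by apply: measurable_funM => //; apply: measurable_funB => //; exact: measurable_funM.
exists 1; split => // M M1 x Xx /=; apply: le_trans (ltW M1).
by have := f1 Xx; rewrite !ler_norml /label => /andP[h1 h2]; case: ifP => _; lra.
Qed.

End tilted.
End model.

(** * From excess risk to Hamming distance *)

Lemma normr_bump_sum {R : realType} d (N : nat) (a : R) (q : 'I_d -> R)
    (A : R) (sg : {ffun 'I_d -> 'I_N} -> bool) (x : 'rV[R]_d) : 0 <= A ->
  `|bump_sum a q (fun j => A * label (sg j)) x| =
    A * \sum_(j : {ffun 'I_d -> 'I_N}) cell_bump a q j x.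
Proof.
move=> A0; rewrite bump_sumE.
have [[j0 h0]|h] := pselect (exists j : {ffun 'I_d -> 'I_N}, cell_bump a q j x != 0).
  have z (j : {ffun 'I_d -> 'I_N}) : j != j0 -> cell_bump a q j x = 0.
    move=> jj; apply: contraNeq jj => h.
    by rewrite (tder_cell_single (k := fun=> 0%N) h h0).
  rewrite (bigD1 j0)//= big1 => [|j /z->]; last by rewrite mulr0.
  rewrite [in RHS](bigD1 j0)//= [in RHS]big1// !addr0 normrM (ger0_norm (cell_bump_ge0 _ _ _ _)).
  by congr (_ * _); rewrite normrM ger0_norm// /label; case: ifP; rewrite ?normrN normr1 mulr1.
have z (j : {ffun 'I_d -> 'I_N}) : cell_bump a q j x = 0 by apply: contra_notP h => /eqP; exists j.
by rewrite !big1 ?mulr0 ?normr0// => j _; rewrite z// mulr0.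
Qed.

Section excess.
Context {R : realType} {d : nat} (Omega : set 'rV[R]_d).
Let X := closure Omega.
Hypothesis X0 : (0 < @leb R d X)%E.
Hypothesis Xfin : (@leb R d X < +oo)%E.
Notation lebd := (@leb R d).
Notation row := 'rV[R]_d.
Notation L2 := (L2 Omega).
Notation L2dot := (L2dot Omega).
Notation mean f := (L2dot f (cst 1)).
Let mX := measurable_closure Omega.
Let v := fine (lebd X).
Let vE : lebd X = v%:E. Proof. by rewrite fineK// ge0_fin_numE. Qed.
Let v0 : 0 < v. Proof. by rewrite -lte_fin -vE. Qed.

Let L2_1 : L2 (cst 1).
Proof.
have [] // := L2_bounded Xfin (f := cst 1) (M := 1).
by move=> x _; rewrite /= normr1.
Qed.

Let mean_le (f g : row -> R) : L2 f -> L2 g -> (forall x, X x -> f x <= g x) -> mean f <= mean g.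
Proof.
move=> Lf Lg fg; apply: le_Rintegral => //; [exact: (L2_integrableM Lf)|exact: (L2_integrableM Lg)|].
by move=> x Xx; rewrite /= !mulr1; exact: fg.
Qed.

Let mean_normr_le (f : row -> R) : L2 f -> mean (fun x => `|f x|) <= Num.sqrt (v * L2dot f f).
Proof.
move=> Lf; have Lnf : L2 (fun x => `|f x|).
  split; first by apply: measurableT_comp => //; exact: Lf.1.
  rewrite (_ : L2sq _ _ = L2sq Omega f); first exact: Lf.2.
  by apply: eq_integral => x _; rewrite real_normK// num_real.
apply: (le_trans (ler_norm _)); rewrite -sqrtr_sqr ler_sqrt; last first.
  by rewrite mulr_ge0 ?(ltW v0)//; exact: L2dot_ge0.
apply: (le_trans (L2dot_CauchySchwarz Lnf L2_1)); rewrite mulrC.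
have -> : L2dot (cst 1) (cst 1) = v.
  by rewrite /Defs.L2dot/= (eq_Rintegral _ (g := cst 1)) ?Rintegral_cst ?mul1r// => x _; rewrite mulr1.
rewrite (_ : L2dot _ _ = L2dot f f)//.
by apply: eq_Rintegral => x _; rewrite -normrM ger0_norm// -expr2 sqr_ge0.
Qed.

Variable P : probability (row * bool)%type R.
Hypothesis hP : forall F : row * bool -> \bar R,
  measurable_fun setT F -> (forall z, 0 <= F z)%E ->
  (\int[P]_z F z = (v^-1)%:E * \int[lebd]_(x in X) (2^-1%:E * (F (x, true) + F (x, false))))%E.
Variables (f : row -> R) (rho : probability (row * bool)%type R).
Hypotheses (mf : measurable_fun X f) (f1 : forall x, X x -> `|f x| <= 1).
Hypothesis hrho : forall A, measurable A -> (rho A = \int[P]_(z in A) (tilt Omega f z)%:E)%E.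
Variables (N : nat) (a : R) (q : 'I_d -> R) (A : R) (sg : {ffun 'I_d -> 'I_N} -> bool).
Hypotheses (a1 : 1 <= a) (A0 : 0 <= A).
Hypothesis cube : forall x : row, (forall l, q l <= x ord0 l <= q l + N%:R / a) -> X x.
Notation g := (bump_sum a q (fun j => A * label (sg j))).

(** The sign with which the classifier h agrees best on the cell j, bumps being taken as
    weights. *)
Definition cell_vote (h : row -> R) (j : {ffun 'I_d -> 'I_N}) : bool :=
  0 <= mean (fun x => label (0 <= h x) * cell_bump a q j x).

Let label1 b : `|label b| = 1 :> R.
Proof. by rewrite /label; case: b; rewrite ?normrN normr1. Qed.

(** The rule sign f is at least as good as the rule sign g; replacing f by g in the
    difference of the risks costs the mean of |g - f|. What remains is the mean of (|g| -
    sign(h) g) / 2, which is nonnegative and, on a cell where sg differs from the vote, at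
    least half the mass of the bump times A. *)
Lemma excess_risk_ge (h : row -> R) : measurable_fun X h ->
  v^-1 * (A / 2 * (expR (- 16) / (4 * a)) ^+ d * #|[pred j | sg j != cell_vote h j]|%:R -
    Num.sqrt (v * L2dot (g - f) (g - f))) <=
  risk Omega rho h - risk Omega rho f.
Proof.
move=> mh; rewrite !(tilted_risk Xfin hP mf f1 hrho)// -mulrBr.
apply: ler_wpM2l; first by rewrite invr_ge0 ltW.
have ml (u : row -> R) : measurable_fun X u -> measurable_fun X (fun x => label (0 <= u x) : R).
  move=> mu; apply: (measurableT_comp (f := label)) => //; exact: measurable_fun_ler.
pose U (u : row -> R) x := (1 - label (0 <= u x) * f x) / 2.
have UE u : (\int[lebd]_(x in X) ((1 - label (0 <= u x) * f x) / 2))%R = mean (U u).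
  by apply: eq_Rintegral => x _; rewrite mulr1.
rewrite !UE.
have LU u : measurable_fun X u -> L2 (U u).
  move=> mu; have [] // := L2_bounded Xfin (f := U u) (M := 1).
    by apply: measurable_funM => //; apply: measurable_funB => //; apply: measurable_funM => //; exact: ml.
  move=> x Xx; have := f1 Xx; rewrite /U !ler_norml /label => /andP[h1 h2].
  by case: ifP => _; lra.
have Lg : L2 g by exact: bump_sum_L2.
have Lf : L2 f by have [] := L2_bounded Xfin mf f1.
pose w (j : {ffun 'I_d -> 'I_N}) x := (cell_bump a q j - label (sg j) *: (fun x => label (0 <= h x) * cell_bump a q j x)) x.
have Lc (j : {ffun 'I_d -> 'I_N}) : L2 (cell_bump a q j) by exact: cell_bump_L2.
have Llc j : L2 (fun x => label (0 <= h x) * cell_bump a q j x).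
  have [] // := L2_bounded Xfin (f := fun x => label (0 <= h x) * cell_bump a q j x) (M := 1).
    apply: measurable_funM; first exact: ml.
    by apply: measurable_funTS; exact: measurable_cell_bump.
  by move=> x _; rewrite normrM label1 mul1r ger0_norm ?cell_bump_ge0// cell_bump_le1.
have Lw j : L2 (w j) by apply: L2B => //; exact: L2Z.
have Lgf : L2 (g - f) by exact: L2B.
have Lngf : L2 (fun x => `|(g - f) x|).
  split; first by apply: measurableT_comp => //; exact: Lgf.1.
  rewrite (_ : L2sq _ _ = L2sq Omega (g - f)); first exact: Lgf.2.
  by apply: eq_integral => x _; rewrite real_normK// num_real.
pose W := \sum_(j : {ffun 'I_d -> 'I_N}) (A / 2) *: w j.
have LW : L2 W by apply: (L2_sum Xfin) => j; exact: L2Z.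
have WE x : W x = (A * \sum_(j : {ffun 'I_d -> 'I_N}) cell_bump a q j x - label (0 <= h x) * g x) / 2.
  rewrite /W fct_sumE bump_sumE !mulr_sumr -sumrB mulr_suml; apply: eq_bigr => j _.
  rewrite (_ : ((A / 2) *: w j) x = A / 2 * (cell_bump a q j x -
    label (sg j) * (label (0 <= h x) * cell_bump a q j x)))//.
  by field.
apply: (@le_trans _ _ (mean (W - (fun x => `|(g - f) x|)))).
  rewrite (L2dotBl LW Lngf L2_1); apply: lerB; last exact: mean_normr_le.
  rewrite /W L2dot_suml//.
  rewrite -sum1_card natr_sum mulr_sumr [leLHS]big_mkcond/=; apply: ler_sum => j _.
  have E : mean (w j) = mean (cell_bump a q j) -
      label (sg j) * mean (fun x => label (0 <= h x) * cell_bump a q j x).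
    by rewrite L2dotBl ?L2dotZl//; exact: L2Z.
  case: ifPn => [sj|_]; last first.
    rewrite mulr_ge0 ?divr_ge0//.
    rewrite (_ : 0 = mean (0 : row -> R)); last by rewrite L2dot0l.
    apply: mean_le => //; first exact: L20.
    move=> x Xx; rewrite (_ : w j x = cell_bump a q j x -
      label (sg j) * (label (0 <= h x) * cell_bump a q j x))// [leLHS](_ : _ = 0)//.
    have := cell_bump_ge0 a q j x; rewrite /label; case: (sg j); case: (0 <= h x) => /=; lra.
  rewrite mulr1; apply: ler_wpM2l; first by rewrite divr_ge0.
  have Phi : (expR (- 16) / (4 * a)) ^+ d <= mean (cell_bump a q j).
    apply: (le_trans (cell_bump_mass Xfin a1 j cube)).
    by rewrite le_eqVlt; apply/orP; left; apply/eqP/eq_Rintegral => x _; rewrite mulr1.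
  rewrite E; apply: (le_trans Phi); rewrite lerDl oppr_ge0.
  move: sj; rewrite inE; case: (boolP (cell_vote h j)) => hm; case: (sg j) => //= _.
    by rewrite mulN1r oppr_le0.
  by rewrite mul1r ltW// ltNge.
have [LUh LUf] : L2 (U h) /\ L2 (U f) by split; exact: LU.
rewrite -(L2dotBl LUh LUf L2_1); apply: mean_le; [exact: L2B|exact: L2B|].
move=> x Xx; rewrite [leLHS](_ : _ = W x - `|g x - f x|)// WE -(normr_bump_sum _ _ sg)//.
rewrite [leRHS](_ : _ = U h x - U f x)// /U.
have fE : label (0 <= f x) * f x = `|f x|.
  by rewrite /label; case: (leP 0 (f x)) => h0; [rewrite mul1r ger0_norm|rewrite mulN1r ltr0_norm].
rewrite fE.
have key (u y z p t : R) : u <= y + z -> t - p <= y -> (u - p) / 2 - y <= (1 - t) / 2 - (1 - z) / 2.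
  by move=> *; lra.
apply: key; first by rewrite -[X in `|X| <= _](subrK (f x)); exact: ler_normD.
by rewrite -mulrBr; apply: (le_trans (ler_norm _)); rewrite normrM label1 mul1r distrC.
Qed.

End excess.

Section hypercube.
Context d (T : measurableType d) (R : realType) (P : probability T R) (J : finType) (n : nat).
Notation cube := {ffun J -> bool}.
Variables (L : cube -> T -> R) (rho : cube -> probability T R) (Y : set T).
Variables (good : cube -> set (n.-tuple T)) (b : n.-tuple T -> J -> bool) (E : cube -> R) (delta : R).
Hypotheses (mL : forall s, measurable_fun setT (L s)) (L0 : forall s z, 0 <= L s z).
Hypothesis rhoE : forall s A, measurable A -> (rho s A = \int[P]_(z in A) (L s z)%:E)%E.
Hypotheses (mY : measurable Y) (rhoY : forall s, rho s Y = 1%E).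
Hypothesis LE : forall s, (\int[P]_z (L s z ^+ 2)%:E = (E s)%:E)%E.
Hypothesis En : forall s, E s ^+ n <= (21/20) ^+ #|J|.
Hypothesis goodP : forall s t, (forall i, Y (tnth t i)) -> ~ good s t ->
  (8 * #|[pred j | s j != b t j]| < #|J|)%N.
Hypothesis deltaP : (21/22) ^+ #|J| + (33/40) ^+ #|J| < delta.

Let one_prod (m : probability T R) (Z : set T) : measurable Z -> m Z = 1%E ->
  (\int[mpow m n]_t (\prod_i \1_Z (tnth t i))%:E = 1)%E.
Proof.
move=> mZ mZ1; rewrite (ge0_integral_mpow_prod m (f := fun=> \1_Z)).
- by rewrite big1// => i _; rewrite integral_indic// setIT.
- by move=> i; exact: measurable_indic.
- by move=> i x; rewrite indicE.
Qed.

(** Suppose that every good event has a probability below 1 - delta. Then a measurable cover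
    of it leaves out an event of probability above delta, on which s is close to the vote b
    in the Hamming distance. At each sample these events hold for at most (3/2)^M vectors s,
    M = #|J|, and the change of measure at t = (11/10)^M bounds the average of their
    probabilities by (21/22)^M + (33/40)^M. *)
Lemma hypercube_lower_bound : exists s, ((1 - delta)%:E <= (mpow (rho s) n)^*%mu (good s))%E.
Proof.
apply: contrapT => /forallNP H.
have /choice[G hG] s : exists G, [/\ measurable G, good s `<=` G & (mpow (rho s) n G < (1 - delta)%:E)%E].
  have /negP := H s; rewrite -ltNge => /outer_measure_cover[G mG [sG GG]].
  by exists G.
pose Yn : set (n.-tuple T) := [set t | forall i, Y (tnth t i)].
have mYn : measurable Yn.
  rewrite (_ : Yn = \bigcap_(i in [set: 'I_n]) ((fun t => tnth t i) @^-1` Y)).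
    apply: fin_bigcap_measurable => // i _; rewrite -[X in measurable X]setTI.
    exact: measurable_tnth.
  by apply/seteqP; split => t /= h i; [move=> _|]; apply: h.
pose Bad s := ~` G s `&` Yn.
have mBad s : measurable (Bad s) by apply: measurableI => //; apply: measurableC; have [] := hG s.
pose Ln s (t : n.-tuple T) := \prod_i L s (tnth t i).
have mLn s : measurable_fun setT (Ln s).
  exact: (measurable_tuple_prod (f := fun=> L s)).
have Ln0 s t : 0 <= Ln s t by apply: prodr_ge0.
pose M := #|J|.
have bound : (\sum_s \int[mpow P n]_(t in Bad s) (Ln s t)%:E <=
   (#|{: cube}|%:R * ((21/20) ^+ M / (11/10) ^+ M) + (11/10) ^+ M * (3/2) ^+ M)%:E)%E.
  apply: average_change_of_measure => //.
  - have := one_prod (m := P) measurableT (@probability_setT _ _ _ P).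
    move=> <-; rewrite -[LHS]mul1e -integral_cst//; apply: eq_integral => t _.
    by rewrite big1// => i _; rewrite indicE in_setT.
  - move=> s; rewrite (_ : (\int[mpow P n]_x _)%E = ((E s) ^+ n)%:E) ?lee_fin//.
    rewrite (eq_integral (fun t => (\prod_i (fun z => L s z ^+ 2) (tnth t i))%:E)); last first.
      by move=> t _; rewrite /Ln prodrXl.
    rewrite (ge0_integral_mpow_prod P (f := fun=> fun z => L s z ^+ 2)).
    + by under eq_bigr do rewrite LE; rewrite -[n in RHS]card_ord -prodr_const prodEFin.
    + by move=> i; exact: measurable_funX.
    + by move=> i x; exact: sqr_ge0.
  - move=> t; apply: le_trans (hamming_ball_card (b t)).
    rewrite -sum1_card natr_sum [leRHS]big_mkcond/=; apply: ler_sum => s _.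
    rewrite indicE; case: (boolP (t \in Bad s)) => [/set_mem[nG Yt]|_]; last by case: ifP.
    rewrite inE goodP// => gst; apply: nG; have [_ + _] := hG s; exact.
have lower s : (delta%:E < \int[mpow P n]_(t in Bad s) (Ln s t)%:E)%E.
  rewrite /Ln -(measure_mpow_density (mu := P) (nu := rho s) (mL s) (L0 s) (rhoE s))//.
  have [mG _ lt] := hG s.
  have one := one_prod (m := rho s) mY (rhoY s).
  have le1 : (1 <= mpow (rho s) n (G s) + mpow (rho s) n (Bad s))%E.
    rewrite -[leLHS]one -(setIT (G s)) -(setIT (Bad s)) -!integral_indic//.
    have mI (B : set (n.-tuple T)) : measurable B ->
        measurable_fun setT (fun t => (\1_B t)%:E : \bar R).
      by move=> mB; apply/measurable_EFinP; exact: measurable_indic.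
    rewrite -ge0_integralD//; [|exact: mI|exact: mI].
    apply: ge0_le_integral => //; [| | |].
    + by move=> t _; rewrite lee_fin prodr_ge0// => i _; rewrite indicE.
    + apply/measurable_EFinP; apply: (measurable_tuple_prod (f := fun=> \1_Y)) => i; exact: measurable_indic.
    + by apply: emeasurable_funD; exact: mI.
    move=> t _; rewrite -EFinD lee_fin !indicE.
    have [Yt|nYt] := pselect (Yn t); last first.
      have [i nYi] : exists i, ~ Y (tnth t i) by apply/existsNP.
      by rewrite (bigD1 i)//= indicE memNset// mul0r addr_ge0.
    rewrite big1; last by move=> i _; rewrite indicE mem_set.
    have [Gt|nGt] := pselect (G s t); first by rewrite mem_set// lerDl.
    by rewrite [t \in Bad s]mem_set// lerDr.
  have fG : mpow (rho s) n (G s) \is a fin_num by rewrite ge0_fin_numE// (lt_trans lt) ?ltry.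
  move: le1 lt; rewrite -(fineK fG); case: (mpow _ n (Bad s)) => [x| |]//.
    by rewrite -EFinD !(lee_fin, lte_fin) => h1 h2; lra.
  by rewrite ltry.
have : (\sum_(s : cube) delta%:E <= \sum_s \int[mpow P n]_(t in Bad s) (Ln s t)%:E)%E.
  by apply: lee_sum => s _; exact: ltW.
rewrite sumEFin => /le_trans /(_ bound); rewrite lee_fin sumr_const card_ffun card_bool natrX.
apply/negP; rewrite -ltNge -[delta *+ _]mulr_natr natrX [delta * _]mulrC.
have -> : (11/10) ^+ M * (3/2) ^+ M = 2 ^+ M * (33/40) ^+ M :> R.
  by rewrite -!exprMn; congr (_ ^+ _); field.
have -> : (21/20) ^+ M / (11/10) ^+ M = (21/22) ^+ M :> R.
  by rewrite -expr_div_n; congr (_ ^+ _); field.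
by rewrite -mulrDr ltr_pM2l// exprn_gt0.
Qed.

End hypercube.

(** * The hypotheses on a grid *)

Lemma sqr_divrK {R : realType} (a0 p : R) : 0 < p -> (a0 / p) ^+ 2 * p ^+ 2 = a0 ^+ 2.
Proof. by move=> p0; rewrite -exprMn mulfVK// gt_eqF. Qed.

Section grid_hypotheses.
Context {R : realType} {d : nat} (Omega : set 'rV[R]_d).
Let X := closure Omega.
Hypothesis X0 : (0 < @leb R d X)%E.
Hypothesis Xfin : (@leb R d X < +oo)%E.
Notation row := 'rV[R]_d.
Notation L2dot := (L2dot Omega).
Let mX := measurable_closure Omega.
Let v := fine (@leb R d X).
Let vE : @leb R d X = v%:E. Proof. by rewrite fineK// ge0_fin_numE. Qed.
Let v0 : 0 < v. Proof. by rewrite -lte_fin -vE. Qed.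
Variables (r K : R) (k : row -> row -> R) (lam : nat -> R) (e : nat -> row -> R).
Hypotheses (hk : reproducing_kernel Omega r k) (hm : mercer_expansion Omega lam e k).
Hypothesis r0 : 0 < r.
Hypothesis K0 : 0 < K.
Hypothesis hK : forall f x, HrRKHS Omega r f -> X x -> f x ^+ 2 <= K * Hn Omega r f.
Variable C1 : R.
Hypothesis C10 : 0 < C1.
Hypothesis hC1 : forall N (a : R) (q : 'I_d -> R) (c : {ffun 'I_d -> 'I_N} -> R) A,
  1 <= a -> 0 <= A -> (forall j, `|c j| <= A) ->
  HrRKHS Omega r (bump_sum a q c) /\
  (Hsq Omega r (bump_sum a q c) <= (C1 * A ^+ 2 * a `^ (2 * r))%:E)%E.
Variables (s B ep a0 : R).
Hypotheses (s0 : 0 < s) (B0 : 0 < B) (ep0 : 0 < ep) (ep1 : ep <= 1) (a00 : 0 < a0) (a01 : a0 <= 1).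
Hypothesis a0B : ep `^ (- s) * (a0 ^+ 2 * (v + C1)) <= B ^+ 2.
Hypothesis a0K : K * (C1 * a0 ^+ 2) <= 1.
Variables (N : nat) (a : R) (q : 'I_d -> R).
Hypothesis a1 : 1 <= a.
Notation A := (a0 / a `^ (r * s)).
Implicit Types sg : {ffun {ffun 'I_d -> 'I_N} -> bool}.
Notation g sg := (bump_sum a q (fun j => A * label (sg j))).

(** With p = a^(r s), the threshold tau = ep a^(-2 r) satisfies tau^(-s) = ep^(-s) p^2,
    which cancels the factor p^(-2) of A^2 in the bound of [spectral_approx]; and tau
    |g|_H^2 is at most ep C1 A^2. *)
Lemma power_space_hypothesis sg : exists f : row -> R,
  [/\ L2 Omega f, forall x, X x -> `|f x| <= 1,
      L2dot (g sg - f) (g sg - f) <= ep * (C1 + 1) * A ^+ 2 &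
      L2dot f f <= v * A ^+ 2] /\
  (power_space Omega lam e s f /\ (power_norm Omega lam e s f <= B%:E)%E).
Proof.
have apos : 0 < a by apply: lt_le_trans a1.
set p := a `^ (r * s); have p0 : 0 < p by exact: powR_gt0.
have p1 : 1 <= p by rewrite -[leLHS](powRr0 a); apply: ler_powR => //; rewrite mulr_ge0 ?ltW.
have A0 : 0 < a0 / p by rewrite divr_gt0.
have A1 : a0 / p <= 1 by rewrite ler_pdivrMr// mul1r (le_trans a01).
have lA (j : {ffun 'I_d -> 'I_N}) : `|a0 / p * label (sg j)| <= a0 / p.
  by rewrite normrM (gtr0_norm A0) /label; case: (sg j); rewrite ?normrN normr1 mulr1.
have [Hg Hle] := hC1 q a1 (ltW A0) lA.
have Lg : L2 Omega (g sg) by have [] := Hg.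
have gA x : `|g sg x| <= a0 / p by apply: bump_sum_le => //; exact: ltW.
have gg : L2dot (g sg) (g sg) <= v * (a0 / p) ^+ 2.
  have [_ +] := L2_bounded Xfin Lg.1 (fun x _ => gA x).
  by rewrite (L2sqE Lg) vE -EFinM lee_fin [v * _]mulrC.
rewrite (Hn_E Hg) lee_fin in Hle.
pose w := a `^ (2 * r); have w0 : 0 < w by exact: powR_gt0.
pose tau := ep / w; have tau0 : 0 < tau by rewrite divr_gt0.
have tauH : tau * Hn Omega r (g sg) <= ep * (C1 * (a0 / p) ^+ 2).
  rewrite /tau mulrAC ler_pdivrMr// -mulrA; apply: ler_wpM2l; first exact: ltW.
  exact: Hle.
have eA0 : 0 < ep * (a0 / p) ^+ 2 by rewrite mulr_gt0// exprn_gt0.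
have g1 : s <= 1 -> forall x, X x -> `|g sg x| <= 1 by move=> _ x _; exact: le_trans (gA x) A1.
have gH : 1 < s -> K * Hn Omega r (g sg) <= 1 ^+ 2.
  move=> s1; rewrite expr1n; apply: le_trans a0K; apply: ler_wpM2l; first exact: ltW.
  apply: (le_trans Hle); rewrite -mulrA; apply: ler_wpM2l; first exact: ltW.
  rewrite -[leRHS](sqr_divrK a0 p0); apply: ler_wpM2l; first exact: sqr_ge0.
  rewrite -(powR_mulrn 2 (ltW p0)) -powRrM; apply: ler_powR => //.
  have : r * 1 <= r * s by apply: ler_wpM2l; apply: ltW.
  lra.
have [f [c [[Lf f1 gf ff] [ex sums]]]] :=
  spectral_approx X0 Xfin hk hm K0 hK s0 tau0 eA0 ler01 Hg g1 gH.
exists f; split; [split => //|].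
- apply: (le_trans gf); rewrite mulrDr mulr1 mulrDl; apply: lerD => //.
  by rewrite -mulrA.
- exact: le_trans ff gg.
split; first by exists c.
apply: (power_norm_le (ltW B0) ex) => n; apply: (le_trans (sums n)); apply: le_trans a0B.
have tauE : tau `^ (- s) = ep `^ (- s) * p ^+ 2.
  rewrite /tau powRM ?invr_ge0 ?ltW//; congr (_ * _).
  rewrite -(powR_inv1 (ltW w0)) -powRrM mulN1r opprK -(powR_mulrn 2 (ltW p0)) -!powRrM.
  by congr (_ `^ _); ring.
rewrite tauE -mulrA; apply: ler_wpM2l; first exact: powR_ge0.
rewrite -(sqr_divrK a0 p0) [X in _ <= X * _]mulrC -[leRHS]mulrA; apply: ler_wpM2l; first exact: sqr_ge0.
rewrite mulrDr [_ * v]mulrC; apply: lerD => //; apply: (le_trans tauH).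
rewrite [leRHS]mulrC -[leRHS]mul1r; apply: ler_wpM2r => //.
by rewrite mulr_ge0 ?ltW// exprn_gt0.
Qed.

Variables (L mumin mumax delta : R) (n : nat).
Variable fhat : n.-tuple (row * bool)%type -> row -> R.
Notation kap := ((expR (- 16) * L / 4) ^+ d).
Hypothesis hmu : mumin <= v^-1 <= mumax.
Hypotheses (L0 : 0 < L) (aE : a = N%:R / L).
Hypothesis cube : forall x : row, (forall l, q l <= x ord0 l <= q l + L) -> X x.
Hypothesis sepP : v * (ep * (C1 + 1)) <= (kap / 32) ^+ 2.
Hypothesis nP : (1 + A ^+ 2) ^+ n <= (21/20) ^+ (N ^ d).
Hypothesis deltaP : (21/22) ^+ (N ^ d) + (33/40) ^+ (N ^ d) < delta.
Hypothesis mfhat : forall S, (forall i, X (tnth S i).1) -> measurable_fun X (fhat S).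

(** Up to the factor 1 / v, votes that are wrong on an eighth of the cells cost kap A / 16,
    and the approximation of g by f at most half of it by the choice of ep. *)
Lemma hard_distribution : exists (rho : probability (row * bool)%type R) (eta : row -> R),
  distr_class Omega lam e s B mumin mumax rho eta /\
  ((1 - delta)%:E <= (mpow rho n)^*%mu
    [set S | (v^-1 * (kap / 32) * A <= excess_risk Omega rho eta (fhat S))%R])%E.
Proof.
have apos : 0 < a by apply: lt_le_trans a1.
have A0 : 0 < A by rewrite divr_gt0// powR_gt0.
have Npos : 0 < N%:R :> R by move: apos; rewrite aE pmulr_lgt0// invr_gt0.
have /choice[f hf] := power_space_hypothesis.
have mf sg : measurable_fun X (f sg) by have [[[]]] := hf sg.
have f1 sg x : X x -> `|f sg x| <= 1 by have [[_ + _ _] _] := hf sg; apply.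
have [P hP] := fair_model X0 Xfin.
have /choice[rho hrho] sg := tilted_probability X0 Xfin hP (mf sg) (f1 sg).
have cJ : #|{ffun 'I_d -> 'I_N}| = (N ^ d)%N by rewrite card_ffun !card_ord.
pose eta sg x := (1 + f sg x) / 2.
have bE sg : bayes (eta sg) = f sg by apply/funext => x; rewrite /bayes /eta; field.
pose good sg : set (n.-tuple (row * bool)%type) :=
  [set S | v^-1 * (kap / 32) * A <= excess_risk Omega (rho sg) (eta sg) (fhat S)].
have [sg hsg] : exists sg, ((1 - delta)%:E <= (mpow (rho sg) n)^*%mu (good sg))%E.
  apply: (hypercube_lower_bound (P := P) (L := fun sg => tilt Omega (f sg)) (Y := X `*` setT)
    (b := fun S => cell_vote Omega a q (fhat S)) (E := fun sg => 1 + v^-1 * L2dot (f sg) (f sg))).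
  - by move=> sg; apply: measurable_tilt.
  - by move=> sg z; apply: tilt_ge0; exact: f1.
  - exact: hrho.
  - exact: measurableX.
  - by move=> sg; apply: (tilted_concentrated X0 Xfin hP (mf sg) (f1 sg) (hrho sg)).
  - by move=> sg; apply: (tilt_sqr_integral X0 Xfin hP); have [[]] := hf sg.
  - move=> sg; rewrite cJ; apply: le_trans nP; apply: lerXn2r.
    + rewrite nnegrE addr_ge0// mulr_ge0 ?invr_ge0 ?(ltW v0)//.
      by apply: L2dot_ge0; have [[]] := hf sg.
    + by rewrite nnegrE addr_ge0// sqr_ge0.
    rewrite lerD2l; have [[_ _ _ ff] _] := hf sg.
    by rewrite ler_pdivrMl.
  - move=> sg S XS; apply: contra_notT; rewrite -leqNgt cJ => NJ.
    have mh : measurable_fun X (fhat S) by apply: mfhat => i; have [] := XS i.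
    rewrite /good/= /excess_risk bE.
    have cube' (x : row) : (forall l, q l <= x ord0 l <= q l + N%:R / a) -> X x.
      by rewrite aE invf_div mulrC divfK ?gt_eqF//; exact: cube.
    have ge := excess_risk_ge X0 Xfin hP (mf sg) (f1 sg) (hrho sg) sg a1 (ltW A0) cube' mh; apply: le_trans ge.
    rewrite -mulrA; apply: ler_wpM2l; first by rewrite invr_ge0 ltW.
    (* N^d cells of volume a^(-d) fill the cube of side L. *)
    have kE : (expR (- 16) / (4 * a)) ^+ d * (N ^ d)%:R = kap.
      rewrite natrX -exprMn aE; congr (_ ^+ _); field.
      by rewrite !gt_eqF.
    have k0 : 0 <= (expR (- 16) / (4 * a)) ^+ d by rewrite exprn_ge0// divr_ge0 ?expR_ge0// mulr_ge0// ltW.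
    have kap0 : 0 <= kap by rewrite -kE mulr_ge0.
    have h1 : kap / 16 * A <= A / 2 * (expR (- 16) / (4 * a)) ^+ d * #|[pred j | sg j != cell_vote Omega a q (fhat S) j]|%:R.
      have : (N ^ d)%:R <= 8 * #|[pred j | sg j != cell_vote Omega a q (fhat S) j]|%:R :> R.
        by rewrite -natrM ler_nat.
      have key (b c u w : R) : b * w <= b * (c * (8 * u)) -> w / 16 * b <= b / 2 * c * u by move=> ?; lra.
      by move=> /(ler_wpM2l k0); rewrite kE => /(ler_wpM2l (ltW A0)); exact: key.
    have [[Lf _ gf _] _] := hf sg.
    have h2 : Num.sqrt (v * L2dot (g sg - f sg) (g sg - f sg)) <= kap / 32 * A.
      have kA : 0 <= kap / 32 * A by rewrite mulr_ge0 ?(ltW A0)// divr_ge0.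
      rewrite -[leRHS](ger0_norm kA) -sqrtr_sqr ler_sqrt ?sqr_ge0// exprMn.
      apply: le_trans (ler_wpM2l (ltW v0) gf) _; rewrite mulrA.
      by apply: ler_wpM2r => //; exact: sqr_ge0.
    by move: h1 h2; lra.
  - by rewrite cJ.
exists (rho sg), (eta sg); split => //; split.
- exists (cst v^-1); last exact: (tilted_has_density hP (mf sg) (f1 sg) (hrho sg)).
  split => //.
  rewrite (_ : \int[_]_(x in _) _ = \int[@leb R d]_(x in X) cst (v^-1)%:E x)%E//.
  rewrite integral_cst//; transitivity ((v^-1)%:E * v%:E)%E; first by congr (_ * _)%E; exact: vE.
  by rewrite -EFinM mulVf// gt_eqF.
- exact: (tilted_cond_prob hP (mf sg) (f1 sg) (hrho sg)).
- by rewrite bE; have [_ []] := hf sg.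
- by rewrite bE; have [_ []] := hf sg.
Qed.

End grid_hypotheses.

(** * The choice of the grid and the rate *)

(** Integrating the bounds on p gives mumin v <= 1 <= mumax v for the volume v of X. *)
Lemma density_volume {R : realType} d (Omega : set 'rV[R]_d) mumin mumax p :
  0 < mumin -> prob_density Omega mumin mumax p ->
  [/\ (0 < @leb R d (closure Omega))%E, (@leb R d (closure Omega) < +oo)%E &
      mumin <= (fine (@leb R d (closure Omega)))^-1 <= mumax].
Proof.
move=> m0 [mp hp p1]; set X := closure Omega; have mX : measurable X := measurable_closure Omega.
have cstE (c : R) : (\int[@leb R d]_(x in X) c%:E = c%:E * @leb R d X)%E.
  by rewrite -integral_cst.
have lo : (mumin%:E * @leb R d X <= 1)%E.
  rewrite -cstE -p1; apply: ge0_le_integral => //.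
  - by move=> x _; rewrite lee_fin ltW.
  - exact/measurable_EFinP.
  - by move=> x Xx; rewrite lee_fin; have /andP[] := hp x Xx.
have hi : (1 <= mumax%:E * @leb R d X)%E.
  rewrite -cstE -p1; apply: ge0_le_integral => //.
  - by move=> x Xx; rewrite lee_fin; have /andP[+ _] := hp x Xx; apply: le_trans; exact: ltW.
  - exact/measurable_EFinP.
  - by move=> x Xx; rewrite lee_fin; have /andP[] := hp x Xx.
have Xfin : (@leb R d X < +oo)%E.
  rewrite ltey; apply: contraTneq lo => ->; rewrite gt0_muley ?lte_fin//.
have X0 : (0 < @leb R d X)%E.
  rewrite lt0e measure_ge0 andbT; apply: contraTneq hi => ->.
  by rewrite mule0 -ltNge lte_fin.
have fX : @leb R d X \is a fin_num by rewrite ge0_fin_numE.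
have v0 : 0 < fine (@leb R d X) by rewrite fine_gt0// X0.
split => //; rewrite -(fineK fX) -EFinM lee_fin in lo; rewrite -(fineK fX) -EFinM lee_fin in hi.
by rewrite -[X in _ <= X <= _]mul1r ler_pdivlMr// lo ler_pdivrMr.
Qed.

Lemma cube_in_open {R : realType} d (Omega : set 'rV[R]_d) : Omega !=set0 -> open Omega ->
  exists (q : 'I_d -> R) (L : R), 0 < L /\
    forall x : 'rV[R]_d, (forall l, q l <= x ord0 l <= q l + L) -> Omega x.
Proof.
move=> [x0 Ox0] oO; have /nbhs_ballP[e e0 he] : nbhs x0 Omega by exact: open_nbhs_nbhs.
exists (x0 ord0), (e / 2); split; first by rewrite divr_gt0.
move=> x hx; apply: he; split => // i l; rewrite ord1 /ball/= distrC ltr_norml.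
have key (u w : R) : 0 < e -> w <= u <= w + e / 2 -> - e < u - w < e.
  by move=> ? /andP[? ?]; apply/andP; split; lra.
by apply: key => //; exact: hx.
Qed.

(** The number of cells per direction is rounded up so that a = N / L reaches (c n)^(1/D);
    this at most doubles a if n is large. *)
Lemma grid_choice {R : realType} (d : nat) (L D c delta : R) : (0 < d)%N ->
  0 < L -> 0 < D -> 0 < c -> 0 < delta ->
  \forall n \near \oo, exists N : nat, [/\ 1 <= N%:R / L, c * n%:R <= (N%:R / L) `^ D,
    N%:R / L <= 2 * (c * n%:R) `^ D^-1 & (21/22) ^+ (N ^ d) + (33/40) ^+ (N ^ d) < delta].
Proof.
move=> d0 L0 D0 c0 delta0.
have [M0 hM0] : exists M0, forall M, (M0 <= M)%N -> (21/22) ^+ M + (33/40) ^+ M < delta.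
  have cv : ((21/22) ^+ M + (33/40) ^+ M : R) @[M --> \oo] --> (0 + 0 : R).
    by apply: cvgD; apply: cvg_expr; rewrite ger0_norm; lra.
  rewrite addr0 in cv; have [M0 _ hM] := cvgr_lt _ cv _ delta0.
  by exists M0.
pose Y := 1 + L^-1 + M0%:R / L.
have Li : 0 < L^-1 by rewrite invr_gt0.
have Y1 : [/\ 1 <= Y, L^-1 <= Y & M0%:R / L <= Y].
  have : 0 <= M0%:R / L by rewrite divr_ge0// ltW.
  by rewrite /Y => ?; split; lra.
have Y0 : 0 < Y by case: Y1; lra.
near=> n.
have nY : Y `^ D <= c * n%:R.
  rewrite mulrC -ler_pdivrMr//; near: n; exact: nbhs_infty_ger.
pose y := (c * n%:R) `^ D^-1.
have cn0 : 0 <= c * n%:R by rewrite mulr_ge0// ltW.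
have yY : Y <= y.
  rewrite -[Y](powRr1 (ltW Y0)) -(mulfV (lt0r_neq0 D0)) powRrM.
  by apply: ge0_ler_powR => //; rewrite ?nnegrE ?invr_ge0 ?powR_ge0 ?(ltW D0).
have y0 : 0 < y by apply: lt_le_trans yY.
exists (Num.truncn (L * y)).+1.
have Ly0 : 0 <= L * y by rewrite mulr_ge0// ltW.
have lo : y <= (Num.truncn (L * y)).+1%:R / L.
  by rewrite ler_pdivlMr// mulrC ltW// truncnS_gt.
have [Y1a Y1b Y1c] := Y1.
split.
- by apply: le_trans lo; apply: le_trans yY.
- have -> : c * n%:R = y `^ D by rewrite /y -powRrM mulVf ?gt_eqF// powRr1.
  by apply: ge0_ler_powR => //; rewrite ?nnegrE ?(ltW D0) ?(ltW y0)// divr_ge0// ltW.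
- rewrite -natr1 mulrDl mul1r -/y.
  have : (Num.truncn (L * y))%:R / L <= y.
    by rewrite ler_pdivrMr// [y * L]mulrC truncn_le.
  have : L^-1 <= y by apply: le_trans yY.
  lra.
apply: hM0; apply: (@leq_trans (Num.truncn (L * y)).+1); last first.
  by rewrite -[leqLHS]expn1 leq_pexp2l.
rewrite -(ler_nat R) -(ler_pM2r Li); apply: le_trans lo; exact: le_trans yY.
Unshelve. all: by end_near.
Qed.


Theorem theorem3p1 (R : realType) (d : nat) (Omega : set 'rV[R]_d)
    (r s B mumin mumax : R) (k : 'rV[R]_d -> 'rV[R]_d -> R)
    (lam : nat -> R) (e : nat -> 'rV[R]_d -> R)
    (hd : (0 < d)%N) (hOmega : smooth_bounded_domain Omega)
    (hr : d%:R / 2 < r) (hs : 0 < s) (hB : 0 < B)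
    (hmumin : 0 < mumin) (hmu : mumin <= mumax)
    (hdens : exists p, prob_density Omega mumin mumax p)
    (hk : reproducing_kernel Omega r k)
    (hmercer : mercer_expansion Omega lam e k) :
  let beta := 2 * r / d%:R in
  exists2 C : R, 0 < C &
    forall fhat : (forall n : nat, n.-tuple ('rV[R]_d * bool)%type -> 'rV[R]_d -> R),
    learning_method Omega fhat ->
    forall delta : R, 0 < delta < 1 ->
    \forall n \near \oo,
      exists (rho : probability ('rV[R]_d * bool)%type R) (eta : 'rV[R]_d -> R),
        distr_class Omega lam e s B mumin mumax rho eta /\
        ((1 - delta)%:E <=
          (mpow rho n)^*%mu
            [set S : n.-tuple ('rV[R]_d * bool)%type |
              (C * delta * n%:R `^ (- (s * beta / (2 * (s * beta + 1)))) <=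
               excess_risk Omega rho eta (fhat n S))%R])%E.
Proof.
move=> beta; have [p hp] := hdens.
have [X0 Xfin hv] := density_volume hmumin hp.
set v := fine _ in hv.
have v0 : 0 < v by rewrite fine_gt0// X0.
have dR : 0 < d%:R :> R by rewrite ltr0n.
have r0 : 0 < r by apply: lt_trans hr; rewrite divr_gt0.
have [On0 oO _ _ _] := hOmega.
have [K K0 hK] := sup_bound Xfin r0 hr hOmega.
have [C1 C10 hC1] := bump_sum_Hsq Xfin r0.
have [q [L [L0 cubeO]]] := cube_in_open On0 oO.
have cubeX (x : 'rV[R]_d) : (forall l, q l <= x ord0 l <= q l + L) -> closure Omega x.
  by move=> hx; apply: subset_closure; exact: cubeO.
pose kap : R := (expR (- 16) * L / 4) ^+ d.
have kap0 : 0 < kap by rewrite exprn_gt0// divr_gt0// mulr_gt0 ?expR_gt0.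
have vC0 : 0 < v * (C1 + 1) by rewrite mulr_gt0// addr_gt0.
(* The threshold constant ep makes the error of f in L^2 small against the separation of the
   hypotheses; a0 is then small enough for the norm bound B and the bound 1 on |f|. *)
pose ep : R := Num.min 1 ((kap / 32) ^+ 2 / (v * (C1 + 1))).
have ep0 : 0 < ep by rewrite lt_min ltr01/= divr_gt0// exprn_gt0// divr_gt0.
have ep1 : ep <= 1 by rewrite ge_min lexx.
have epk : v * (ep * (C1 + 1)) <= (kap / 32) ^+ 2.
  by rewrite mulrCA -ler_pdivlMr// ge_min lexx orbT.
pose Q : R := ep `^ (- s) * (v + C1) / B ^+ 2 + K * C1.
have e0 : 0 < ep `^ (- s) * (v + C1) / B ^+ 2.
  by rewrite divr_gt0 ?exprn_gt0// mulr_gt0 ?powR_gt0// addr_gt0.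
have KC : 0 < K * C1 by rewrite mulr_gt0.
pose a0 : R := (1 + Q)^-1.
have Q0 : 0 < Q by rewrite addr_gt0.
have a00 : 0 < a0 by rewrite invr_gt0 addr_gt0.
have a01 : a0 <= 1 by rewrite invf_le1 ?addr_gt0// lerDl ltW.
have a0Q : a0 ^+ 2 * Q <= 1.
  have h1 : a0 * (1 + Q) = 1 by rewrite mulVf// gt_eqF// addr_gt0.
  have h2 : a0 * (a0 * (1 + Q)) = a0 by rewrite h1 mulr1.
  have h3 : a0 ^+ 2 * Q = a0 - a0 ^+ 2 by rewrite -[X in X - _]h2; ring.
  by rewrite h3; have := sqr_ge0 a0; lra.
have a0B : ep `^ (- s) * (a0 ^+ 2 * (v + C1)) <= B ^+ 2.
  have B2 : 0 < B ^+ 2 by rewrite exprn_gt0.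
  have le1 : a0 ^+ 2 * (ep `^ (- s) * (v + C1) / B ^+ 2) <= 1.
    apply: le_trans a0Q; apply: ler_wpM2l; first exact: sqr_ge0.
    by rewrite /Q lerDl ltW.
  move: le1; rewrite mulrA ler_pdivrMr// mul1r; apply: le_trans.
  by rewrite le_eqVlt; apply/orP; left; apply/eqP; ring.
have a0K : K * (C1 * a0 ^+ 2) <= 1.
  apply: le_trans a0Q; rewrite mulrA mulrC; apply: ler_wpM2l; first exact: sqr_ge0.
  by rewrite /Q lerDr ltW.
pose al := r * s.
have al0 : 0 < al by rewrite mulr_gt0.
(* The relation c n <= a^D amounts to n a^(-2 al) <= lg N^d, which keeps the second moment
   of the likelihood ratio below (21/20)^(N^d). *)
pose D := al * 2 + d%:R.
have D0 : 0 < D by rewrite addr_gt0// mulr_gt0.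
pose lg : R := ln (21/20).
have lg0 : 0 < lg by rewrite ln_gt0//; lra.
pose c := (lg * L ^+ d)^-1.
have c0 : 0 < c by rewrite invr_gt0 mulr_gt0// exprn_gt0.
have den0 : 0 < 2 `^ al * c `^ (al / D) by rewrite mulr_gt0 ?powR_gt0.
exists (v^-1 * (kap / 32) * (a0 / (2 `^ al * c `^ (al / D)))).
  by rewrite mulr_gt0 ?divr_gt0// mulr_gt0 ?invr_gt0// divr_gt0.
move=> fhat hfhat delta /andP[delta0 delta1].
near=> n.
have n0 : 0 < n%:R :> R by rewrite ltr0n; near: n; exact: nbhs_infty_gt.
have [N [a1 aD a2 MD]] : exists N : nat, [/\ 1 <= N%:R / L, c * n%:R <= (N%:R / L) `^ D,
    N%:R / L <= 2 * (c * n%:R) `^ D^-1 & (21/22) ^+ (N ^ d) + (33/40) ^+ (N ^ d) < delta].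
  by near: n; exact: grid_choice.
have apos : 0 < N%:R / L by apply: lt_le_trans a1.
have pw0 : 0 < (N%:R / L) `^ al by exact: powR_gt0.
have nP : (1 + (a0 / (N%:R / L) `^ (r * s)) ^+ 2) ^+ n <= (21/20) ^+ (N ^ d).
  rewrite -/al; set A := a0 / _.
  apply: (@le_trans _ _ (expR (A ^+ 2) ^+ n)).
    apply: lerXn2r; rewrite ?nnegrE ?expR_ge0 ?addr_ge0 ?sqr_ge0//.
    exact: expR_ge1Dx.
  have -> : (21/20 : R) = expR lg by rewrite lnK// posrE; lra.
  rewrite -!expRM_natl ler_expR natrX.
  have aDE : (N%:R / L) `^ D = ((N%:R / L) `^ al) ^+ 2 * (N%:R / L) ^+ d.
    rewrite /D powRD ?gt_eqF ?implybT// powRrM !powR_mulrn// ?powR_ge0//.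
    by rewrite ltW.
  have a02 : a0 ^+ 2 <= 1 by rewrite expr_le1// ltW.
  set P := (_ `^ al) in pw0 aDE A *; have P2 : 0 < P ^+ 2 by rewrite exprn_gt0.
  have Ld0 : 0 < L ^+ d by rewrite exprn_gt0.
  rewrite expr_div_n mulrA ler_pdivrMr//.
  apply: (@le_trans _ _ (n%:R * 1)); first by apply: ler_wpM2l => //; exact: ltW.
  rewrite mulr1; move: aD; rewrite aDE /c expr_div_n ler_pdivrMl ?mulr_gt0//.
  move=> /le_trans; apply; rewrite le_eqVlt; apply/orP; left; apply/eqP; field.
  by rewrite gt_eqF.
have [rho [eta [hc hout]]] := @hard_distribution _ _ Omega X0 Xfin _ _ _ _ _ hk hmercer r0 K0 hK
  C1 C10 hC1 s B ep a0 hs hB ep0 ep1 a00 a01 a0B a0K N (N%:R / L) q a1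
  L mumin mumax delta n (fhat n) hv L0 erefl cubeX epk nP MD (hfhat n).
exists rho, eta; split => //; apply: (le_trans hout); apply: le_outer_measure => S /=.
apply: le_trans; rewrite -/v -/kap -/al.
rewrite -mulrA -[leLHS]mulrA; apply: ler_wpM2l.
  by rewrite mulr_ge0 ?invr_ge0 ?(ltW v0)// divr_ge0// ltW.
have -> : s * beta / (2 * (s * beta + 1)) = al / D.
  rewrite /beta /D /al; field.
  by rewrite !gt_eqF.
have Pn : (N%:R / L) `^ al <= 2 `^ al * c `^ (al / D) * n%:R `^ (al / D).
  have cn : 0 <= c * n%:R by rewrite mulr_ge0// ltW.
  apply: (@le_trans _ _ ((2 * (c * n%:R) `^ D^-1) `^ al)).
    apply: ge0_ler_powR => //; [exact: ltW|by rewrite nnegrE; exact: ltW|].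
    by rewrite nnegrE mulr_ge0// powR_ge0.
  rewrite powRM ?powR_ge0// -powRrM [D^-1 * _]mulrC powRM ?(ltW c0)//.
  by rewrite mulrA.
have u0 : 0 < n%:R `^ (al / D) by exact: powR_gt0.
set W := 2 `^ al * _ in den0 Pn *; set u := n%:R `^ (al / D) in u0 Pn *.
rewrite powRN; apply: (@le_trans _ _ (a0 / (W * u))).
  rewrite (_ : _ / (W * u) = a0 / W / u * 1); last by rewrite mulr1 invfM mulrA.
  rewrite (_ : _ * (delta / u) = a0 / W / u * delta); last by ring.
  by apply: ler_wpM2l; [rewrite divr_ge0 ?(ltW u0)// divr_ge0// ltW|exact: ltW].
by apply: ler_wpM2l; [exact: ltW|rewrite lef_pV2 ?posrE// mulr_gt0].
Unshelve. all: by end_near.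
Qed.
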